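(* Let $m\in\{2,3,4\}$, let $a,b,c\in\mathbb{Z}$ be such that $f(x)=x^6+ax^m+bx+c$ is irreducible over $\mathbb{Q}$, and let $K=\mathbb{Q}(\theta)$ where $\theta$ is a root of $f(x)$. Suppose that $a+(-1)^m$, $b$ and $c$ are divisible by $8$, and that $m\,v_2(b)<(m-1)\,v_2(c)$. Then: (i) if $m=2$ and $v_2(a+1-b+c)>3$, then $v_2(i(K))=4$; (ii) if $m=2$ and $v_2(a+1-b+c)=3$, then $v_2(i(K))=1$; (iii) if $m=3$ and $\gcd(v_2(b),2)=1$, then $v_2(i(K))=1$; (iv) if $m=4$ and $\gcd(v_2(b),3)=1$, then $v_2(i(K))=2$. In particular, in each of these cases $K$ is non-monogenic.
   Context: $O_K$ denotes the ring of algebraic integers of $K$. For $\alpha\in O_K$, $\operatorname{ind}\alpha$ denotes the index of the subgroup $\mathbb{Z}[\alpha]$ in $O_K$. The index of the field is $i(K)=\gcd\{\operatorname{ind}\alpha : \alpha\in O_K,\ K=\mathbb{Q}(\alpha)\}$. For a rational prime $p$ and an integer $r$, $v_p(r)$ is the exponent of the highest power of $p$ dividing $r$. $K$ is monogenic if $O_K=\mathbb{Z}[\alpha]$ for some $\alpha\in O_K$, and non-monogenic otherwise. *)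

(* Defs.v *)
From HB Require Import structures.
From mathcomp Require Import all_boot all_order all_algebra all_field.
From mathcomp Require Import finmap all_classical.

Set Implicit Arguments.
Unset Strict Implicit.
Unset Printing Implicit Defensive.

Import Order.TTheory GRing.Theory Num.Theory.
Local Open Scope classical_set_scope.
Local Open Scope ring_scope.

(* [logn p 0 = 0], whereas mathematically v_p(0) is infinite: uses of [vp p r]
   are meaningful only for r != 0. *)
Definition vp (p : nat) (r : int) : nat := logn p `|r|%N.

Definition ring_of_integers (K : fieldExtType rat) : set K :=
  [set x | integralOver (intr : int -> K) x].

Definition Zadjoin (K : fieldExtType rat) (alpha : K) : set K :=
  [set (map_poly intr p).[alpha] | p in [set: {poly int}]].

Definition primitive_elt (K : fieldExtType rat) (alpha : K) : Prop :=
  <<1; alpha>>%VS = fullv.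

Definition cosets (V : zmodType) (G H : set V) : set (set V) :=
  [set [set x + h | h in H] | x in G].

(* The number of cosets x + H with x in G; it is 0 when there are infinitely
   many of them, since [fset_set] of an infinite set is empty. *)
Definition subgroup_index (V : zmodType) (G H : set V) : nat :=
  #|` fset_set (cosets G H) |%fset.

Definition ind (K : fieldExtType rat) (alpha : K) : nat :=
  subgroup_index (@ring_of_integers K) (Zadjoin alpha).

Definition is_gcd_set (S : set nat) (d : nat) : Prop :=
  forall e : nat, (e %| d)%N <-> (forall n, S n -> (e %| n)%N).

Definition gcd_set (S : set nat) : nat := xget 0%N (is_gcd_set S).

Lemma gcd_setP (S : set nat) : is_gcd_set S (gcd_set S).
Proof.
suff [d Sd] : exists d, is_gcd_set S d by exact: xgetPex (ex_intro _ d Sd).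
pose P d := (0 < d)%N && `[< forall e, (forall n, S n -> (e %| n)%N) ->
                               (e %| d)%N >].
have [[n0 Sn0 n0_gt0]|S0] := pselect (exists2 n, S n & (0 < n)%N); last first.
  exists 0%N => e; split=> // _ n Sn; case: (posnP n) => [-> //|n_gt0].
  by case: S0; exists n.
have exP : exists d, P d.
  by exists n0; rewrite /P n0_gt0; apply/asboolP => e; apply.
case: (ex_minnP exP) => d /andP[d_gt0 /asboolP Pd] d_min.
exists d => e; split=> [e_d n Sn|]; last exact: Pd.
apply: dvdn_trans e_d _.
suff /eqP <- : gcdn d n == d by exact: dvdn_gcdr.
rewrite eqn_leq dvdn_leq ?dvdn_gcdl //= d_min // /P gcdn_gt0 d_gt0 /=.
by apply/asboolP => k Sk; rewrite dvdn_gcd Pd // Sk.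
Qed.

Definition field_index (K : fieldExtType rat) : nat :=
  gcd_set [set ind alpha | alpha in
             [set alpha : K | ring_of_integers alpha /\ primitive_elt alpha]].

Definition monogenic (K : fieldExtType rat) : Prop :=
  exists2 alpha : K, ring_of_integers alpha &
    @ring_of_integers K = Zadjoin alpha.

(* Main.v *)
Require Import Defs.
From mathcomp Require Import all_boot all_order all_algebra all_fingroup all_solvable all_field.
From mathcomp Require Import ring zify.
From mathcomp Require Import finmap all_classical.

Set Implicit Arguments.
Unset Strict Implicit.
Unset Printing Implicit Defensive.

Import Order.TTheory GRing.Theory Num.Theory.
Local Open Scope ring_scope.

(* In each case an explicit lattice with six generators and integral structure
   constants is shown to be 2-maximal: it contains, besides powers of theta,
   ga = (theta^5 + a theta^(m-1) + b) / 2^v_2(b) and the quotients predicted by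
   the Newton polygons of f at the roots 0 and 1 mod 2. Its homomorphisms to F_2
   and F_4 describe O_K / 2 O_K modulo nilpotents.

   Lower bound for v_2(ind al), uniform in al: O_K / 2 O_K is too large to be
   generated by one element. If al^q - al is nilpotent modulo 2 for every al,
   the image of Z[al] modulo the nilradical has dimension at most q, so
   2^(r - q) divides ind al where r is the dimension of the reduced quotient
   (q = 4, r = 5 in (ii) and (iii); q = 2, r = 4 in (iv)). In (i) the
   same count is made modulo 4 O_K + 2 ka O_K with ka = (theta^3 - theta) / 2.

   Upper bound: for a suitable al, adjoining to Z[al] successive halves of
   elements already obtained gives, after k steps, a lattice that is maximal
   at 2, whence v_2(ind al) <= k. *)

(** * Divisibility by 2 among algebraic integers *)

(** The inequality on valuations puts a vertex of the Newton polygon of f at abscissa 1. So the root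
    0 of f mod 2 carries a prime of degree 1 where theta has valuation v_2(c) - v_2(b), and a second
    side of slope v_2(b)/(m-1), which the coprimality conditions make totally ramified for m = 3 and
    4. Since theta ga = -c / 2^v_2(b), [ga] is a unit at the first prime and lies in every other
    prime above 2: it separates primes that theta confuses. At odd primes only finiteness of the
    index matters: six integral elements independent modulo 2 O_K span a lattice of odd index, so no
    integral basis is sought. Residue maps test independence up to nilpotents; for these, eta^2 = 2
    u with u nonzero in the residue field (for m = 4, et e2 = 2 u) shows that eta is not even. On
    the side of indices the obstacle is that O_K is infinite and [subgroup_index] merely counts
    cosets, with value 0 for infinitely many. Comparisons of indices are therefore carried to finite
    quotients of O_K, where Lagrange's theorem applies. *)

Lemma monic_XnD (R : nzRingType) (p : {poly R}) n : (size p <= n)%N ->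
  'X^n + p \is monic /\ size ('X^n + p) = n.+1.
Proof.
move=> size_p; have lt_p : (size p < size ('X^n : {poly R}))%N by rewrite size_polyXn.
by split; [rewrite monicE lead_coefDl // lead_coefXn | rewrite size_polyDl // size_polyXn].
Qed.

Section Integers.

Variable K : fieldExtType rat.
Implicit Types x y z : K.

Local Notation OK := (@ring_of_integers K).

Lemma intr_K_eq0 (n : int) : ((n%:~R : K) == 0) = (n == 0).
Proof.
by rewrite -(rmorph_int (in_alg K : {rmorphism rat -> K})) fmorph_eq0 intr_eq0.
Qed.

Lemma two_neq0 : 2%:R != 0 :> K.
Proof. by have := intr_K_eq0 2; rewrite -pmulrn => ->. Qed.

Lemma OK_int (n : int) : OK n%:~R. Proof. exact: integral_id. Qed.
Lemma OK_nat n : OK n%:R. Proof. exact: integral_nat. Qed.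
Lemma OK0 : OK 0. Proof. exact: integral0. Qed.
Lemma OK1 : OK 1. Proof. exact: integral1. Qed.
Lemma OKD x y : OK x -> OK y -> OK (x + y). Proof. exact: integral_add. Qed.
Lemma OKB x y : OK x -> OK y -> OK (x - y). Proof. exact: integral_sub. Qed.
Lemma OKN x : OK x -> OK (- x). Proof. exact: integral_opp. Qed.
Lemma OKM x y : OK x -> OK y -> OK (x * y). Proof. exact: integral_mul. Qed.
Lemma OKX x n : OK x -> OK (x ^+ n).
Proof.
by move=> Ox; elim: n => [|n IHn]; [exact: OK1 | rewrite exprS; apply: OKM].
Qed.

Lemma OK_root (p : {poly K}) x :
  p \is monic -> root p x -> (forall i, OK p`_i) -> OK x.
Proof.
by move=> mp px Op; apply: integral_root_monic mp px _; apply/integral_poly.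
Qed.

Lemma OK_expI x n : (0 < n)%N -> OK (x ^+ n) -> OK x.
Proof.
move=> n_gt0 Oxn; apply: (@OK_root ('X^n - (x ^+ n)%:P)).
- exact: monicXnsubC.
- by rewrite rootE !hornerE subrr.
move=> i; rewrite coefB coefXn coefC; apply: OKB; first exact: OK_nat.
by case: ifP => _ //; exact: OK0.
Qed.

Lemma OK_trinomial n x y z : OK y -> OK z -> x ^+ n.+1 = y * x ^+ n + z -> OK x.
Proof.
move=> Oy Oz def_x; pose p := - (y *: 'X^n + z%:P).
have size_p : (size p <= n.+1)%N.
  rewrite size_polyN (leq_trans (size_polyD _ _)) // geq_max.
  by rewrite (leq_trans (size_scale_leq _ _)) ?size_polyXn // (leq_trans (size_polyC_leq1 _)).
have [mon_q _] := monic_XnD size_p.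
apply: OK_root mon_q _ _; first by rewrite rootE !(hornerD, hornerN, hornerZ, hornerXn, hornerC) def_x subrr.
move=> i; rewrite !(coefD, coefN, coefZ, coefXn, coefC).
apply: OKB; first exact: OK_nat.
apply: OKD; first by apply: OKM => //; exact: OK_nat.
by case: ifP => _ //; exact: OK0.
Qed.

Definition ev x := OK (x / 2%:R).

Lemma evP x : ev x <-> exists2 y, OK y & x = 2%:R * y.
Proof.
split=> [Ox2|[y Oy ->]]; last by rewrite /ev mulrC mulKf ?two_neq0.
by exists (x / 2%:R) => //; rewrite mulrC divfK ?two_neq0.
Qed.

Lemma ev2 y : OK y -> ev (2%:R * y). Proof. by move=> Oy; apply/evP; exists y. Qed.
Lemma evE x y : OK y -> x = 2%:R * y -> ev x.
Proof. by move=> Oy ->; exact: ev2. Qed.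
Lemma ev0 : ev 0. Proof. by rewrite /ev mul0r; exact: OK0. Qed.
Lemma evD x y : ev x -> ev y -> ev (x + y).
Proof. by rewrite /ev mulrDl; exact: OKD. Qed.
Lemma evN x : ev x -> ev (- x).
Proof. by rewrite /ev mulNr; exact: OKN. Qed.
Lemma evB x y : ev x -> ev y -> ev (x - y).
Proof. by move=> ex /evN; exact: evD. Qed.
Lemma evMl x y : OK x -> ev y -> ev (x * y).
Proof. by rewrite /ev -mulrA; exact: OKM. Qed.
Lemma evMr x y : ev x -> OK y -> ev (x * y).
Proof. by move=> ex Oy; rewrite mulrC; exact: evMl. Qed.
Lemma ev_int (n : int) : (2 %| n)%Z -> ev n%:~R.
Proof.
case/dvdzP=> k ->; apply: (evE (y := k%:~R)); first exact: OK_int.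
by rewrite rmorphM mulrC.
Qed.
Lemma ev_OK x : ev x -> OK x.
Proof. by case/evP=> y Oy ->; apply: OKM => //; exact: OK_nat. Qed.
Lemma evX x n : ev x -> ev (x ^+ n.+1).
Proof. by move=> ex; rewrite exprS; apply: evMr => //; apply/OKX/ev_OK. Qed.
Lemma ev_sum (I : finType) (F : I -> K) : (forall i, ev (F i)) -> ev (\sum_i F i).
Proof. by move=> eF; apply: big_ind => //; [exact: ev0 | exact: evD]. Qed.


(** In characteristic 2 the powers 2^n detect nilpotency and are additive by Frobenius, so this is
    the preimage in O_K of the nilradical of O_K / 2 O_K. Integrality of [x] is a consequence. *)
Definition nil2 x := exists n, ev (x ^+ (2 ^ n)).

Lemma nil2_OK x : nil2 x -> OK x.
Proof. by case=> n /ev_OK; apply: OK_expI; rewrite expn_gt0. Qed.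

Lemma ev_nil2 x : ev x -> nil2 x.
Proof. by move=> ex; exists 0%N; rewrite expn0 expr1. Qed.

Lemma nil2_leq x n m : (n <= m)%N -> ev (x ^+ (2 ^ n)) -> ev (x ^+ (2 ^ m)).
Proof.
move=> /subnK <-; rewrite expnD mulnC exprM => ex.
by case: (2 ^ (m - n))%N (expn_gt0 2 (m - n)) => // k _; exact: evX.
Qed.

Lemma ev_expD x y n : OK x -> OK y ->
  ev ((x + y) ^+ (2 ^ n) - (x ^+ (2 ^ n) + y ^+ (2 ^ n))).
Proof.
move=> Ox Oy; elim: n => [|n]; first by rewrite expn0 !expr1 subrr; exact: ev0.
rewrite expnSr !exprM; set X := x ^+ _; set Y := y ^+ _; set Z := (x + y) ^+ _.
move=> eZ; have [OX OY OZ] : [/\ OK X, OK Y & OK Z] by split; do !apply: OKX; do ?apply: OKD.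
have -> : Z ^+ 2 - (X ^+ 2 + Y ^+ 2) = (Z + (X + Y)) * (Z - (X + Y)) + 2%:R * (X * Y) by ring.
apply: evD; last by apply/ev2/OKM.
by apply: evMl => //; do !apply: OKD.
Qed.

Lemma nil2D x y : nil2 x -> nil2 y -> nil2 (x + y).
Proof.
move=> nx ny; have Ox := nil2_OK nx; have Oy := nil2_OK ny.
case: nx ny => [n ex] [m ey]; exists (maxn n m).
have /(_ (maxn n m)) := ev_expD _ Ox Oy.
move/evD/(_ (evD (nil2_leq (leq_maxl n m) ex) (nil2_leq (leq_maxr n m) ey))).
by rewrite subrK.
Qed.

Lemma nil2Ml x y : OK x -> nil2 y -> nil2 (x * y).
Proof. by move=> Ox [n ey]; exists n; rewrite exprMn; apply: evMl => //; apply: OKX. Qed.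

Lemma nil2N x : nil2 x -> nil2 (- x).
Proof. by move=> nx; rewrite -mulN1r; apply: nil2Ml => //; apply/OKN/OK1. Qed.

Lemma nil2B x y : nil2 x -> nil2 y -> nil2 (x - y).
Proof. by move=> nx /nil2N; exact: nil2D. Qed.

Lemma nil2_sqr x : nil2 (x ^+ 2) -> nil2 x.
Proof. by case=> n ex; exists n.+1; rewrite expnS exprM. Qed.

End Integers.

(** * Lattices and their reductions *)

Section Combinations.

Variable K : fieldExtType rat.
Implicit Types (x y z : K) (b : seq K) (n m : nat -> int).

Local Notation OK := (@ring_of_integers K).

Definition comb n b : K := \sum_(i < 6) (n i)%:~R * b`_i.

(** For integral entries in a field of degree 6, this says that the index of the lattice in O_K is
    odd, without mentioning that index. *)
Definition indep2 b : Prop :=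
  forall n, ev (comb n b) -> forall i, (i < 6)%N -> (2 %| n i)%Z.

Definition Zfree b : Prop :=
  forall n, comb n b = 0 -> forall i, (i < 6)%N -> n i = 0.

Lemma combE n b : comb n b =
  (n 0%N)%:~R * b`_0 + (n 1%N)%:~R * b`_1 + (n 2%N)%:~R * b`_2 + (n 3%N)%:~R * b`_3
  + (n 4%N)%:~R * b`_4 + (n 5%N)%:~R * b`_5.
Proof. by rewrite /comb !big_ord_recr big_ord0 /= add0r. Qed.

Lemma combD n m b : comb (fun i => n i + m i) b = comb n b + comb m b.
Proof. by rewrite -big_split; apply: eq_bigr => i _; rewrite rmorphD mulrDl. Qed.

Lemma combZ (k : int) n b : comb (fun i => k * n i) b = k%:~R * comb n b.
Proof. by rewrite mulr_sumr; apply: eq_bigr => i _; rewrite rmorphM mulrA. Qed.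

(** Descent: by [indep2] every relation has even coefficients, so it can be halved forever. *)
Lemma indep2_Zfree b : indep2 b -> Zfree b.
Proof.
move=> ind_b n n0 i lti6.
(* |n i| + 1 halvings suffice, because 2^(|n i| + 1) exceeds |n i|. *)
have [] : exists2 m : nat -> int, comb m b = 0 & n i = 2%:Z ^+ `|n i|.+1 * m i.
  elim: `|n i|.+1 => [|t [m m0 ->]]; first by exists n; rewrite // expr0 mul1r.
  have m_even j : (j < 6)%N -> (2 %| m j)%Z by apply: ind_b; rewrite m0; exact: ev0.
  exists (fun j => (m j %/ 2)%Z); last by rewrite exprSr -mulrA [2 * _]mulrC divzK ?m_even.
  have: comb (fun j => 2 * (m j %/ 2)%Z) b = 0.
    by rewrite -m0; apply: eq_bigr => j _; rewrite [2 * _]mulrC divzK ?m_even.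
  by rewrite combZ => /eqP; rewrite mulf_eq0 intr_K_eq0 => /eqP.
move=> m _ def_n; apply/eqP/contraT => ni_neq0.
have: (2 ^ `|n i|.+1 <= `|n i|)%N.
  rewrite {2}def_n abszM abszX leq_pmulr // absz_gt0.
  by apply: contraNneq ni_neq0 => m0; rewrite def_n m0 mulr0.
by rewrite leqNgt (ltn_trans (ltnSn _)) // ltn_expl.
Qed.

Lemma int_denominator (k : 'I_6 -> rat) :
  exists2 D : int, D != 0 & exists m : nat -> int, forall i : 'I_6, D%:~R * k i = (m i)%:~R.
Proof.
have [q [D nzD def_p]] := rat_poly_scale (\poly_(i < 6) k (inord i)).
exists D => //; exists (fun i => q`_i) => i.
have: (\poly_(j < 6) k (inord j))`_i = k i by rewrite coef_poly ltn_ord inord_val.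
by rewrite def_p coefZ coef_map => <-; rewrite mulVKf // intr_eq0.
Qed.

Lemma Zfree_span b : \dim {:K} = 6%N -> Zfree b ->
  forall x, exists2 N : int, N != 0 & exists n, N%:~R * x = comb n b.
Proof.
move=> dimK free_b x; pose X : 6.-tuple K := [tuple b`_i | i < 6].
have nthX (i : 'I_6) : X`_i = b`_i by rewrite -tnth_nth tnth_mktuple.
have scale_int (D : int) (k : rat) y : D%:~R * (k *: y) = (D%:~R * k) *: y.
  by rewrite mulrzl -scalerA scaler_int.
have freeX : free X.
  apply/freeP => k Xk0 i; have [D nzD [m def_m]] := int_denominator k.
  have: comb m b = 0.
    transitivity (D%:~R * \sum_i k i *: X`_i); last by rewrite Xk0 mulr0.
    rewrite mulr_sumr; apply: eq_bigr => j _.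
    by rewrite scale_int def_m nthX scaler_int mulrzl.
  move/free_b/(_ i (ltn_ord i)) => mi0; apply/eqP.
  by have /eqP := def_m i; rewrite mi0 mulf_eq0 intr_eq0 (negPf nzD).
have basisX : basis_of fullv X by rewrite basisEfree freeX subvf dimK size_tuple.
have def_x := coord_basis basisX (memvf x).
have [D nzD [m def_m]] := int_denominator (fun i => coord X i x).
exists D => //; exists m; rewrite {1}def_x mulr_sumr; apply: eq_bigr => j _.
by rewrite scale_int def_m nthX scaler_int mulrzl.
Qed.

(** Some nonzero multiple N x lies in the lattice. As long as N is even, [indep2] makes all
    coefficients even, and both sides can be halved. *)
Lemma indep2_odd b : \dim {:K} = 6%N -> indep2 b ->
  forall x, OK x -> exists2 N : int, ~~ (2 %| N)%Z & exists n, N%:~R * x = comb n b.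
Proof.
move=> dimK ind_b x Ox.
have [N nzN [n def_n]] := Zfree_span dimK (indep2_Zfree ind_b) x.
have [t] := ubnP `|N|%N; elim: t N nzN n def_n => // t IHt N nzN n def_n.
rewrite ltnS => leNt; have [|] := boolP (2 %| N)%Z; last by exists N => //; exists n.
case/dvdzP=> M def_N.
have n_even j : (j < 6)%N -> (2 %| n j)%Z.
  apply: ind_b; rewrite -def_n; apply: (evE (y := M%:~R * x)).
    by apply: OKM => //; exact: OK_int.
  by rewrite def_N rmorphM /= -pmulrn; ring.
have nzM : M != 0 by apply: contraNneq nzN => M0; rewrite def_N M0 mul0r.
apply: (IHt M nzM (fun j => (n j %/ 2)%Z)); last first.
  by apply: leq_trans leNt; rewrite def_N abszM; move: nzM; rewrite -absz_gt0; lia.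
apply: (mulfI (two_neq0 K)).
have -> : 2%:R * comb (fun j => (n j %/ 2)%Z) b = comb n b.
  rewrite [2%:R]pmulrn -combZ; apply: eq_bigr => j _.
  by rewrite [2 * _]mulrC divzK ?n_even.
by rewrite -def_n def_N rmorphM /= -pmulrn; ring.
Qed.

Lemma indep2_span b : \dim {:K} = 6%N -> indep2 b -> (forall i, OK b`_i) ->
  forall x, OK x -> exists n, ev (x - comb n b).
Proof.
move=> dimK ind_b Ob x Ox; have [N oddN [n def_n]] := indep2_odd dimK ind_b Ox.
exists n; rewrite -def_n.
have [M def_N] : exists M : int, N = 1 + 2 * M by exists ((N - 1) %/ 2)%Z; lia.
apply: (evE (y := - M%:~R * x)); first by apply: OKM => //; apply/OKN/OK_int.
by rewrite def_N rmorphD rmorphM /= -pmulrn; ring.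
Qed.

Section Reduction.

(* Ring homomorphisms from the lattice spanned by b to F, given by the values h
   on the basis; [redn x v] means that x is in the lattice and has image v. *)
Variables (F : idomainType) (b : seq K) (h : seq F).

Definition redn x (v : F) : Prop :=
  exists2 n, x = comb n b & v = \sum_(i < 6) (n i)%:~R * h`_i.

Hypothesis free_b : Zfree b.

(** [redn] is a relation, so that no coordinate function on the lattice has to be chosen; freeness
    of [b] makes it single-valued. *)
Lemma redn_uniq x v w : redn x v -> redn x w -> v = w.
Proof.
move=> [n -> ->] [m eq_nm ->]; apply: eq_bigr => i _; congr (_%:~R * _).
apply/eqP; rewrite -subr_eq0 -mulN1r; apply/eqP.
apply: (free_b (n := fun i => n i + -1 * m i)) => //.
by rewrite combD combZ eq_nm mulN1r subrr.
Qed.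

Lemma redn0 : redn 0 0.
Proof. by exists (fun=> 0); rewrite /comb big1 // => i _; rewrite mul0r. Qed.

Lemma rednD x y v w : redn x v -> redn y w -> redn (x + y) (v + w).
Proof.
move=> [n -> ->] [m -> ->]; exists (fun i => n i + m i); first by rewrite combD.
by rewrite -big_split; apply: eq_bigr => i _; rewrite rmorphD mulrDl.
Qed.

Lemma rednZ (k : int) x v : redn x v -> redn (k%:~R * x) (k%:~R * v).
Proof.
move=> [n -> ->]; exists (fun i => k * n i); first by rewrite combZ.
by rewrite mulr_sumr; apply: eq_bigr => i _; rewrite rmorphM mulrA.
Qed.

Lemma rednN x v : redn x v -> redn (- x) (- v).
Proof. by move/(rednZ (-1)); rewrite !mulN1r. Qed.

Lemma rednB x y v w : redn x v -> redn y w -> redn (x - y) (v - w).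
Proof. by move=> xv /rednN; exact: rednD. Qed.

Lemma redn_sum (I : Type) (r : seq I) (X : I -> K) (V : I -> F) :
  (forall i, redn (X i) (V i)) -> redn (\sum_(i <- r) X i) (\sum_(i <- r) V i).
Proof.
move=> XV; elim: r => [|i r IHr]; first by rewrite !big_nil; exact: redn0.
by rewrite !big_cons; apply: rednD.
Qed.

Lemma redn_basis i : (i < 6)%N -> redn b`_i h`_i.
Proof.
move=> lti6; exists (fun j => (j == i)%:Z).
  rewrite /comb (bigD1 (Ordinal lti6)) //= eqxx mul1r big1 ?addr0 // => j.
  by rewrite -val_eqE /= => /negPf->; rewrite mul0r.
rewrite (bigD1 (Ordinal lti6)) //= eqxx mul1r big1 ?addr0 // => j.
by rewrite -val_eqE /= => /negPf->; rewrite mul0r.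
Qed.

Hypothesis redn1 : redn 1 1.
Hypothesis redn_table : forall i j, (i <= j < 6)%N -> redn (b`_i * b`_j) (h`_i * h`_j).

Lemma rednM x y v w : redn x v -> redn y w -> redn (x * y) (v * w).
Proof.
move=> [n -> ->] [m -> ->]; rewrite !big_distrlr /=.
apply: redn_sum => i; apply: redn_sum => j; rewrite mulrACA.
rewrite -rmorphM mulrACA -rmorphM; apply: rednZ.
case: (leqP i j) => [leij|/ltnW leji]; first by apply: redn_table; rewrite leij /=.
by rewrite mulrC [h`_i * _]mulrC; apply: redn_table; rewrite leji /=.
Qed.

Lemma rednX x v k : redn x v -> redn (x ^+ k) (v ^+ k).
Proof.
by move=> xv; elim: k => [|k IHk]; [exact: redn1 | rewrite !exprS; apply: rednM].
Qed.

Hypothesis F2 : 2%:R = 0 :> F.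

(* Lying over: x = 2y with y integral is a root of a monic polynomial whose
   lower coefficients are even. *)
Lemma redn_ev x v : redn x v -> ev x -> v = 0.
Proof.
move=> xv /evP[y [p mon_p py0] def_x].
pose d := (size p).-1; have size_p : size p = d.+1 by rewrite /d prednK // size_poly_gt0 monic_neq0.
have: \sum_(i < d.+1) (p`_i * 2 ^+ (d - i))%:~R * x ^+ i = 0.
  rewrite -[RHS](mulr0 (2%:R ^+ d)) -[X in _ * X](rootP py0) horner_coef size_map_inj_poly //; last first.
    by move=> i j /eqP; rewrite -subr_eq0 -rmorphB intr_K_eq0 subr_eq0 => /eqP.
  rewrite size_p mulr_sumr; apply: eq_bigr => i _.
  rewrite coef_map /= rmorphM rmorphXn /= def_x exprMn -pmulrn.
  have -> : 2%:R ^+ d = 2%:R ^+ (d - i) * 2%:R ^+ i :> K by rewrite -exprD subnK // -ltnS.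
  by rewrite mulrA mulrACA [RHS]mulrC; ring.
have: redn (\sum_(i < d.+1) (p`_i * 2 ^+ (d - i))%:~R * x ^+ i) (v ^+ d).
  have -> : v ^+ d = \sum_(i < d.+1) (p`_i * 2 ^+ (d - i))%:~R * v ^+ i.
    rewrite big_ord_recr /= subnn expr0 mulr1 big1 => [|i _].
      by rewrite add0r; move/monicP: mon_p; rewrite /lead_coef -/d => ->; rewrite mul1r.
    rewrite rmorphM rmorphXn /= -pmulrn F2 -[(d - i)%N]prednK ?subn_gt0 //.
    by rewrite exprS mul0r mulr0 mul0r.
  by apply: redn_sum => i; apply: rednZ; exact: rednX.
move=> r0 x0; rewrite x0 in r0; have /eqP := redn_uniq r0 redn0.
by rewrite expf_eq0 => /andP[_ /eqP].
Qed.

Lemma redn_nil2 x v : redn x v -> nil2 x -> v = 0.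
Proof.
move=> xv [n] /(redn_ev (rednX (2 ^ n) xv)) /eqP.
by rewrite expf_eq0 => /andP[_ /eqP].
Qed.

End Reduction.

End Combinations.

(** * Integers and powers of theta *)

Lemma irreducible_coprimep (F : fieldType) (p q : {poly F}) :
  irreducible_poly p -> ~~ (p %| q) -> coprimep p q.
Proof.
move=> irr_p; apply: contraR => size_gcd.
by rewrite -(eqp_dvdl _ (irr_p.2 _ size_gcd (dvdp_gcdl p q))) dvdp_gcdr.
Qed.

Lemma irreducible_root_dvdp (F : fieldType) (L : comNzRingType) (e : {rmorphism F -> L})
    (p q : {poly F}) (x : L) :
  irreducible_poly p -> root (map_poly e p) x -> root (map_poly e q) x -> p %| q.
Proof.
move=> irr_p /rootP px0 /rootP qx0; apply: contraT => /(irreducible_coprimep irr_p).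
case/Bezout_eq1_coprimepP=> -[u v] /= /(congr1 (fun r => (map_poly e r).[x])).
by rewrite rmorphD !rmorphM rmorph1 !hornerE px0 qx0 !mulr0 addr0 => /eqP; rewrite eq_sym oner_eq0.
Qed.

Section PrimitiveInteger.

Variables (K : fieldExtType rat) (theta : K) (f : {poly int}).
Hypotheses (mon_f : f \is monic) (f_irr : irreducible_poly (map_poly intr f : {poly rat})).
Hypotheses (f_theta : root (map_poly intr f) theta) (K_theta : primitive_elt theta).

Local Notation d := (size f).-1.
Local Notation fQ := (map_poly intr f : {poly rat}).
Local Notation toC := (map_poly (ratr : rat -> algC)).
Local Notation inK := (in_alg K : {rmorphism rat -> K}).

Lemma map_in_alg_intr (p : {poly int}) :
  map_poly inK (map_poly intr p) = map_poly intr p.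
Proof. by rewrite -map_poly_comp; apply: eq_map_poly => n; rewrite /= scaler_int. Qed.

Lemma size_map_intr (p : {poly int}) : size (map_poly intr p : {poly rat}) = size p.
Proof. by apply: size_map_inj_poly => // m n /intr_inj. Qed.

Lemma fQ_theta : root (map_poly inK fQ) theta. Proof. by rewrite map_in_alg_intr. Qed.

Lemma theta_dvdp (q : {poly rat}) : root (map_poly inK q) theta -> fQ %| q.
Proof. exact: irreducible_root_dvdp f_irr fQ_theta. Qed.

Lemma theta_horner x : exists2 q : {poly rat}, (size q <= d)%N & x = (map_poly inK q).[theta].
Proof.
have /Fadjoin1_polyP[q def_x] : x \in <<1; theta>>%VS by rewrite K_theta memvf.
have fQ_neq0 : fQ != 0 := irredp_neq0 f_irr.
exists (q %% fQ); first last.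
  rewrite {1}def_x {1}(divp_eq q fQ) rmorphD rmorphM /= !hornerE.
  by rewrite [X in _ * X](rootP fQ_theta) mulr0 add0r.
by rewrite -ltnS (leq_trans _ (leqSpred _)) // -size_map_intr ltn_modp.
Qed.

Lemma dim_primitive : \dim {:K} = d.
Proof.
have := dim_Fadjoin 1 theta; rewrite K_theta dimv1 muln1 => ->.
have /polyOver1P[g def_g] := minPolyOver 1 theta.
have g_dvd_f : g %| fQ.
  rewrite -(dvdp_map inK) -def_g minPoly_dvdp ?fQ_theta //.
  by apply/polyOver1P; exists fQ.
have f_dvd_g : fQ %| g by apply: theta_dvdp; rewrite -def_g root_minPoly.
have/eqp_size : fQ %= g by rewrite /eqp f_dvd_g.
by rewrite size_map_intr -(size_map_poly inK) -def_g size_minPoly => ->.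
Qed.

(* The determinant Delta of the Vandermonde matrix of the conjugates of theta
   is an algebraic integer, and Delta q_i is one as well whenever
   sum q_i theta^i is integral; a nonzero integer multiple of Delta works for D. *)
Lemma OK_denominator :
  exists2 D : int, D != 0 &
    forall x, @ring_of_integers K x -> exists2 q : {poly int}, (size q <= d)%N &
      D%:~R * x = (map_poly intr q).[theta].
Proof.
have toC_int (p : {poly int}) : toC (map_poly intr p) = map_poly intr p.
  by rewrite -map_poly_comp; apply: eq_map_poly => n; rewrite /= ratr_int.
have mon_fC : toC fQ \is monic by rewrite map_monic monic_map.
have [zs def_f] := closed_field_poly_normal (toC fQ).
rewrite (monicP mon_fC) scale1r in def_f.
have lead_fQ : fQ`_d = 1.
  by have /monicP := monic_map (intr : {rmorphism int -> rat}) mon_f; rewrite /lead_coef size_map_intr.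
have d_gt0 : (0 < d)%N by have := f_irr.1; rewrite size_map_intr; lia.
have fQ' : fQ^`() != 0.
  apply: contraTneq isT => /polyP/(_ d.-1); rewrite coef_deriv coef0 prednK // lead_fQ.
  by move/eqP; rewrite pnatr_eq0; case: (d) d_gt0.
have uniq_zs : uniq zs.
  rewrite -separable_prod_XsubC -def_f separable_map unlock.
  apply: irreducible_coprimep f_irr _; apply/negP => /(dvdp_leq fQ').
  by rewrite leqNgt lt_size_deriv ?irredp_neq0.
have size_zs : size zs = d.
  have := congr1 (fun p : {poly algC} => size p) def_f.
  by rewrite size_prod_XsubC size_map_poly size_map_intr => ->.
have root_zs z : z \in zs -> root (toC fQ) z by rewrite def_f root_prod_XsubC.
have Aint_zs z : z \in zs -> z \in Aint.
  move=> /root_zs fz; apply: (root_monic_Aint fz mon_fC).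
  by rewrite toC_int; apply/polyOverP => i; rewrite coef_map /= intr_int.
pose r : 'rV[algC]_d := \row_i zs`_i.
have r_zs i : r 0 i \in zs by rewrite mxE mem_nth // size_zs.
pose V := Vandermonde d r; pose Delta := \det V.
have V_Aint i j : V i j \in Aint by rewrite mxE rpredX ?Aint_zs.
have det_Aint n (A : 'M[algC]_n) : (forall i j, A i j \in Aint) -> \det A \in Aint.
  move=> A_Aint; rewrite /determinant rpred_sum // => s _; rewrite rpredM ?rpred_sign //.
  by rewrite rpred_prod.
have Delta_Aint : Delta \in Aint by exact: det_Aint.
have adj_Aint i j : (\adj V) i j \in Aint.
  rewrite mxE rpredM ?rpred_sign //; apply: det_Aint => k l.
  by rewrite !mxE rpredX // Aint_zs // mem_nth // size_zs.
have Delta_neq0 : Delta != 0.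
  rewrite /Delta det_Vandermonde; apply/prodf_neq0 => i _; apply/prodf_neq0 => j ltij.
  by rewrite subr_eq0 !mxE nth_uniq ?size_zs // neq_ltn ltij orbT.
(* The integer multiple of [Delta] is the constant term [D] of its minimal polynomial: it equals
   -[g1](Delta) Delta with [g1](Delta) integral, and minimality makes it nonzero because [Delta]
   is. *)
have [g [def_g mon_g] g_dvd] := minCpolyP Delta.
have /polyOverP g_int : minCpoly Delta \is a polyOver Num.int by [].
have [D def_D] : exists D : int, (minCpoly Delta)`_0 = D%:~R by apply/intrP/g_int.
have [g1 [g1_int def_g1]] : exists g1 : {poly algC}, g1 \is a polyOver Num.int /\
    minCpoly Delta = g1 * 'X + D%:~R%:P.
  exists (\poly_(i < (size (minCpoly Delta)).-1) (minCpoly Delta)`_i.+1); split.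
    by apply/polyOverP => i; rewrite coef_poly; case: ifP => _; rewrite ?rpred0 ?g_int.
  apply/polyP => -[|i]; rewrite coefD coefMX coefC /= ?add0r // addr0 coef_poly.
  by case: ltnP => // lei; rewrite nth_default //; lia.
have D_eq : D%:~R = - (g1.[Delta] * Delta).
  have /rootP := root_minCpoly Delta; rewrite def_g1 !hornerE => /eqP.
  by rewrite addrC addr_eq0 => /eqP.
have g1_Aint : g1.[Delta] \in Aint.
  by apply: rpred_horner => //; apply: polyOverS g1_int; exact: Aint_Cint.
have D_neq0 : D != 0.
  apply: contraTneq isT => D0.
  have g10 : g1.[Delta] = 0.
    by apply/eqP; move/eqP: D_eq; rewrite D0 eq_sym oppr_eq0 mulf_eq0 (negPf Delta_neq0) orbF.
  have g_root0 : root g 0 by rewrite -(fmorph_root (ratr : {rmorphism rat -> algC})) rmorph0 -def_g rootE horner_coef0 def_D D0.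
  have /factor_theorem[g2 def_g2] := g_root0.
  have : g %| g2.
    rewrite -g_dvd; move: def_g1; rewrite def_g def_g2 D0 rmorphM /= map_polyXsubC rmorph0 !subr0 addr0.
    by move/(mulIf (monic_neq0 (monicX _))) => ->; rewrite rootE g10.
  have g2_neq0 : g2 != 0 by apply: contraTneq mon_g => g20; rewrite def_g2 g20 mul0r monicE lead_coef0 eq_sym oner_eq0.
  by move/(dvdp_leq g2_neq0); rewrite def_g2 size_Mmonic ?monicXsubC // size_XsubC addn2 ltnn.
exists D => // x Ox; have [q size_q def_x] := theta_horner x.
have [P mon_P Px0] := Ox.
(* The conjugates of [x]: [P \Po q] is a multiple of f, so [P] vanishes at them and they are
   integral. *)
pose y : 'rV[algC]_d := \row_i (toC q).[zs`_i].
have y_Aint i : y 0 i \in Aint.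
  rewrite mxE; set z := zs`_i; have zs_z : z \in zs by rewrite mem_nth // size_zs.
  apply: (@root_monic_Aint (map_poly intr P)).
  - have: fQ %| map_poly intr P \Po q.
      apply: theta_dvdp; rewrite map_comp_poly map_in_alg_intr rootE horner_comp -def_x.
      exact: Px0.
    rewrite -(dvdp_map (ratr : {rmorphism rat -> algC})) => /dvdpP[s def_s].
    rewrite -toC_int rootE -horner_comp -map_comp_poly def_s hornerM.
    by rewrite (rootP (root_zs z zs_z)) mulr0.
  - exact: monic_map.
  by apply/polyOverP => j; rewrite coef_map /= intr_int.
pose c : 'rV[algC]_d := \row_i (toC q)`_i.
have cV : c *m V = y.
  apply/rowP => j; rewrite !mxE (horner_coef_wide _ (n := d)) ?size_map_poly //.
  by apply: eq_bigr => i _; rewrite !mxE.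
(* Cramer's rule: Delta c = y adj(V), where the right-hand side is integral. *)
have Dc i : D%:~R * c 0 i \in Aint.
  have /rowP/(_ i) : c *m V *m \adj V = y *m \adj V by rewrite cV.
  rewrite -mulmxA mul_mx_adj mul_mx_scalar [LHS]mxE => Delta_c.
  rewrite D_eq mulNr rpredN -mulrA rpredM // Delta_c mxE.
  by apply: rpred_sum => j _; rewrite rpredM.
have Dq (i : nat) : exists k : int, D%:~R * q`_i = k%:~R.
  case: (ltnP i d) => [ltid|ledi]; last first.
    by exists 0; rewrite nth_default ?mulr0 // (leq_trans size_q).
  have := Dc (Ordinal ltid); rewrite mxE coef_map -(rmorph_int (ratr : {rmorphism rat -> algC})) -rmorphM => Aint_Dq.
  have /intrP[k] : ratr (D%:~R * q`_i) \in (Num.int : {pred algC}) by rewrite Cint_rat_Aint // Crat_rat.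
  rewrite -[RHS](rmorph_int (ratr : {rmorphism rat -> algC})) => /(fmorph_inj _) ->.
  by exists k.
have [k def_k] := choice Dq.
have def_Dq : map_poly intr (\poly_(i < d) k i) = D%:~R *: q.
  apply/polyP => i; rewrite coef_map coef_poly coefZ def_k; case: ltnP => // ledi.
  by rewrite -def_k nth_default ?mulr0 // (leq_trans size_q).
exists (\poly_(i < d) k i); first exact: size_poly.
by rewrite -map_in_alg_intr def_Dq map_polyZ hornerZ -def_x /= scaler_int.
Qed.


End PrimitiveInteger.

(** * Indices of subgroups *)

Section AbelianIndex.

Variables (gT : finGroupType) (G H : {group gT}).
Hypothesis nHG : G \subset 'N(H)%g.

Lemma pnat_index p t : prime p -> (forall x, x \in G -> (x ^+ (p ^ t) \in H)%g) ->
  p.-nat #|G : H|%g.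
Proof.
move=> p_pr expG; rewrite -card_quotient // -pgroupE -pnat_exponent.
apply: (pnat_dvd (n := p ^ t)); last by rewrite pnatX pnat_id.
apply/exponentP => _ /morphimP[x Nx Gx ->].
by rewrite -morphX //= coset_id // expG.
Qed.

Lemma odd_index : (forall x, x \in G -> exists2 n, odd n & (x ^+ n \in H)%g) ->
  odd #|G : H|%g.
Proof.
move=> expG; rewrite -card_quotient // -[odd _]negbK -dvdn2; apply/negP.
case/Cauchy=> // _ /morphimP[x Nx Gx ->] ord_x; have [n odd_n Hxn] := expG x Gx.
have: (#[coset H x]%g %| n)%N by rewrite order_dvdn -morphX //= coset_id.
by rewrite ord_x dvdn2 odd_n.
Qed.

Lemma index_cover (T : finType) (g : T -> gT) :
  (forall x, x \in G -> exists j, x \in (H :* g j)%g) -> (#|G : H|%g <= #|T|)%N.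
Proof.
move=> coverG; have sub : rcosets H G \subset (fun j => (H :* g j)%g) @: T.
  apply/fintype.subsetP => _ /rcosetsP[x Gx ->].
  by have [j /rcoset_eqP ->] := coverG x Gx; apply/imsetP; exists j.
by apply: leq_trans (subset_leq_card sub) (leq_trans (leq_imset_card _ _) _).
Qed.

Lemma index_inj (T : finType) (g : T -> gT) : (forall i, g i \in G) ->
  (forall i j, g i \in (H :* g j)%g -> i = j) -> (#|T| <= #|G : H|%g)%N.
Proof.
move=> Gg g_inj; have f_inj : injective (fun i => (H :* g i)%g).
  by move=> i j /= eqH; apply: g_inj; rewrite -eqH rcoset_refl.
have sub : (fun i => (H :* g i)%g) @: T \subset rcosets H G.
  by apply/fintype.subsetP => _ /imsetP[i _ ->]; apply/rcosetsP; exists (g i).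
by have := subset_leq_card sub; rewrite (card_imset _ f_inj).
Qed.

End AbelianIndex.

(** * Indices in an infinite abelian group through finite quotients *)

Section SubgroupIndex.

Variables (V : zmodType) (G : set V).

Definition subgrp (S : set V) : Prop := S 0 /\ forall x y, S x -> S y -> S (x - y).

Lemma subgrpN S x : subgrp S -> S x -> S (- x).
Proof. by case=> S0 SB Sx; rewrite -sub0r; apply: SB. Qed.

Lemma subgrpD S x y : subgrp S -> S x -> S y -> S (x + y).
Proof. by move=> gS Sx Sy; rewrite -[y]opprK; apply: (gS.2) => //; apply: subgrpN. Qed.

Lemma subgrpMn S x n : subgrp S -> S x -> S (x *+ n).
Proof.
move=> gS Sx; elim: n => [|n IHn]; first exact: gS.1.
by rewrite mulrS; apply: subgrpD.
Qed.

Hypothesis gG : subgrp G.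

Section Model.

Variables (W : finZmodType) (psi : V -> W).
Hypothesis psiB : forall x y, G x -> G y -> psi (x - y) = psi x - psi y.

Definition img (S : set V) : {set W} := [set w | `[< exists2 x, S x & psi x = w >]].

Lemma mem_img S x : S x -> psi x \in img S.
Proof. by move=> Sx; rewrite inE; apply/asboolP; exists x. Qed.

Lemma imgP S w : reflect (exists2 x, S x & psi x = w) (w \in img S).
Proof. by rewrite inE; apply: asboolP. Qed.

Lemma psi0 : psi 0 = 0.
Proof. by rewrite -[in LHS](subrr 0) psiB ?subrr //; exact: gG.1. Qed.

Lemma psiMn x n : G x -> psi (x *+ n) = psi x *+ n.
Proof.
move=> Gx; have psiN : psi (- x) = - psi x.
  by rewrite -sub0r psiB ?psi0 ?sub0r //; exact: gG.1.
elim: n => [|n IHn]; first by rewrite !mulr0n psi0.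
have Gxn := subgrpMn n gG Gx; have GNx := subgrpN gG Gx.
by rewrite !mulrSr -{2}[x]opprK psiB // psiN opprK IHn.
Qed.

Lemma img_group_set S : subgrp S -> (S `<=` G)%classic -> group_set (img S).
Proof.
move=> gS sSG; have psiN y : S y -> psi (- y) = - psi y.
  by move=> Sy; rewrite -sub0r psiB ?psi0 ?sub0r //; [exact: gG.1 | exact: sSG].
apply/group_setP; split; first by apply/imgP; exists 0; [exact: gS.1 | exact: psi0].
move=> _ _ /imgP[x Sx <-] /imgP[y Sy <-]; apply/imgP; exists (x + y).
  exact: subgrpD.
have SNy : S (- y) by apply: subgrpN.
by rewrite FinRing.zmodMgE -{1}[y]opprK psiB ?psiN ?opprK //; exact: sSG.
Qed.

Lemma mem_rcoset_img S x y : subgrp S -> (S `<=` G)%classic -> G x -> G y ->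
    (forall z, G z -> psi z = 0 -> S z) ->
  (psi y \in (img S :* psi x)%g) <-> S (y - x).
Proof.
move=> gS sSG Gx Gy kerS; rewrite mem_rcoset FinRing.zmodMgE FinRing.zmodVgE -psiB //.
split=> [/imgP[z Sz eq_zx]|Syx]; last exact: mem_img.
rewrite -[y - x](subrK z); apply: subgrpD => //; apply: kerS.
  by apply: (gG.2); [apply: (gG.2) | exact: sSG].
have Gz := sSG _ Sz; have Gyx : G (y - x) by exact: (gG.2).
by rewrite psiB // eq_zx subrr.
Qed.

(** [S] contains the kernel of [psi] on [G], so taking preimages matches the cosets of [img S] in
    [img G] with those of [S] in [G]. *)
Lemma index_img S : subgrp S -> (S `<=` G)%classic ->
    (forall x, G x -> psi x = 0 -> S x) ->
  subgroup_index G S = #|img G : img S|%g.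
Proof.
move=> gS sSG kerS; rewrite /subgroup_index.
pose R := rcosets (img S) (img G).
pose F (C : {set W}) := [set x | G x /\ psi x \in C]%classic.
have defF x : G x -> F (img S :* psi x)%g = [set x + h | h in S]%classic.
  move=> Gx; apply/seteqP; split=> [y [Gy mem_y]|_ [h Sh <-]].
    by exists (y - x); [exact/(mem_rcoset_img gS sSG Gx Gy kerS) | rewrite addrC subrK].
  have Gxh : G (x + h) by apply: subgrpD => //; exact: sSG.
  split=> //; apply/(mem_rcoset_img gS sSG Gx Gxh kerS).
  by rewrite addrC addKr.
have -> : cosets G S = (F @` [set` [fset C in R]%fset])%classic.
  apply/seteqP; split=> [_ [x Gx <-]|_ [C + <-]].
    exists (img S :* psi x)%g; last exact: defF.
    by rewrite /= !inE; apply/rcosetsP; exists (psi x) => //; apply: mem_img.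
  rewrite /= !inE => /rcosetsP[_ /imgP[x Gx <-] ->]; exists x => //.
  by rewrite defF.
rewrite fset_set_image // set_fsetK card_in_imfset /=; last first.
  move=> C C'; rewrite !inE => /rcosetsP[_ /imgP[x Gx <-] ->].
  move=> /rcosetsP[_ /imgP[y Gy <-] ->] eqF.
  have: F (img S :* psi x)%g y.
    rewrite eqF; split=> //; apply/(mem_rcoset_img gS sSG Gy Gy kerS).
    by rewrite subrr; exact: gS.1.
  case=> _ y_x; exact/esym/(@rcoset_eqP _ (Group (img_group_set gS sSG))).
by rewrite card_imfset //= -cardE.
Qed.

End Model.

(** Finiteness of G / N G for all N > 0, in the form of a map to a finite group, additive on [G],
    whose kernel in [G] lies in N G. It spares the choice of a Z-basis of [G]. *)
Definition finite_model : Prop := forall N, (0 < N)%N ->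
  exists (W : finZmodType) (psi : V -> W),
    (forall x y, G x -> G y -> psi (x - y) = psi x - psi y) /\
    (forall x, G x -> psi x = 0 -> exists2 y, G y & x = y *+ N).

Hypothesis fmG : finite_model.

Lemma finite_cosets S : subgroup_index G S != 0%N -> finite_set (cosets G S).
Proof.
by rewrite /subgroup_index /fset_set; case: pselect => // _; rewrite cardfs0.
Qed.

(** Pigeonhole: if n is the index, two of the multiples 0, x, ..., n x lie in one coset, so [S]
    contains l x for some 0 < l <= n, and l divides n!. *)
Lemma subgroup_index_exponent S : subgrp S -> (S `<=` G)%classic ->
  subgroup_index G S != 0%N -> exists2 N, (0 < N)%N & forall x, G x -> S (x *+ N).
Proof.
move=> gS sSG ind_neq0; have fin := finite_cosets ind_neq0.
pose n := subgroup_index G S; exists n`!; first exact: fact_gt0.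
move=> x Gx; pose C k := [set x *+ k + h | h in S]%classic.
have C_in k : C k \in fset_set (cosets G S).
  by rewrite in_fset_set // inE; exists (x *+ k) => //; apply: subgrpMn.
pose g (k : 'I_n.+1) : fset_set (cosets G S) := [` C_in k]%fset.
have /injectivePn[k [l neq_kl /(congr1 val) /= eqC]] : ~~ injectiveb g.
  by apply/negP => /injectiveP/leq_card; rewrite card_ord -cardfE ltnn.
have{eqC g C_in} : exists k l, [/\ (k < l)%N, (l <= n)%N & S (x *+ (l - k))].
  wlog ltkl : k l eqC neq_kl / (k < l)%N.
    move=> IH; have := neq_kl; rewrite neq_ltn => /orP[|ltlk]; first exact: IH.
    by apply: (IH l k) => //; rewrite eq_sym.
  exists k, l; split=> //; first by rewrite -ltnS.
  have: C l (x *+ l) by exists 0; rewrite ?addr0 //; exact: gS.1.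
  rewrite -eqC => -[h Sh eq_kl]; rewrite mulrnBr ?(ltnW ltkl) // -eq_kl.
  by rewrite addrC addKr.
move=> [k' [l' [ltkl leln S_kl]]].
have /dvdnP[q ->] : (l' - k' %| n`!)%N by rewrite dvdn_fact // subn_gt0 ltkl; lia.
by rewrite mulnC mulrnA; apply: subgrpMn.
Qed.

(** [G : A + I] divides [G : A]. It is a power of 2 because [I] contains 2^t G, and it equals
    [G : I] / [A + I : I], which is at least 2^r / 2^s; a power of 2 of that size is divisible by
    2^(r - s). *)
Lemma dvdn_subgroup_index (A I : set V) t (T1 T2 : finType) (g1 : T1 -> V) (g2 : T2 -> V) r s :
    subgrp A -> (A `<=` G)%classic -> subgrp I -> (I `<=` G)%classic ->
    (forall x, G x -> I (x *+ (2 ^ t)%N)) ->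
    (forall i, G (g1 i)) -> (forall i j, I (g1 i - g1 j) -> i = j) ->
    (forall j, G (g2 j)) -> (forall x, A x -> exists j, I (x - g2 j)) ->
    (2 ^ r <= #|T1|)%N -> (#|T2| <= 2 ^ s)%N ->
  (2 ^ (r - s) %| subgroup_index G A)%N.
Proof.
move=> gA sAG gI sIG expI Gg1 g1_inj Gg2 g2_cover leT1 leT2.
(* The value 0 stands for infinitely many cosets and is divisible by every power of 2. *)
have [->|/(subgroup_index_exponent gA sAG)[N N_gt0 NG]] := eqVneq (subgroup_index G A) 0%N.
  exact: dvdn0.
(* With the modulus 2^t N the kernel of the finite model lies both in [A] and in [I]. *)
have tN_gt0 : (0 < 2 ^ t * N)%N by rewrite muln_gt0 expn_gt0.
have [W [psi [psiB kerpsi]]] := fmG tN_gt0.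
have kerA x : G x -> psi x = 0 -> A x.
  by move=> Gx /kerpsi[] // y Gy ->; rewrite mulrnA; apply: NG; exact: subgrpMn.
have kerI x : G x -> psi x = 0 -> I x.
  by move=> Gx /kerpsi[] // y Gy ->; rewrite mulrnA; apply: subgrpMn => //; apply: expI.
rewrite (index_img psiB) //.
pose GG := Group (img_group_set psiB gG (fun x Gx => Gx)).
pose GA := Group (img_group_set psiB gA sAG); pose GI := Group (img_group_set psiB gI sIG).
have nW (X Y : {group W}) : Y \subset 'N(X)%g.
  apply: (fintype.subset_trans (finset.subsetT (Y : {set W}))).
  by apply: sub_abelian_norm (FinRing.zmod_abelian _) (finset.subsetT _).
pose M := (GI <*> GA)%G.
have sAGW : GA \subset GG by apply/fintype.subsetP => _ /imgP[x Ax <-]; apply/mem_img/sAG.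
have sIGW : GI \subset GG by apply/fintype.subsetP => _ /imgP[x Ix <-]; apply/mem_img/sIG.
have sMG : M \subset GG by rewrite join_subG sIGW.
have sAM : GA \subset M by exact: joing_subr.
have sIM : GI \subset M by exact: joing_subl.
have /p_natP[j def_j] : 2%N.-nat #|GG : M|%g.
  apply: (@pnat_index _ _ _ (nW _ _) _ t) => // _ /imgP[x Gx <-].
  rewrite FinRing.zmodXgE -psiMn //; apply/(fintype.subsetP sIM)/mem_img/expI/Gx.
have leM : (#|M : GI|%g <= 2 ^ s)%N.
  apply: leq_trans leT2; rewrite (norm_joinEr (nW GI GA) : M = (GI * GA)%g :> {set W}) indexMg.
  apply: (index_cover (g := psi \o g2)) => _ /imgP[x Ax <-].
  have [k Ik] := g2_cover x Ax; exists k.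
  exact: ((mem_rcoset_img psiB gI sIG (Gg2 k) (sAG _ Ax) kerI).2 Ik).
have leG : (2 ^ r <= #|GG : GI|%g)%N.
  apply: leq_trans leT1 _; apply: (index_inj (g := psi \o g1)) => [i|i k].
    exact: mem_img.
  by move=> /((mem_rcoset_img psiB gI sIG (Gg1 k) (Gg1 i) kerI).1) /g1_inj.
have := Lagrange_index sMG sAM; rewrite /= => <-; rewrite -/(gval M) -/(gval GG) in def_j *.
rewrite def_j dvdn_mulr // dvdn_exp2l // leq_subLR -(@leq_exp2l 2) // expnD mulnC.
apply: leq_trans leG _; rewrite -(Lagrange_index sMG sIM) def_j leq_mul2l leM.
by rewrite orbT.
Qed.

(** [G : A] = [G : L] [L : A]. The first factor is odd by Cauchy's theorem, as every element of [G]
    has an odd multiple in [L]; the second is at most the number of representatives. *)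
Lemma logn_subgroup_index (A L : set V) N (T : finType) (g : T -> V) k :
    subgrp A -> subgrp L -> (A `<=` L)%classic -> (L `<=` G)%classic ->
    (0 < N)%N -> (forall x, G x -> A (x *+ N)) ->
    (forall x, G x -> exists2 n, odd n & L (x *+ n)) ->
    (forall j, G (g j)) -> (forall x, L x -> exists j, A (x - g j)) -> (#|T| <= 2 ^ k)%N ->
  subgroup_index G A != 0%N /\ (logn 2 (subgroup_index G A) <= k)%N.
Proof.
move=> gA gL sAL sLG N_gt0 NA oddL Gg coverL leT.
have sAG : (A `<=` G)%classic by move=> x /sAL/sLG.
have [W [psi [psiB kerpsi]]] := fmG N_gt0.
have kerA x : G x -> psi x = 0 -> A x by move=> Gx /kerpsi[] // y Gy ->; apply: NA.
rewrite (index_img psiB) //.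
pose GG := Group (img_group_set psiB gG (fun x Gx => Gx)).
pose GA := Group (img_group_set psiB gA sAG); pose GL := Group (img_group_set psiB gL sLG).
have nW (X Y : {group W}) : Y \subset 'N(X)%g.
  apply: (fintype.subset_trans (finset.subsetT (Y : {set W}))).
  by apply: sub_abelian_norm (FinRing.zmod_abelian _) (finset.subsetT _).
have sAL' : GA \subset GL by apply/fintype.subsetP => _ /imgP[x Ax <-]; apply/mem_img/sAL.
have sLG' : GL \subset GG by apply/fintype.subsetP => _ /imgP[x Ix <-]; apply/mem_img/sLG.
have oddGL : odd #|GG : GL|%g.
  apply: odd_index => // _ /imgP[x Gx <-]; have [n odd_n Lxn] := oddL x Gx.
  by exists n => //; rewrite FinRing.zmodXgE -psiMn //; apply: mem_img.
have leL : (#|GL : GA|%g <= 2 ^ k)%N.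
  apply: leq_trans leT; apply: (index_cover (g := psi \o g)) => _ /imgP[x Lx <-].
  have [j Aj] := coverL x Lx; exists j.
  exact: ((mem_rcoset_img psiB gA sAG (Gg j) (sLG _ Lx) kerA).2 Aj).
have := Lagrange_index sLG' sAL'; rewrite /= => <-.
have ind_gt0 : (0 < #|GL : GA|%g)%N by exact: indexg_gt0.
have G_gt0 : (0 < #|GG : GL|%g)%N by exact: indexg_gt0.
split; first by rewrite -lt0n muln_gt0 ind_gt0 G_gt0.
rewrite lognM // (lognE 2 #|GG : GL|%g) dvdn2 oddGL /= andbF add0n.
rewrite -(@leq_exp2l 2) //; apply: leq_trans leL.
by apply: dvdn_leq => //; exact: pfactor_dvdnn.
Qed.

End SubgroupIndex.

(** * Bounds for the index of an element *)

Section ZAdjoin.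

Variable K : fieldExtType rat.
Implicit Types (x y : K) (al : K).
Local Notation OK := (@ring_of_integers K).

Lemma OK_subgrp : subgrp OK.
Proof. by split; [exact: OK0 | exact: OKB]. Qed.

Lemma nil2_subgrp : subgrp (@nil2 K).
Proof. by split; [exact/ev_nil2/ev0 | exact: nil2B]. Qed.

Lemma Zadjoin_subgrp al : subgrp (Zadjoin al).
Proof.
split; first by exists 0; rewrite ?rmorph0 ?horner0.
by move=> _ _ [p _ <-] [q _ <-]; exists (p - q); rewrite // rmorphB hornerD hornerN.
Qed.

Lemma ZadjoinM al x y : Zadjoin al x -> Zadjoin al y -> Zadjoin al (x * y).
Proof. by move=> [p _ <-] [q _ <-]; exists (p * q); rewrite // rmorphM hornerM. Qed.

Lemma Zadjoin_id al : Zadjoin al al.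
Proof. by exists 'X; rewrite ?map_polyX ?hornerX. Qed.

Lemma Zadjoin_int al (n : int) : Zadjoin al n%:~R.
Proof. by exists n%:P; rewrite ?map_polyC ?hornerC. Qed.

Lemma ZadjoinX al x n : Zadjoin al x -> Zadjoin al (x ^+ n).
Proof.
move=> Zx; elim: n => [|n IHn]; first exact: (Zadjoin_int al 1).
by rewrite exprS; exact: ZadjoinM.
Qed.

Lemma Zadjoin_OK al : OK al -> (Zadjoin al `<=` OK)%classic.
Proof.
move=> Oal _ [p _ <-]; rewrite horner_coef; apply: big_ind => [||i _].
- exact: OK0.
- exact: OKD.
by rewrite coef_map; apply: OKM; [exact: OK_int | exact: OKX].
Qed.

(* Division by a monic polynomial with value in the ideal I reduces Z[al] modulo I. *)
Lemma Zadjoin_reduce al (I : set K) (q : {poly int}) :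
    OK al -> (forall x y, OK x -> I y -> I (x * y)) ->
    q \is monic -> I (map_poly intr q).[al] ->
  forall x, Zadjoin al x -> exists2 r : {poly int}, (size r < size q)%N &
    I (x - (map_poly intr r).[al]).
Proof.
move=> Oal idI mon_q Iq _ [p _ <-].
exists (Pdiv.CommonRing.rmodp p q).
  by rewrite Pdiv.Ring.ltn_rmodp monic_neq0.
rewrite {1}(Pdiv.RingMonic.rdivp_eq mon_q p) rmorphD rmorphM /= hornerD hornerM addrK.
by apply: idI Iq; apply: (Zadjoin_OK Oal); exists (Pdiv.CommonRing.rdivp p q).
Qed.

Definition adjZ (A : set K) y : set K := [set a + n%:~R * y | a in A & n in [set: int]]%classic.

Fixpoint adjoinZ (A : set K) (ys : seq K) : set K :=
  if ys is y :: ys' then adjoinZ (adjZ A y) ys' else A.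

(** Each new element has its double in the group built so far, so each step multiplies the order
    over [A] by at most 2. *)
Fixpoint even_chain (A : set K) (ys : seq K) : Prop :=
  if ys is y :: ys' then A (2%:R * y) /\ even_chain (adjZ A y) ys' else True.

Lemma sub_adjZ A y : (A `<=` adjZ A y)%classic.
Proof. by move=> a Aa; exists a => //; exists 0; rewrite // mul0r addr0. Qed.

Lemma mem_adjZ A y : subgrp A -> adjZ A y y.
Proof. by case=> A0 _; exists 0 => //; exists 1; rewrite // mul1r add0r. Qed.

Lemma adjZ_subgrp A y : subgrp A -> subgrp (adjZ A y).
Proof.
move=> gA; split; first exact/sub_adjZ/(gA.1).
move=> _ _ [a Aa [n _ <-]] [c Ac [m _ <-]]; exists (a - c); first exact: (gA.2).
by exists (n - m); rewrite // rmorphB /=; ring.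
Qed.

Lemma subgrp_intM (A : set K) (n : int) x : subgrp A -> A x -> A (n%:~R * x).
Proof.
move=> gA Ax; rewrite mulrzl; case: n => n; first exact: subgrpMn.
by apply: subgrpN => //; exact: subgrpMn.
Qed.

Lemma adjoinZ_subgrp A ys : subgrp A -> subgrp (adjoinZ A ys).
Proof. by elim: ys A => //= y ys IHys A /(adjZ_subgrp y)/IHys. Qed.

Lemma sub_adjoinZ A ys : (A `<=` adjoinZ A ys)%classic.
Proof.
elim: ys A => [|y ys IHys] A a //= Aa.
exact/IHys/sub_adjZ.
Qed.

Lemma adjoinZ_OK A ys : (A `<=` OK)%classic -> {in ys, forall y, OK y} ->
  (adjoinZ A ys `<=` OK)%classic.
Proof.
elim: ys A => //= y ys IHys A sAO Oys.
have sAyO : (adjZ A y `<=` OK)%classic.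
  move=> _ [a Aa [n _ <-]]; apply: OKD; first exact: sAO.
  by apply: OKM; [exact: OK_int | apply: Oys; rewrite inE eqxx].
have Oys' : {in ys, forall z, OK z} by move=> z z_ys; apply: Oys; rewrite inE z_ys orbT.
exact: IHys sAyO Oys'.
Qed.

(** The representatives are the sums of subfamilies of [ys]: the coefficient of [y] matters only
    modulo 2, since 2 y is already in [A]. *)
Lemma even_chain_cover A ys : subgrp A -> (A `<=` OK)%classic -> {in ys, forall y, OK y} ->
    even_chain A ys ->
  exists s : seq K, [/\ size s = (2 ^ size ys)%N, {in s, forall y, OK y} &
    forall x, adjoinZ A ys x -> exists2 y, y \in s & A (x - y)].
Proof.
elim: ys A => [|y ys IHys] A gA sAO Oys /=.
  move=> _; exists [:: 0]; split=> // [z|x Ax]; first by rewrite inE => /eqP->; exact: OK0.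
  by exists 0; rewrite ?mem_head ?subr0.
case=> A2y chain_ys; have Oy : OK y by apply: Oys; rewrite inE eqxx.
have Oys' : {in ys, forall z, OK z} by move=> z z_ys; apply: Oys; rewrite inE z_ys orbT.
have sAyO : (adjZ A y `<=` OK)%classic.
  move=> _ [a Aa [n _ <-]]; apply: OKD; first exact: sAO.
  by apply: OKM => //; exact: OK_int.
have [s [size_s Os cover_s]] := IHys _ (adjZ_subgrp y gA) sAyO Oys' chain_ys.
exists (s ++ [seq z + y | z <- s]); split.
- by rewrite size_cat size_map size_s addnn expnS mul2n.
- move=> z; rewrite mem_cat => /orP[/Os //|/mapP[t t_s ->]].
  by apply: OKD => //; exact: Os.
move=> x /cover_s[z z_s [a Aa [n _ def_xz]]].
have Aeven (m : int) : A (m%:~R * (2%:R * y)) by exact: subgrp_intM.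
have def_n : n = (n %/ 2)%Z * 2 + (n %% 2)%Z by exact: divz_eq.
have [n0|n1] : (n %% 2)%Z = 0 \/ (n %% 2)%Z = 1 by lia.
  exists z; first by rewrite mem_cat z_s.
  rewrite -def_xz def_n n0 addr0 rmorphM /= -pmulrn -mulrA.
  by apply: subgrpD.
exists (z + y); first by rewrite mem_cat; apply/orP; right; apply/mapP; exists z.
have -> : x - (z + y) = a + ((n %/ 2)%Z)%:~R * (2%:R * y).
  by rewrite opprD addrA -def_xz {1}def_n n1 rmorphD rmorphM /= -pmulrn; ring.
exact: subgrpD.
Qed.

Lemma even_chain_exp A ys : subgrp A -> even_chain A ys ->
  forall x, adjoinZ A ys x -> A (x *+ (2 ^ size ys)).
Proof.
elim: ys A => //= y ys IHys A gA [A2y chain_ys] x.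
move=> /(IHys _ (adjZ_subgrp y gA) chain_ys)[a Aa [n _ def_x]].
rewrite expnSr mulrnA -def_x mulrnDl; apply: subgrpD => //; first exact: subgrpMn.
rewrite -[_ *+ 2]mulr_natl mulrCA; exact: subgrp_intM.
Qed.

End ZAdjoin.

Section IndexBounds.

Variables (K : fieldExtType rat) (theta : K) (f : {poly int}).
Hypotheses (mon_f : f \is monic) (f_irr : irreducible_poly (map_poly intr f : {poly rat})).
Hypotheses (f_theta : root (map_poly intr f) theta) (K_theta : primitive_elt theta).
Hypothesis size_f : size f = 7%N.

Local Notation OK := (@ring_of_integers K).

Lemma dimK6 : \dim {:K} = 6%N.
Proof. by rewrite (dim_primitive f_irr f_theta K_theta) size_f. Qed.

Lemma OK_theta : OK theta. Proof. by exists f. Qed.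

Lemma theta_Zfree (p : {poly int}) : (size p <= 6)%N -> (map_poly intr p).[theta] = 0 -> p = 0.
Proof.
move=> size_p p0; apply/eqP; apply: contraT => nz_p.
have nz_pQ : map_poly intr p != 0 :> {poly rat} by rewrite -size_poly_eq0 size_map_intr size_poly_eq0.
have := theta_dvdp f_irr f_theta (q := map_poly intr p).
rewrite map_in_alg_intr rootE p0 eqxx => /(_ isT)/(dvdp_leq nz_pQ).
by rewrite !size_map_intr size_f => /leq_trans/(_ size_p).
Qed.

Lemma theta_Zfree6 (c : seq int) : size c = 6%N ->
  \sum_(i < 6) (c`_i)%:~R * theta ^+ i = 0 -> c = nseq 6 0.
Proof.
move=> size_c c0; apply: (@eq_from_nth _ 0); rewrite ?size_nseq // size_c => i lti6.
have p0 : \poly_(i < 6) c`_i = 0.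
  apply: theta_Zfree; first exact: size_poly.
  rewrite (horner_coef_wide _ (n := 6)); last first.
    by rewrite (leq_trans (size_poly _ _)) // size_poly.
  rewrite -[RHS]c0; apply: eq_bigr => j _; by rewrite coef_map coef_poly ltn_ord.
by have /polyP/(_ i) := p0; rewrite coef_poly lti6 coef0 nth_nseq lti6.
Qed.

(** With [D] a common denominator, x is sent to the coordinates of D x on the powers of theta,
    modulo a multiple of D N; if these vanish, x is N times an integral element. *)
Lemma OK_finite_model : finite_model OK.
Proof.
move=> N N_gt0.
have [D nzD OKD'] := OK_denominator mon_f f_irr f_theta K_theta.
have /choice[q def_q] x : exists p : {poly int}, OK x ->
    (size p <= 6)%N /\ D%:~R * x = (map_poly intr p).[theta].
  have [Ox|nOx] := pselect (OK x); last by exists 0.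
  by have [p size_p def_p] := OKD' x Ox; exists p => _; rewrite size_f in size_p.
(* The factor |D| is cancelled against the one in D x; the factor 2 ensures M > 1, as required for
   ['Z_M] to be Z / M. *)
pose M := (`|D| * N * 2)%N.
have M_gt1 : (1 < M)%N by rewrite /M; move: nzD; rewrite -absz_gt0; nia.
exists 'rV['Z_M]_6, (fun x => \row_(i < 6) ((q x)`_i)%:~R); split.
  move=> x y Ox Oy; have [sx qx] := def_q x Ox; have [sy qy] := def_q y Oy.
  have [sxy qxy] := def_q _ (OKB Ox Oy).
  suff -> : q (x - y) = q x - q y by apply/rowP => i; rewrite !mxE coefB rmorphB.
  apply/eqP; rewrite -subr_eq0; apply/eqP; apply: theta_Zfree.
    rewrite (leq_trans (size_polyD _ _)) // size_polyN geq_max sxy.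
    by rewrite (leq_trans (size_polyD _ _)) // size_polyN geq_max sx.
  by rewrite !rmorphB /= !hornerE -qx -qy -qxy; ring.
move=> x Ox q0; have [sx qx] := def_q x Ox.
have Mq (i : nat) : (M%:Z %| (q x)`_i)%Z.
  have [lti6|le6i] := ltnP i 6; last by rewrite nth_default ?dvdz0 // (leq_trans sx).
  have /rowP/(_ (Ordinal lti6)) := q0; rewrite !mxE /= => /eqP.
  rewrite dvdzE.
  have Znat n : (n%:R == 0 :> 'Z_M) = (M %| n)%N.
    by rewrite Zp_nat -val_eqE /= Zp_cast.
  case: ((q x)`_i) => n; first by rewrite -pmulrn Znat.
  by rewrite NegzE mulrNz oppr_eq0 -pmulrn Znat.
pose p := \poly_(i < 6) ((q x)`_i %/ M)%Z.
have def_qx : q x = M%:Z *: p.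
  apply/polyP => i; rewrite coefZ coef_poly; case: ltnP => [_|le6i].
    by rewrite mulrC divzK.
  by rewrite mulr0 nth_default // (leq_trans sx).
have [s def_s] : exists s : int, `|D|%N%:Z = D * s.
  by have [D_ge0|D_lt0] := ltrP 0 D; [exists 1 | exists (-1)]; lia.
have def_M : M%:Z = D * (s * 2) * N by rewrite /M !PoszM def_s; ring.
exists ((s * 2)%:~R * (map_poly intr p).[theta]).
  by apply: OKM; [exact: OK_int | apply: (Zadjoin_OK OK_theta); exists p].
apply: (mulfI (x := D%:~R)); first by rewrite intr_K_eq0.
rewrite qx def_qx map_polyZ hornerZ /= def_M !rmorphM /= -[X in _ = _ * X]mulr_natl [N%:R]pmulrn.
set P := (_).[theta]; ring.
Qed.

(** O_K lies in the group generated by the six elements theta^i / D, so the product of their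
    exponents serves for all of O_K. *)
Lemma uniform_exponent (A : set K) : subgrp A ->
    (forall x, exists2 n, (0 < n)%N & A (x *+ n)) ->
  exists2 N, (0 < N)%N & forall x, OK x -> A (x *+ N).
Proof.
move=> gA expA; have [D nzD OKD'] := OK_denominator mon_f f_irr f_theta K_theta.
have /choice[n def_n] (i : nat) : exists n, (0 < n)%N /\ A (theta ^+ i / D%:~R *+ n).
  by have [n n_gt0 An] := expA (theta ^+ i / D%:~R); exists n.
exists (\prod_(i < 6) n i)%N; first by apply: prodn_gt0 => i; case: (def_n i).
move=> x Ox; have [q size_q def_x] := OKD' x Ox.
have nzDK : D%:~R != 0 :> K by rewrite intr_K_eq0.
have -> : x = \sum_(i < 6) (q`_i)%:~R * (theta ^+ i / D%:~R).
  apply: (mulfI nzDK); rewrite def_x (horner_coef_wide _ (n := 6)); last first.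
    by rewrite (leq_trans (size_poly _ _)) // (leq_trans size_q) // size_f.
  rewrite mulr_sumr; apply: eq_bigr => i _; rewrite coef_map /=.
  by rewrite mulrCA [D%:~R * _]mulrC divfK.
rewrite -sumrMnl; apply: big_ind => [||i _]; [exact: gA.1 | move=> *; exact: subgrpD |].
rewrite -mulrnAr; apply: subgrp_intM => //.
rewrite (bigD1 i) //= mulrnA; apply: subgrpMn => //.
by case: (def_n i).
Qed.

(** The lattice built from Z[al] by the chain contains a family independent modulo 2 O_K, hence has
    odd index in O_K, and it exceeds Z[al] by a factor at most 2^(size ys). Each element of K has a
    nonzero multiple in Z[al], so [al] generates K. *)
Lemma ind_upper (al : K) (ys b : seq K) :
    OK al -> {in ys, forall y, OK y} -> even_chain (Zadjoin al) ys ->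
    indep2 b -> (forall i, (i < 6)%N -> adjoinZ (Zadjoin al) ys b`_i) ->
  [/\ primitive_elt al, ind al != 0%N & (logn 2 (ind al) <= size ys)%N].
Proof.
move=> Oal Oys chain_ys ind_b sub_b.
have gA := Zadjoin_subgrp al; have gL := adjoinZ_subgrp ys gA.
have sAO := Zadjoin_OK Oal.
have combL n : adjoinZ (Zadjoin al) ys (comb n b).
  apply: big_ind => [||i _]; [exact: gL.1 | move=> *; exact: subgrpD |].
  by apply: subgrp_intM => //; apply: sub_b.
have intL (S : set K) (N : int) x : subgrp S -> S (N%:~R * x) -> S (x *+ `|N|%N).
  move=> gS; rewrite mulrzl; case: N => n // /(subgrpN gS).
  by rewrite NegzE mulrNz opprK abszN.
have expA x : exists2 n, (0 < n)%N & Zadjoin al (x *+ n).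
  have [N nzN [n def_n]] := Zfree_span dimK6 (indep2_Zfree ind_b) x.
  exists (`|N| * 2 ^ size ys)%N; first by rewrite muln_gt0 absz_gt0 nzN expn_gt0.
  by rewrite mulrnA; apply: even_chain_exp => //; apply: intL => //; rewrite def_n.
have [N N_gt0 NA] := uniform_exponent gA expA.
have [s [size_s Os cover_s]] := even_chain_cover gA sAO Oys chain_ys.
have nth_s i : OK s`_i.
  by have [/(mem_nth 0)/Os //|/(nth_default 0)->] := ltnP i (size s); exact: OK0.
have := @logn_subgroup_index K OK (OK_subgrp K) OK_finite_model (Zadjoin al)
  (adjoinZ (Zadjoin al) ys) N 'I_(size s) (fun i => s`_i) (size ys).
case=> //.
- exact: sub_adjoinZ.
- exact: adjoinZ_OK.
- move=> x Ox; have [M odd_M [n def_n]] := indep2_odd dimK6 ind_b Ox.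
  exists `|M|%N; first by lia.
  by apply: intL => //; rewrite def_n.
- move=> x /cover_s[y y_s Ay]; have lt_y : (index y s < size s)%N by rewrite index_mem.
  by exists (Ordinal lt_y); rewrite /= nth_index.
- by rewrite card_ord size_s.
move=> ind_neq0 le_ind; split=> //.
apply/vspaceP => x; rewrite memvf.
have [n n_gt0 [p _ def_p]] := expA x.
have -> : x = n%:R^-1 *: (map_poly intr p).[al].
  rewrite def_p -scaler_nat scalerA mulVf ?scale1r // pnatr_eq0 -lt0n //.
rewrite memvZ //; apply/Fadjoin1_polyP; exists (map_poly intr p).
by rewrite map_in_alg_intr.
Qed.

(** Counting modulo I = [nil2]: the [r] independent elements give 2^r classes of O_K, while the
    remainders modulo [q] give at most 2^(deg q) classes of Z[al]. *)
Lemma ind_lower_nil2 (al : K) (b : seq K) (q : {poly int}) r :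
    OK al -> (forall i, OK b`_i) ->
    (forall n : nat -> int, nil2 (\sum_(i < r) (n i)%:~R * b`_i) ->
       forall i, (i < r)%N -> (2 %| n i)%Z) ->
    q \is monic -> nil2 (map_poly intr q).[al] ->
  (2 ^ (r - (size q).-1) %| ind al)%N.
Proof.
move=> Oal Ob ind_b mon_q q_nil.
pose T n := {ffun 'I_n -> bool}.
apply: (@dvdn_subgroup_index K OK (OK_subgrp K) OK_finite_model (Zadjoin al) (@nil2 K) 1
  (T r) (T (size q).-1) (fun e => \sum_(i < r) (e i)%:R * b`_i)
  (fun e => \sum_(i < (size q).-1) (e i)%:R * al ^+ i)).
- exact: Zadjoin_subgrp.
- exact: Zadjoin_OK.
- exact: nil2_subgrp.
- exact: nil2_OK.
- by move=> x Ox; rewrite expn1 -mulr_natl; apply/ev_nil2/ev2.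
- move=> e; apply: big_ind => [||i _]; [exact: OK0 | exact: OKD |].
  by apply: OKM => //; exact: OK_nat.
- move=> e e' nil_e; apply/ffunP => i.
  pose n j : int := if insub j is Some k then (e k)%:R - (e' k)%:R else 0.
  have nE j : n (val j) = (e j)%:R - (e' j)%:R by rewrite /n valK.
  have: (2 %| n i)%Z.
    apply: ind_b => //; rewrite -sumrB in nil_e; congr nil2: nil_e.
    by apply: eq_bigr => j _; rewrite nE rmorphB /= !rmorph_nat -mulrBl.
  by rewrite nE; case: (e i); case: (e' i).
- move=> e; apply: big_ind => [||i _]; [exact: OK0 | exact: OKD |].
  by apply: OKM; [exact: OK_nat | exact: OKX].
- move=> x /(Zadjoin_reduce Oal (@nil2Ml K) mon_q q_nil)[p size_p nil_x].
  exists [ffun i : 'I_(size q).-1 => ~~ (2 %| p`_i)%Z].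
  have size_p' : (size p <= (size q).-1)%N by rewrite -ltnS prednK // (leq_ltn_trans _ size_p).
  rewrite -[x - _](subrKA (map_poly intr p).[al]) ; apply: nil2D => //.
  rewrite (horner_coef_wide _ (n := (size q).-1)) ?(leq_trans (size_poly _ _)) //.
  rewrite -sumrB; apply/ev_nil2/ev_sum => i; rewrite ffunE coef_map /= -mulrBl.
  apply: evMr; last exact: OKX.
  have -> : (p`_i)%:~R - (~~ (2 %| p`_i)%Z)%:R = (p`_i - (~~ (2 %| p`_i)%Z)%:Z)%:~R :> K.
    by rewrite rmorphB /= -pmulrn.
  by apply: ev_int; case: (boolP (2 %| p`_i)%Z) => /=; lia.
- by rewrite card_ffun card_bool card_ord.
by rewrite card_ffun card_bool card_ord.
Qed.

End IndexBounds.

Section FieldIndex.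

Variable K : fieldExtType rat.
Local Notation OK := (@ring_of_integers K).

Lemma ind_monogenic (al : K) : OK = Zadjoin al -> ind al = 1%N.
Proof.
rewrite /ind => <-; rewrite /subgroup_index.
suff -> : cosets OK OK = [set OK]%classic by rewrite fset_set1 cardfs1.
have coset_OK x : OK x -> [set x + h | h in OK]%classic = OK.
  move=> Ox; apply/seteqP; split=> [_ [h Oh <-]|y Oy]; first exact: OKD.
  by exists (y - x); [exact: OKB | rewrite addrC subrK].
apply/seteqP; split=> [_ [x Ox <-]|_ ->]; first exact: coset_OK.
by exists 0; [exact: OK0 | exact/coset_OK/OK0].
Qed.

(** The lower bound is stated for all integral [al], so that it applies directly to the generator in
    [monogenic], whose index is 1. *)
Lemma vp2_field_index k :
    (forall al : K, OK al -> (2 ^ k %| ind al)%N) ->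
    (exists2 al : K, OK al & [/\ primitive_elt al, ind al != 0%N & (logn 2 (ind al) <= k)%N]) ->
  vp 2 (field_index K) = k /\ ((0 < k)%N -> ~ monogenic K).
Proof.
move=> lower [al Oal [prim_al ind_neq0 le_ind]]; split; last first.
  move=> k_gt0 [be Obe /ind_monogenic ind1]; have := lower be Obe.
  by rewrite ind1 dvdn1 -(expn0 2) eqn_exp2l // gtn_eqF.
have gcdP := gcd_setP [set ind alpha | alpha in
  [set alpha : K | ring_of_integers alpha /\ primitive_elt alpha]]%classic.
have dvd_al : (field_index K %| ind al)%N.
  by apply: ((gcdP (field_index K)).1 (dvdnn _)); exists al.
have k_dvd : (2 ^ k %| field_index K)%N.
  by apply: (gcdP (2 ^ k)%N).2 => _ [be [Obe _] <-]; exact: lower.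
have fi_gt0 : (0 < field_index K)%N by apply: dvdn_gt0 dvd_al; rewrite lt0n.
rewrite /vp absz_nat; apply/eqP; rewrite eqn_leq; apply/andP; split.
  by apply: leq_trans le_ind; apply: dvdn_leq_log; rewrite // lt0n.
by rewrite -pfactor_dvdn.
Qed.

End FieldIndex.

Section IndexBoundIdeal.

Variables (K : fieldExtType rat) (theta : K) (f : {poly int}).
Hypotheses (mon_f : f \is monic) (f_irr : irreducible_poly (map_poly intr f : {poly rat})).
Hypotheses (f_theta : root (map_poly intr f) theta) (K_theta : primitive_elt theta).
Hypothesis size_f : size f = 7%N.

Local Notation OK := (@ring_of_integers K).

Definition ideal2 (ka : K) : set K :=
  [set x | exists u v, [/\ OK u, OK v & x = 2%:R * u + ka * v]]%classic.

Lemma ideal2_subgrp ka : subgrp (ideal2 ka).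
Proof.
split; first by exists 0, 0; split; rewrite ?mulr0 ?addr0 //; exact: OK0.
move=> _ _ [u [v [Ou Ov ->]]] [u' [v' [Ou' Ov' ->]]].
by exists (u - u'), (v - v'); split; [exact: OKB | exact: OKB | ring].
Qed.

(* With N = 2 OK + ka OK and I = 2 N, the quotient OK / I has order at least
   2^6 * 2^4, whereas the image of Z[al] is spanned by 1, al, y, al y with
   y = al^2 - al, the last two being killed by 2 and all of them by 4. *)
Lemma ind_lower_ideal2 (al ka : K) (b b' : seq K) :
    OK al -> OK ka -> (forall i, OK b`_i) -> (forall i, OK b'`_i) -> indep2 b ->
    (forall n : nat -> int, ideal2 ka (\sum_(i < 4) (n i)%:~R * b'`_i) ->
       forall i, (i < 4)%N -> (2 %| n i)%Z) ->
    ideal2 ka (al ^+ 2 - al) ->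
    (exists2 w, ideal2 ka w & (al ^+ 2 - al) ^+ 2 = 2%:R * w) ->
  (2 ^ 4 %| ind al)%N.
Proof.
move=> Oal Oka Ob Ob' ind_b ind_b' Ny [w Nw def_y2].
pose I : set K := [set x | exists2 y, ideal2 ka y & x = 2%:R * y]%classic.
set y := al ^+ 2 - al in Ny def_y2.
have N_OK x : ideal2 ka x -> OK x.
  case=> u [v [Ou Ov ->]]; apply: OKD; apply: OKM => //; exact: OK_nat.
have N_ev x : ev x -> ideal2 ka x.
  by case/evP=> z Oz ->; exists z, 0; split=> //; [exact: OK0 | rewrite mulr0 addr0].
have N_ideal x z : OK x -> ideal2 ka z -> ideal2 ka (x * z).
  move=> Ox [u [v [Ou Ov ->]]]; exists (x * u), (x * v).
  by split; [exact: OKM | exact: OKM | ring].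
have gN := ideal2_subgrp ka.
have gI : subgrp I.
  split; first by exists 0; [exact: gN.1 | rewrite mulr0].
  move=> _ _ [x Nx ->] [z Nz ->]; exists (x - z); first exact: (gN.2).
  by rewrite mulrBr.
have idI x z : OK x -> I z -> I (x * z).
  by move=> Ox [t Nt ->]; exists (x * t); [exact: N_ideal | rewrite mulrCA].
have I4 x : OK x -> I (4%:R * x).
  move=> Ox; exists (2%:R * x); first exact/N_ev/ev2.
  by rewrite mulrA -natrM.
have I_ev x : I x -> ev x by move=> [z /N_OK Oz ->]; exact: ev2.
have Oy : OK y by apply: N_OK.
pose T n := {ffun 'I_n -> bool}.
pose nn r (e e' : T r) j : int := if insub j is Some k then (e k)%:R - (e' k)%:R else 0.
have nnE r (e e' : T r) (j : 'I_r) : nn r e e' j = (e j)%:R - (e' j)%:R by rewrite /nn valK.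
have nn_sum r (e e' : T r) (c : seq K) :
    \sum_(i < r) (e i)%:R * c`_i - \sum_(i < r) (e' i)%:R * c`_i =
    \sum_(i < r) (nn r e e' i)%:~R * c`_i.
  rewrite -sumrB; apply: eq_bigr => j _.
  by rewrite nnE rmorphB /= !rmorph_nat -mulrBl.
have nn_inj r (e e' : T r) : (forall i, (i < r)%N -> (2 %| nn r e e' i)%Z) -> e = e'.
  move=> even_n; apply/ffunP => i; have := even_n i (ltn_ord i).
  by rewrite nnE; case: (e i); case: (e' i).
have O_sum r (e : T r) (c : seq K) : (forall i, OK c`_i) -> OK (\sum_(i < r) (e i)%:R * c`_i).
  move=> Oc; apply: big_ind => [||i _]; [exact: OK0 | exact: OKD |].
  by apply: OKM => //; exact: OK_nat.
rewrite -[4%N]/(10 - 6)%N.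
apply: (@dvdn_subgroup_index K OK (OK_subgrp K) (OK_finite_model mon_f f_irr f_theta K_theta size_f)
  (Zadjoin al) I 2 (T 6 * T 4)%type ('I_4 * 'I_4 * (bool * bool))%type
  (fun e => \sum_(i < 6) (e.1 i)%:R * b`_i + 2%:R * \sum_(i < 4) (e.2 i)%:R * b'`_i)
  (fun e => (e.1.1 : nat)%:R + (e.1.2 : nat)%:R * al + (e.2.1 : nat)%:R * y
            + (e.2.2 : nat)%:R * (al * y))).
- exact: Zadjoin_subgrp.
- exact: Zadjoin_OK.
- exact: gI.
- by move=> x /I_ev/ev_OK.
- by move=> x Ox; rewrite -mulr_natl; apply: I4.
- by move=> e; apply: OKD; [|apply: OKM; first exact: OK_nat]; apply: O_sum.
- move=> [e d] [e' d'] /= Ie.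
  have eqe : e = e'.
    apply: (nn_inj 6); apply: ind_b; rewrite /comb -nn_sum.
    have sub_eq (X Y Z W : K) : X - Z = (X + 2%:R * Y - (Z + 2%:R * W)) - 2%:R * (Y - W).
      by ring.
    rewrite (sub_eq _ (\sum_(i < 4) (d i)%:R * b'`_i) _ (\sum_(i < 4) (d' i)%:R * b'`_i)).
    apply: evB; first exact: I_ev Ie.
    by apply/ev2/OKB; apply: O_sum.
  congr pair => //; apply: (nn_inj 4); apply: ind_b'; rewrite -nn_sum.
  case: Ie => z Nz; rewrite eqe opprD addrACA subrr add0r -mulrBr.
  by move/(mulfI (two_neq0 K)) ->.
- move=> e; do !apply: OKD; do ?[exact: OK_nat | apply: OKM => //]; exact: OK_nat.
(* ['X^4 + p] is (X^2 - X)^2, whose value at [al] lies in I by assumption. *)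
- pose p : {poly int} := 'X^2 - 'X^3 *+ 2.
  have size_p : (size p <= 4)%N.
    apply/leq_sizeP => j le4j; rewrite coefB coefMn !coefXn.
    by case: j le4j => [|[|[|[|j]]]] // _; rewrite mul0rn subr0.
  have [mon_q size_q] := monic_XnD size_p.
  have q_al : (map_poly intr ('X^4 + p)).[al] = (al ^+ 2 - al) ^+ 2.
    rewrite rmorphD rmorphB rmorphMn /= !map_polyXn !(hornerD, hornerN, hornerMn, hornerXn).
    by ring.
  have Iq : I (map_poly intr ('X^4 + p)).[al] by rewrite q_al def_y2; exists w.
  move=> x /(Zadjoin_reduce Oal idI mon_q Iq)[r]; rewrite size_q ltnS => size_r Ixr.
  (* Passage to the generators 1, al, y, al y, through al^2 = y + al and al^3 = al y + y + al. *)
  have def_r : (map_poly intr r).[al] =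
      (r`_0)%:~R + (r`_1 + r`_2 + r`_3)%:~R * al + (r`_2 + r`_3)%:~R * y + (r`_3)%:~R * (al * y).
    rewrite (horner_coef_wide _ (n := 4)) ?(leq_trans (size_poly _ _)) //.
    rewrite !big_ord_recr big_ord0 /= !coef_map /= !rmorphD /= /y; ring.
  have mod_lt (n d : int) : 0 < d -> (`|(n %% d)%Z|%N < `|d|)%N.
    by move=> d_gt0; have := ltz_pmod n d_gt0; have := modz_ge0 n (lt0r_neq0 d_gt0); lia.
  exists ((Ordinal (mod_lt r`_0 4 isT), Ordinal (mod_lt (r`_1 + r`_2 + r`_3) 4 isT)),
          (~~ (2 %| r`_2 + r`_3)%Z, ~~ (2 %| r`_3)%Z)).
  rewrite -[x - _](subrKA (map_poly intr r).[al]); apply: subgrpD => // {x Ixr}.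
  rewrite def_r /=; set n1 := r`_1 + r`_2 + r`_3; set n2 := r`_2 + r`_3.
  move: (r`_0) n1 n2 (r`_3) => n0 n1 n2 n3.
  have mod4 (n : int) x : OK x -> I ((n%:~R - (`|(n %% 4)%Z|%N)%:R) * x).
    move=> Ox; have -> : n%:~R - (`|(n %% 4)%Z|%N)%:R = 4%:R * ((n %/ 4)%Z)%:~R :> K.
      have {1}-> : n = 4 * (n %/ 4)%Z + (`|(n %% 4)%Z|%N)%:Z.
        by have := divz_eq n 4; have := @modz_ge0 n 4 isT; lia.
      by rewrite rmorphD rmorphM /= -!pmulrn addrK.
    by rewrite -mulrA; apply/I4/OKM => //; exact: OK_int.
  have mod2 (n : int) x : OK x -> I ((n%:~R - (~~ (2 %| n)%Z : nat)%:R) * (x * y)).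
    move=> Ox; have -> : n%:~R - (~~ (2 %| n)%Z : nat)%:R = 2%:R * ((n %/ 2)%Z)%:~R :> K.
      have {1}-> : n = 2 * (n %/ 2)%Z + (~~ (2 %| n)%Z : nat)%:Z.
        by case: (boolP (2 %| n)%Z) => /=; lia.
      by rewrite rmorphD rmorphM /= -!pmulrn addrK.
    exists ((n %/ 2)%Z%:~R * (x * y)); last by rewrite -mulrA.
    exact: (N_ideal _ _ (OK_int K _) (N_ideal _ _ Ox Ny)).
  have -> : n0%:~R + n1%:~R * al + n2%:~R * y + n3%:~R * (al * y) -
      ((`|(n0 %% 4)%Z|%N)%:R + (`|(n1 %% 4)%Z|%N)%:R * al + (~~ (2 %| n2)%Z : nat)%:R * y +
       (~~ (2 %| n3)%Z : nat)%:R * (al * y)) =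
      (n0%:~R - (`|(n0 %% 4)%Z|%N)%:R) * 1 + (n1%:~R - (`|(n1 %% 4)%Z|%N)%:R) * al +
      ((n2%:~R - (~~ (2 %| n2)%Z : nat)%:R) * (1 * y) +
       (n3%:~R - (~~ (2 %| n3)%Z : nat)%:R) * (al * y)).
    by ring.
  apply: subgrpD => //; apply: subgrpD => //;
    [apply/mod4/OK1 | exact: mod4 | apply/mod2/OK1 | exact: mod2].
- by rewrite card_prod !card_ffun card_bool !card_ord.
by rewrite !card_prod card_bool !card_ord.
Qed.


End IndexBoundIdeal.

(** * Structure constants *)

(** F_4 is the common target of all residue maps: a prime with residue field F_2 corresponds to a
    map with values in the prime subfield, that is with [q = [::]]. *)
Lemma field4 : exists (F : finFieldType) (w : F),
  [/\ 2%:R = 0 :> F, w ^+ 2 = w + 1 & #|F| = 4%N].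
Proof.
have [F F2 cardF] := @PrimePowerField 2 2 isT isT.
have two0 : 2%:R = 0 :> F by case/andP: F2 => _ /eqP.
have [w w01] : exists w : F, w \notin [:: 0; 1].
  apply/existsP; rewrite -negb_forall; apply/negP => /forallP all01.
  have sub : F \subset ([:: 0; 1] : seq F) by apply/fintype.subsetP => x _; exact: all01.
  have := leq_trans (subset_leq_card sub) (card_size _).
  by rewrite cardF.
exists F, w; split=> //; have := expf_card w; rewrite cardF => w4.
rewrite !inE negb_or in w01; case/andP: w01 => w0 w1.
have: w * (w - 1) * (w ^+ 2 - (w + 1)) = 0.
  have -> : w * (w - 1) * (w ^+ 2 - (w + 1)) = w ^+ 4 - w + 2%:R * (w - w ^+ 3) by ring.
  by rewrite w4 two0 mul0r subrr addr0.
by move/eqP; rewrite !mulf_eq0 !subr_eq0 (negPf w0) (negPf w1) => /eqP.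
Qed.

Lemma lt6_ind (P : nat -> Prop) :
  P 0%N -> P 1%N -> P 2%N -> P 3%N -> P 4%N -> P 5%N -> forall i, (i < 6)%N -> P i.
Proof. by move=> P0 P1 P2 P3 P4 P5 [|[|[|[|[|[|i]]]]]]. Qed.

Lemma le_lt6_ind (P : nat -> nat -> Prop) :
    (forall j, (j < 6)%N -> P 0%N j) ->
    P 1%N 1%N -> P 1%N 2%N -> P 1%N 3%N -> P 1%N 4%N -> P 1%N 5%N ->
    P 2%N 2%N -> P 2%N 3%N -> P 2%N 4%N -> P 2%N 5%N ->
    P 3%N 3%N -> P 3%N 4%N -> P 3%N 5%N -> P 4%N 4%N -> P 4%N 5%N -> P 5%N 5%N ->
  forall i j, (i <= j < 6)%N -> P i j.
Proof.
move=> P0 ? ? ? ? ? ? ? ? ? ? ? ? ? ? ? i j /andP[+ ltj].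
by case: j ltj => [|[|[|[|[|[|j]]]]]] // _; case: i => [|[|[|[|[|[|i]]]]]] // _; apply: P0.
Qed.

Section LatticeRing.

Variables (K : fieldExtType rat) (b : seq K) (c : seq (seq (seq int))).
Local Notation OK := (@ring_of_integers K).
Local Notation sc i j := (nth [::] (nth [::] c i) j).

Definition struct_const : Prop := forall i j, (i <= j < 6)%N ->
  b`_i * b`_j = comb (fun k => (sc i j)`_k) b.

Definition dotp (n : nat -> int) (p : seq int) : int := \sum_(i < 6) n i * p`_i.

Lemma dotpE n p : dotp n p =
  n 0%N * p`_0 + n 1%N * p`_1 + n 2%N * p`_2 + n 3%N * p`_3 + n 4%N * p`_4 + n 5%N * p`_5.
Proof. by rewrite /dotp !big_ord_recr big_ord0 /= add0r. Qed.

(* The homomorphism from the lattice to the field of order 4 that maps b`_i to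
   p`_i + q`_i w, where w ^ 2 = w + 1. *)
Definition hom4 (p q : seq int) : Prop := forall i j, (i <= j < 6)%N ->
  (2 %| dotp (fun k => (sc i j)`_k) p - (p`_i * p`_j + q`_i * q`_j))%Z /\
  (2 %| dotp (fun k => (sc i j)`_k) q - (p`_i * q`_j + q`_i * p`_j + q`_i * q`_j))%Z.

Hypotheses (free_b : Zfree b) (b_sc : struct_const) (b0 : b`_0 = 1).

Section Hom.

Variables (p q : seq int).
Hypotheses (pq_hom : hom4 p q) (p0 : p`_0 = 1) (q0 : q`_0 = 0).

Section Field.

Variables (F : finFieldType) (w : F).
Hypotheses (F2 : 2%:R = 0 :> F) (w2 : w ^+ 2 = w + 1).

Let h : seq F := [seq (p`_i)%:~R + (q`_i)%:~R * w | i <- iota 0 6].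

Lemma nth_hom i : (i < 6)%N -> h`_i = (p`_i)%:~R + (q`_i)%:~R * w.
Proof. by move=> lti6; rewrite (nth_map 0%N) ?size_iota // nth_iota. Qed.

Lemma even_F4 (n : int) : (2 %| n)%Z -> n%:~R = 0 :> F.
Proof. by case/dvdzP=> k ->; rewrite rmorphM /= -pmulrn F2 mulr0. Qed.

Lemma odd_F4 (n : int) : ~~ (2 %| n)%Z -> n%:~R = 1 :> F.
Proof.
move=> odd_n; apply/eqP; rewrite -subr_eq0 -[1]/(1%:~R) -rmorphB; apply/eqP/even_F4.
by move: odd_n; lia.
Qed.

Lemma F4_eq0 (m n : int) : m%:~R + n%:~R * w = 0 -> (2 %| m)%Z /\ (2 %| n)%Z.
Proof.
have w_neq0 : w != 0.
  by apply: contraTneq isT => w0; have /eqP := w2; rewrite w0 expr0n add0r eq_sym oner_eq0.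
have w_neq1 : 1 + w != 0.
  apply: contraTneq isT => w1; have /eqP := w2; rewrite addrC w1 expf_eq0.
  by rewrite (negPf w_neq0).
case: (boolP (2 %| m)%Z) => [/even_F4->|/odd_F4->];
  case: (boolP (2 %| n)%Z) => [/even_F4->|/odd_F4->] //;
  rewrite ?mul0r ?mul1r ?add0r ?addr0 => /eqP; rewrite ?oner_eq0 ?(negPf w_neq0) ?(negPf w_neq1) //.
Qed.

Lemma redn_comb n : redn b h (comb n b) ((dotp n p)%:~R + (dotp n q)%:~R * w).
Proof.
exists n => //; rewrite !rmorph_sum /= mulr_suml -big_split; apply: eq_bigr => i _.
by rewrite nth_hom // !rmorphM /=; ring.
Qed.

Lemma redn_hom1 : redn b h 1 1.
Proof. by rewrite -b0; have := redn_basis b h (isT : (0 < 6)%N); rewrite nth_hom // p0 q0 mul0r addr0. Qed.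

Lemma redn_hom_table i j : (i <= j < 6)%N -> redn b h (b`_i * b`_j) (h`_i * h`_j).
Proof.
move=> ltij; have /andP[leij ltj6] := ltij; have lti6 := leq_ltn_trans leij ltj6.
rewrite b_sc //; have [/even_F4 evp /even_F4 evq] := pq_hom ltij.
suff -> : h`_i * h`_j = (dotp (fun k => (sc i j)`_k) p)%:~R + (dotp (fun k => (sc i j)`_k) q)%:~R * w.
  exact: redn_comb.
move/eqP: evp; rewrite rmorphB subr_eq0 => /eqP->; move/eqP: evq; rewrite rmorphB subr_eq0 => /eqP->.
rewrite !nth_hom // !rmorphD !rmorphM /=; ring: w2.
Qed.

Lemma redn_comb_inj n v : redn b h (comb n b) v -> v = 0 -> (2 %| dotp n p)%Z /\ (2 %| dotp n q)%Z.
Proof. by move=> r v0; apply: F4_eq0; rewrite -(redn_uniq free_b r (redn_comb n)). Qed.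

End Field.

Lemma hom_nil2 n : nil2 (comb n b) -> (2 %| dotp n p)%Z /\ (2 %| dotp n q)%Z.
Proof.
have [F [w [F2 w2 _]]] := field4 => nil_n.
apply: (redn_comb_inj F2 w2 (redn_comb w n)).
exact: (redn_nil2 free_b (redn_hom1 w) (redn_hom_table F2 w2) F2 (redn_comb w n) nil_n).
Qed.

Lemma hom_nil2_ideal j n m : (j < 6)%N -> p`_j = 0 -> q`_j = 0 ->
  nil2 (comb n b - b`_j * comb m b) -> (2 %| dotp n p)%Z /\ (2 %| dotp n q)%Z.
Proof.
have [F [w [F2 w2 _]]] := field4 => ltj6 pj0 qj0 nil_nm.
have rn := redn_comb w n; apply: (redn_comb_inj F2 w2 rn).
have rj := redn_basis b [seq (p`_i)%:~R + (q`_i)%:~R * w | i <- iota 0 6] ltj6.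
rewrite nth_hom // pj0 qj0 mul0r addr0 in rj.
have rjm := rednM (redn_hom_table F2 w2) rj (redn_comb w m).
have := redn_nil2 free_b (redn_hom1 w) (redn_hom_table F2 w2) F2 (rednB rn rjm) nil_nm.
by rewrite mul0r subr0.
Qed.

(** All elements of F_4 satisfy v^4 = v. Applied to every residue map at once, this places x^4 - x
    among the nilpotents modulo 2. *)
Lemma hom_frob4 n m : comb m b = comb n b ^+ 4 - comb n b ->
  (2 %| dotp m p)%Z /\ (2 %| dotp m q)%Z.
Proof.
have [F [w [F2 w2 cardF]]] := field4 => eq_m; have rn := redn_comb w n.
set v := (_ + _) in rn.
have := rednB (rednX (redn_hom1 w) (redn_hom_table F2 w2) 4 rn) rn; rewrite -eq_m.
by move/(redn_comb_inj F2 w2); apply; rewrite -cardF expf_card subrr.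
Qed.

Lemma hom_frob2 n m : q = [::] -> comb m b = comb n b ^+ 2 - comb n b -> (2 %| dotp m p)%Z.
Proof.
have [F [w [F2 w2 _]]] := field4 => q_nil eq_m; have rn := redn_comb w n.
set v := (_ + _) in rn.
have v2 : v ^+ 2 = v.
  have -> : v = (dotp n p)%:~R.
    have q0' : dotp n q = 0 by rewrite /dotp q_nil big1 // => i _; rewrite nth_nil mulr0.
    by rewrite /v q0' mul0r addr0.
  by case: (boolP (2 %| dotp n p)%Z) => [/(even_F4 F2)->|/(odd_F4 F2)->]; rewrite ?expr0n ?expr1n.
have := rednB (rednX (redn_hom1 w) (redn_hom_table F2 w2) 2 rn) rn; rewrite -eq_m.
by rewrite v2 subrr => /(redn_comb_inj F2 w2) [].
Qed.

End Hom.

Lemma comb_mul n m : exists k, comb n b * comb m b = comb k b.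
Proof.
pose Lam : set K := [set x | exists k, x = comb k b]%classic.
have LamD x y : Lam x -> Lam y -> Lam (x + y).
  by move=> [k ->] [l ->]; exists (fun i => k i + l i); rewrite combD.
have Lam0 : Lam 0 by exists (fun=> 0); rewrite /comb big1 // => i _; rewrite mul0r.
have LamZ (t : int) x : Lam x -> Lam (t%:~R * x).
  by move=> [k ->]; exists (fun i => t * k i); rewrite combZ.
suff [k ->] : Lam (comb n b * comb m b) by exists k.
rewrite !big_distrlr /=; apply: big_ind => // i _; apply: big_ind => // j _.
rewrite mulrACA -rmorphM; apply: LamZ.
have [leij|/ltnW leji] := leqP i j.
  by rewrite b_sc ?leij ?ltn_ord //; exists (fun k => (sc i j)`_k).
by rewrite mulrC b_sc ?leji ?ltn_ord //; exists (fun k => (sc j i)`_k).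
Qed.

Lemma comb_exp n k : exists m, comb n b ^+ k = comb m b.
Proof.
elim: k => [|k [m IHk]].
  exists (fun i => (i == 0%N)%:Z); rewrite expr0 -b0 /comb big_ord_recl /= mul1r.
  by rewrite big1 ?addr0 // => i _; rewrite mul0r.
by rewrite exprS IHk; apply: comb_mul.
Qed.

Lemma comb_frob n k : exists m, comb m b = comb n b ^+ k - comb n b.
Proof.
have [m ->] := comb_exp n k; exists (fun i => m i + -1 * n i).
by rewrite combD combZ mulN1r.
Qed.

End LatticeRing.

Section Congruences.

Variables (K : fieldExtType rat) (b : seq K).
Hypothesis Ob : forall i, @ring_of_integers K b`_i.

Lemma OK_comb n : ring_of_integers (comb n b).
Proof.
apply: big_ind => [||i _]; [exact: OK0 | exact: OKD |].
by apply: OKM => //; exact: OK_int.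
Qed.

Lemma ev_comb n : (forall i, (i < 6)%N -> (2 %| n i)%Z) -> ev (comb n b).
Proof. by move=> even_n; apply: ev_sum => i; apply: evMr => //; exact/ev_int/even_n. Qed.

(** An integer is y + e with y in the lattice and e even; raising to the power 2^t is additive
    modulo 2, so the case of lattice elements suffices. *)
Lemma nil2_exp_sub t : \dim {:K} = 6%N -> indep2 b ->
    (forall n, @nil2 K (comb n b ^+ (2 ^ t) - comb n b)) ->
  forall x : K, ring_of_integers x -> nil2 (x ^+ (2 ^ t) - x).
Proof.
move=> dimK ind_b nil_b x Ox; have [n ev_n] := indep2_span dimK ind_b Ob Ox.
set y := comb n b in ev_n; set e := x - y in ev_n.
have Oy : ring_of_integers y by exact: OK_comb.
have def_x : x = y + e by rewrite addrC subrK.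
rewrite def_x -[_ - _](subrKA (y ^+ (2 ^ t) + e ^+ (2 ^ t))); apply: nil2D.
  by apply/ev_nil2/ev_expD => //; apply: ev_OK.
rewrite opprD addrACA; apply: nil2D; first exact: nil_b.
apply/ev_nil2/evB => //; case: (2 ^ t)%N (expn_gt0 2 t) => // k _; exact: evX.
Qed.

(** [M] holds the coordinates of [b'] on [b] modulo 2, and the last hypothesis is the invertibility
    of [M] modulo 2. *)
Lemma indep2_change (b' : seq K) (M : seq (seq int)) : indep2 b ->
    (forall i, (i < 6)%N -> ev (b'`_i - comb (fun j => (nth [::] M i)`_j) b)) ->
    (forall n : nat -> int,
      (forall j, (j < 6)%N -> (2 %| \sum_(i < 6) n i * (nth [::] M i)`_j)%Z) ->
      forall i, (i < 6)%N -> (2 %| n i)%Z) ->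
  indep2 b'.
Proof.
move=> ind_b b'b M_inv n ev_n; apply: M_inv; apply: ind_b.
have -> : comb (fun j => \sum_(i < 6) n i * (nth [::] M i)`_j) b =
    \sum_(i < 6) (n i)%:~R * comb (fun j => (nth [::] M i)`_j) b.
  rewrite /comb; under [RHS]eq_bigr => i _ do rewrite mulr_sumr.
  rewrite exchange_big; apply: eq_bigr => j _; rewrite rmorph_sum mulr_suml.
  by apply: eq_bigr => i _; rewrite rmorphM mulrA.
rewrite -[X in ev X](subKr (comb n b')); apply: evB => //.
rewrite -sumrB; apply: ev_sum => i; rewrite -mulrBr; apply: evMl; first exact: OK_int.
exact: b'b.
Qed.

End Congruences.

Ltac int_tac := repeat first
  [ exact: OK_int | exact: OK_nat | exact: OK1 | exact: OK0 | assumption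
  | apply: OKB | apply: OKD | apply: OKN | apply: OKM | apply: OKX ].

Ltac zadj_tac := repeat first
  [ exact: Zadjoin_id | exact: (Zadjoin_int _ 1) | exact: (Zadjoin_int _ 2)
  | apply: (subgrpD (Zadjoin_subgrp _)) | apply: (subgrpN (Zadjoin_subgrp _))
  | apply: ZadjoinM | apply: ZadjoinX ].

Ltac parity6 H :=
  have := H 0%N isT; have := H 1%N isT; have := H 2%N isT; have := H 3%N isT;
  have := H 4%N isT; have := H 5%N isT; rewrite !big_ord_recr !big_ord0 /=; clear;
  move=> ? ? ? ? ? ?; apply: lt6_ind; lia.

Section Criteria.

Variables (K : fieldExtType rat) (th : K) (f : {poly int}).
Hypotheses (mon_f : f \is monic) (f_irr : irreducible_poly (map_poly intr f : {poly rat})).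
Hypotheses (f_th : root (map_poly intr f) th) (K_th : primitive_elt th).
Hypothesis size_f : size f = 7%N.
Local Notation OK := (@ring_of_integers K).

(* al ^ 4 - al is a uniformizer eta at the ramified prime and even at the other
   ones, so that u' = (al ^ 4 - al) ^ 2 / 2 completes Z[al] at 2. *)
Lemma ind_upper1 (al eta u : K) : OK al -> OK eta -> OK u ->
    ev (al ^+ 4 - al - eta) -> eta ^+ 2 = 2%:R * u ->
    indep2 [:: 1; al; al ^+ 2; al ^+ 3; eta; u] ->
  [/\ primitive_elt al, ind al != 0%N & (logn 2 (ind al) <= 1)%N].
Proof.
move=> Oal Oeta Ou /evP[z Oz def_z] eta2 ind_b.
pose u' := u + 2%:R * (eta * z + z ^+ 2).
have def_u' : 2%:R * u' = (al ^+ 4 - al) ^+ 2.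
  have -> : al ^+ 4 - al = eta + 2%:R * z by rewrite -def_z; ring.
  by rewrite /u' mulrDr -eta2; ring.
pose b' := [:: 1; al; al ^+ 2; al ^+ 3; al ^+ 4; u'].
apply: (@ind_upper _ _ _ mon_f f_irr f_th K_th size_f al [:: u'] b') => //.
- by move=> x; rewrite inE => /eqP->; rewrite /u'; int_tac.
- by split=> //; rewrite def_u'; zadj_tac.
- apply: (indep2_change (M := [:: [:: 1]; [:: 0; 1]; [:: 0; 0; 1]; [:: 0; 0; 0; 1];
    [:: 0; 1; 0; 0; 1]; [:: 0; 0; 0; 0; 0; 1]]) ind_b).
    apply: lt6_ind; rewrite combE /=.
    1-4: apply: (evE (y := 0)); [exact: OK0 | ring].
      by apply: (evE Oz); rewrite -def_z; ring.
    by apply: (evE (y := eta * z + z ^+ 2)); [int_tac | rewrite /u'; ring].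
  by move=> n H; parity6 H.
apply: lt6_ind => /=; try by apply: sub_adjZ; zadj_tac.
by apply: mem_adjZ; exact: Zadjoin_subgrp.
Qed.

Lemma ind_lower_frob (t r : nat) (b' : seq K) :
    (forall x, OK x -> nil2 (x ^+ (2 ^ t) - x)) -> (0 < t)%N -> (forall i, OK b'`_i) ->
    (forall n : nat -> int, nil2 (\sum_(i < r) (n i)%:~R * b'`_i) ->
       forall i, (i < r)%N -> (2 %| n i)%Z) ->
  forall al, OK al -> (2 ^ (r - 2 ^ t) %| ind al)%N.
Proof.
move=> frob t_gt0 Ob' ind_b' al Oal.
have size_X : (size (- 'X : {poly int})%R <= 2 ^ t)%N.
  by rewrite size_polyN size_polyX (@leq_exp2l 2 1).
have [mon_q size_q] := monic_XnD size_X.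
have frob_q : nil2 (map_poly intr ('X^(2 ^ t) - 'X : {poly int})).[al].
  by rewrite rmorphB /= map_polyXn map_polyX hornerD hornerN hornerXn hornerX; exact: frob.
have := ind_lower_nil2 mon_f f_irr f_th K_th size_f Oal Ob' ind_b' mon_q frob_q.
by rewrite size_q.
Qed.

End Criteria.

(** * The case m = 2 *)

Lemma natr_K_neq0 (K : fieldExtType rat) n : n.+1%:R != 0 :> K.
Proof. by have := intr_K_eq0 K n.+1; rewrite -pmulrn => ->. Qed.

Ltac nz_tac := rewrite ?andbT; do ?[apply/andP; split]; first [assumption | exact: natr_K_neq0].

(* Structure constants of the order spanned by 1, th, ka, rho, psi, ga below;
   only the entries i <= j are given. *)
Definition table2 (a0 g b1 c3 : int) : seq (seq (seq int)) :=
[:: [:: [:: 1; 0; 0; 0; 0; 0];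
  [:: 0; 1; 0; 0; 0; 0];
  [:: 0; 0; 1; 0; 0; 0];
  [:: 0; 0; 0; 1; 0; 0];
  [:: 0; 0; 0; 0; 1; 0];
  [:: 0; 0; 0; 0; 0; 1]];
 [:: [::];
  [:: 0; - 1; - 1; - 1; 2; 0];
  [:: 0; 0; 0; 1; 0; 0];
  [:: - 4 * b1 * g; - 4 * a0; - 1; 0; 0; 4 * g];
  [:: - 2 * b1 * g; - 2 * a0; 0; 0; 1; 2 * g];
  [:: - 16 * c3 * g; 0; 0; 0; 0; 0]];
 [:: [::];
  [::];
  [:: - 32 * c3 * g ^+ 2; 2 * a0 - 2 * b1 * g; 2 * a0; - 1 + 2 * a0; - 4 * a0; 0];
  [:: 4 * b1 * g; 2 * a0 + 2 * b1 * g - 32 * c3 * g ^+ 2; 1 - 4 * a0 + 2 * b1 * g; 2 * b1 * g; - 4 * b1 * g; - 4 * g];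
  [:: - 16 * c3 * g ^+ 2; - 16 * c3 * g ^+ 2; - a0 + b1 * g; a0 + b1 * g; - 2 * a0 - 2 * b1 * g; 0];
  [:: 8 * c3 * g; 8 * c3 * g; 8 * c3 * g; 8 * c3 * g; - 16 * c3 * g; 0]];
 [:: [::];
  [::];
  [::];
  [:: 64 * c3 * g ^+ 2; - 2 * a0 + 2 * b1 * g + 32 * c3 * g ^+ 2; - 2 * a0 - 4 * b1 * g + 32 * c3 * g ^+ 2; 1 - 6 * a0 + 32 * c3 * g ^+ 2; 4 * a0 - 64 * c3 * g ^+ 2; 0];
  [:: 0; 0; - a0 - b1 * g + 16 * c3 * g ^+ 2; - a0 + b1 * g + 16 * c3 * g ^+ 2; - 2 * a0 - 2 * b1 * g - 32 * c3 * g ^+ 2; 0];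
  [:: 0; 0; - 16 * c3 * g; 0; 0; 0]];
 [:: [::];
  [::];
  [::];
  [::];
  [:: - 2 * b1 * g - 24 * c3 * g ^+ 2; - a0 - b1 * g - 8 * c3 * g ^+ 2; 8 * c3 * g ^+ 2; a0 + b1 * g + 8 * c3 * g ^+ 2; 1 - 4 * a0 - 2 * b1 * g - 16 * c3 * g ^+ 2; 2 * g];
  [:: - 4 * c3 * g; - 4 * c3 * g; - 4 * c3 * g; 4 * c3 * g; - 8 * c3 * g; 0]];
 [:: [::];
  [::];
  [::];
  [::];
  [::];
  [:: 2 * c3 - 16 * a0 * c3; 2 * c3; 2 * c3; - 2 * c3; - 4 * c3; b1]]].

(** Values on 1, th, ka, rho, psi, ga. Modulo 2, f = X^2 (X + 1)^4. Over the root 0 the relation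
    ga^2 = b1 ga leaves ga = 1 here and ga = 0 in [hom2_A']. *)
Lemma hom2_A a0 g b1 c3 : ~~ (2 %| b1)%Z -> hom4 (table2 a0 g b1 c3) [:: 1; 0; 0; 0; 0; 1] [::].
Proof. by move=> ?; apply: le_lt6_ind; [apply: lt6_ind|..]; rewrite !dotpE /=; lia. Qed.

Lemma hom2_A' a0 g b1 c3 : hom4 (table2 a0 g b1 c3) [:: 1; 0; 0; 0; 0; 0] [::].
Proof. by apply: le_lt6_ind; [apply: lt6_ind|..]; rewrite !dotpE /=; lia. Qed.

(** Modulo 8, f = X^2 (X - 1) (X + 1) (X^2 + 1). This is the prime with e = 2 of the factor X^2 + 1,
    the one where [ka] is a unit. *)
Lemma hom2_R a0 g b1 c3 : hom4 (table2 a0 g b1 c3) [:: 1; 1; 1; 1; 0; 0] [::].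
Proof. by apply: le_lt6_ind; [apply: lt6_ind|..]; rewrite !dotpE /=; lia. Qed.

(** Where th = 1 and ka = rho = ga = 0, the table gives psi^2 = psi + (a0 + g b1) modulo 2: two
    solutions in F_2 if the sum is even (B and C), a generator of F_4 otherwise. *)
Lemma hom2_B a0 g b1 c3 : (2 %| a0 + g * b1)%Z ->
  hom4 (table2 a0 g b1 c3) [:: 1; 1; 0; 0; 1; 0] [::].
Proof. by move=> ?; apply: le_lt6_ind; [apply: lt6_ind|..]; rewrite !dotpE /=; lia. Qed.

Lemma hom2_C a0 g b1 c3 : (2 %| a0 + g * b1)%Z ->
  hom4 (table2 a0 g b1 c3) [:: 1; 1; 0; 0; 0; 0] [::].
Proof. by move=> ?; apply: le_lt6_ind; [apply: lt6_ind|..]; rewrite !dotpE /=; lia. Qed.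

Lemma hom2_F4 a0 g b1 c3 : ~~ (2 %| a0 + g * b1)%Z ->
  hom4 (table2 a0 g b1 c3) [:: 1; 1; 0; 0; 0; 0] [:: 0; 0; 0; 0; 1; 0].
Proof. by move=> ?; apply: le_lt6_ind; [apply: lt6_ind|..]; rewrite !dotpE /=; lia. Qed.

Section Degree2.

Variables (K : fieldExtType rat) (th : K) (f : {poly int}).
Hypotheses (mon_f : f \is monic) (f_irr : irreducible_poly (map_poly intr f : {poly rat})).
Hypotheses (f_th : root (map_poly intr f) th) (K_th : primitive_elt th).
Hypothesis size_f : size f = 7%N.

Local Notation OK := (@ring_of_integers K).

(* Here f = X^6 + a X^2 + b X + c with a = 8 a0 - 1, b = 8 g b1 and
   c = 128 g^2 c3, where g is a power of 2. *)
Variables (a0 g b1 c3 : int).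
Hypotheses (g_neq0 : g != 0) (b1_odd : ~~ (2 %| b1)%Z).
Hypothesis f_eq : th ^+ 6 = - ((8%:R * a0%:~R - 1) * th ^+ 2 + 8%:R * g%:~R * b1%:~R * th
  + 128%:R * g%:~R ^+ 2 * c3%:~R).

Let ga := (th ^+ 5 + (8%:R * a0%:~R - 1) * th + 8%:R * g%:~R * b1%:~R) / (8%:R * g%:~R).
Let ka := (th ^+ 3 - th) / 2%:R.
Let rho := (th ^+ 4 - th ^+ 2) / 2%:R.
Let psi := (th ^+ 4 + th ^+ 3 + th ^+ 2 + th) / 4%:R.
Let b := [:: 1; th; ka; rho; psi; ga].

Let nzg : g%:~R != 0 :> K. Proof. by rewrite intr_K_eq0. Qed.

Let R5 : th ^+ 5 = th - 8%:R * a0%:~R * th - 8%:R * g%:~R * b1%:~R + 8%:R * g%:~R * ga.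
Proof. by rewrite /ga; field; nz_tac. Qed.

(** th ga = (th^6 + a th^2 + b th) / 2^v_2(b) = -c / 2^v_2(b). *)
Let Rc : th * ga = - (16%:R * g%:~R * c3%:~R).
Proof. by rewrite /ga; field: f_eq; nz_tac. Qed.

Let Rg : ga ^+ 2 = b1%:~R * ga - 2%:R * c3%:~R * (th ^+ 4 + 8%:R * a0%:~R - 1).
Proof.
have ga_eq : 8%:R * g%:~R * ga = th ^+ 5 + (8%:R * a0%:~R - 1) * th + 8%:R * g%:~R * b1%:~R.
  by rewrite R5; ring.
apply: (mulfI (x := 8%:R * g%:~R)); first by rewrite mulf_neq0 ?natr_K_neq0.
by rewrite expr2 mulrA ga_eq; ring: Rc.
Qed.

Let Oth : OK th. Proof. exact: OK_theta mon_f f_th. Qed.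

Let Oga : OK ga.
Proof.
apply: (@OK_trinomial _ 1 _ b1%:~R (- (2%:R * c3%:~R * (th ^+ 4 + 8%:R * a0%:~R - 1)))).
- by int_tac.
- by int_tac.
exact: Rg.
Qed.

Let Oka : OK ka.
Proof.
apply: (@OK_trinomial _ 1 _ (- th)
  (2%:R * (- a0%:~R * th ^+ 2 - g%:~R * b1%:~R * th - 16%:R * g%:~R ^+ 2 * c3%:~R))).
- by int_tac.
- by int_tac.
by rewrite /ka; field: Rc R5; nz_tac.
Qed.

Let Opsi : OK psi.
Proof.
apply: (@OK_trinomial _ 1 _ 1
  ((- a0%:~R * th - g%:~R * b1%:~R + g%:~R * ga) * (ka + th ^+ 2 + 2%:R * th + 2%:R))).
- by int_tac.
- by int_tac.
by rewrite /ka /psi; field: Rc R5 Rg; nz_tac.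
Qed.

Let Orho : OK rho.
Proof. by have -> : rho = ka * th by [rewrite /rho /ka; ring]; int_tac. Qed.

Let Ob i : OK b`_i.
Proof. by do 6?[case: i => [|i] //]; rewrite /b /= ?nth_nil; int_tac. Qed.

Let free_b : Zfree b.
Proof.
move=> n; rewrite combE /=.
set n0 := n 0%N; set n1 := n 1%N; set n2 := n 2%N; set n3 := n 3%N; set n4 := n 4%N; set n5 := n 5%N.
move=> comb0.
(* Coordinates on the powers of theta of 8 g times the combination. *)
pose c := [:: 8 * g * n0 + 8 * g * b1 * n5; 8 * g * n1 - 4 * g * n2 + 2 * g * n4 + (8 * a0 - 1) * n5;
  2 * g * n4 - 4 * g * n3; 4 * g * n2 + 2 * g * n4; 4 * g * n3 + 2 * g * n4; n5].
have /(theta_Zfree6 f_irr f_th size_f (c := c) erefl) : \sum_(i < 6) (c`_i)%:~R * th ^+ i = 0 :> K.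
  transitivity (8%:R * g%:~R * (n0%:~R * 1 + n1%:~R * th + n2%:~R * ka + n3%:~R * rho +
    n4%:~R * psi + n5%:~R * ga)); last by rewrite comb0 mulr0.
  by rewrite !big_ord_recr big_ord0 /= /ka /rho /psi /ga; field; nz_tac.
move=> [e0 e1 e2 e3 e4 e5].
have g_reg x : g * x = 0 -> x = 0 by move/eqP; rewrite mulf_eq0 (negPf g_neq0) => /eqP.
have n4_0 : n4 = 0 by have := g_reg (4 * n4); clear -e2 e4; lia.
have n3_0 : n3 = 0 by have := g_reg (4 * n3); clear -e4 n4_0; lia.
have n2_0 : n2 = 0 by have := g_reg (4 * n2); clear -e3 n4_0; lia.
have n1_0 : n1 = 0 by have := g_reg (8 * n1); clear -e1 n4_0 n2_0 e5; lia.
have n0_0 : n0 = 0 by have := g_reg (8 * n0); clear -e0 e5; lia.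
exact: lt6_ind.
Qed.

Let b_sc : struct_const b (table2 a0 g b1 c3).
Proof.
apply: le_lt6_ind; [apply: lt6_ind|..]; rewrite combE /= /ka /rho /psi; field: Rc R5 Rg; nz_tac.
Qed.

(** Equal to ka (th - 1); it lies in every prime above 2 and generates the nilpotents modulo 2. *)
Let eta := rho - ka.
(** Coordinates on [b] of eta^2 / 2. *)
Let nu : seq int := [:: - 4 * b1 * g + 16 * c3 * g ^+ 2; - 2 * a0 - 2 * b1 * g + 48 * c3 * g ^+ 2;
  - 1 + 4 * a0 - 4 * b1 * g + 16 * c3 * g ^+ 2; - 2 * a0 - 2 * b1 * g + 16 * c3 * g ^+ 2;
  4 * b1 * g - 32 * c3 * g ^+ 2; 4 * g].
Let u := comb (fun i => nu`_i) b.

Let eta2 : eta ^+ 2 = 2%:R * u.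
Proof. by rewrite /u combE /= /eta /ka /rho /psi; field: Rc R5 Rg; nz_tac. Qed.

Let Ou : OK u. Proof. exact: OK_comb. Qed.

Let eta_nil : nil2 eta.
Proof. by apply/nil2_sqr/ev_nil2; rewrite eta2; exact: ev2. Qed.

(** If eta = 2 x, then u = eta^2 / 2 = 2 x^2 would be killed by every residue map, but [u] has value
    1 at the ramified prime. *)
Let eta_odd : ~ ev eta.
Proof.
case/evP=> x Ox def_eta.
have def_u : u = 2%:R * x ^+ 2.
  by apply: (mulfI (two_neq0 K)); rewrite -eta2 def_eta; ring.
have nil_u : nil2 (comb (fun i => nu`_i) b) by apply/ev_nil2/(evE _ def_u)/OKX.
have [+ _] := hom_nil2 free_b b_sc erefl (@hom2_R _ _ _ _) erefl erefl nil_u.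
by rewrite dotpE /=; clear; lia.
Qed.

(** The residue maps have total rank 5 and see [ka] and [rho] only through their sum; the missing
    direction is that of [eta]. *)
Let nil_parity n : nil2 (comb n b) ->
  [/\ (2 %| n 0%N)%Z, (2 %| n 1%N)%Z, (2 %| n 4%N)%Z, (2 %| n 5%N)%Z & (2 %| n 2%N + n 3%N)%Z].
Proof.
move=> nil_n; have H p q pq p0 q0 := @hom_nil2 _ _ _ free_b b_sc erefl p q pq p0 q0 n nil_n.
have [+ _] := H _ _ (hom2_A a0 g c3 b1_odd) erefl erefl; have [+ _] := H _ _ (hom2_A' a0 g b1 c3) erefl erefl.
have [+ _] := H _ _ (hom2_R a0 g b1 c3) erefl erefl; rewrite !dotpE /=.
have [sig|sig] := boolP (2 %| a0 + g * b1)%Z.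
  have [+ _] := H _ _ (hom2_B c3 sig) erefl erefl; have [+ _] := H _ _ (hom2_C c3 sig) erefl erefl.
  by rewrite !dotpE /=; clear; move: (n 0%N) (n 1%N) (n 2%N) (n 3%N) (n 4%N) (n 5%N) => *; split; lia.
have [] := H _ _ (hom2_F4 c3 sig) erefl erefl; rewrite !dotpE /=; clear.
by move: (n 0%N) (n 1%N) (n 2%N) (n 3%N) (n 4%N) (n 5%N) => *; split; lia.
Qed.

Let comb_eta n : (2 %| n 0%N)%Z -> (2 %| n 1%N)%Z -> (2 %| n 4%N)%Z -> (2 %| n 5%N)%Z ->
    (2 %| n 2%N + n 3%N)%Z ->
  ev (comb n b) /\ (2 %| n 2%N)%Z \/ ev (comb n b - eta).
Proof.
move=> n0 n1 n4 n5 n23; have [n2|n2] := boolP (2 %| n 2%N)%Z.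
  by left; split=> //; apply: ev_comb => //; apply: lt6_ind => //; lia.
right; have -> : comb n b - eta = comb (fun i => n i + [:: 0; 0; 1; - 1]`_i) b.
  by rewrite !combE /= /eta !rmorphD /=; ring.
by apply: ev_comb => //; apply: lt6_ind => /=; lia.
Qed.

Let ind_b : indep2 b.
Proof.
move=> n ev_n; have [n0 n1 n4 n5 n23] := nil_parity (ev_nil2 ev_n).
have [[_ n2]|ev_n_eta] := comb_eta n0 n1 n4 n5 n23.
  by apply: lt6_ind => //; lia.
by case: eta_odd; rewrite -(subKr (comb n b) eta); apply: evB.
Qed.

Let nil_of_parity n : (2 %| n 0%N)%Z -> (2 %| n 1%N)%Z -> (2 %| n 4%N)%Z -> (2 %| n 5%N)%Z ->
  (2 %| n 2%N + n 3%N)%Z -> nil2 (comb n b).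
Proof.
move=> n0 n1 n4 n5 /(comb_eta n0 n1 n4 n5)[[/ev_nil2 //]|/ev_nil2 nil_n].
by rewrite -[comb n b](subrK eta); apply: nil2D.
Qed.

Let combine n (x : K) : x = comb n b -> (forall i, (i < 6)%N -> (2 %| n i)%Z) -> ev x.
Proof. by move=> ->; apply: ev_comb. Qed.

(** * Case (ii): one prime with residue field F_4 *)

Section OddCase.

Hypothesis sigma_odd : ~~ (2 %| a0 + g * b1)%Z.

Let frob4 n : nil2 (comb n b ^+ (2 ^ 2) - comb n b).
Proof.
have [m def_m] := comb_frob b_sc erefl n 4; rewrite -def_m.
have H p q pq p0 q0 := @hom_frob4 _ _ _ free_b b_sc erefl p q pq p0 q0 n m def_m.
have [+ _] := H _ _ (hom2_A a0 g c3 b1_odd) erefl erefl.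
have [+ _] := H _ _ (hom2_A' a0 g b1 c3) erefl erefl.
have [+ _] := H _ _ (hom2_R a0 g b1 c3) erefl erefl.
have [+ +] := H _ _ (hom2_F4 c3 sigma_odd) erefl erefl.
rewrite !dotpE /= => *; apply: nil_of_parity; lia.
Qed.

Let b5 := [:: 1; th; psi; ga; ka].

Let ind_b5 (n : nat -> int) : nil2 (\sum_(i < 5) (n i)%:~R * b5`_i) ->
  forall i, (i < 5)%N -> (2 %| n i)%Z.
Proof.
have -> : \sum_(i < 5) (n i)%:~R * b5`_i =
    comb (fun i => [:: n 0%N; n 1%N; n 4%N; 0; n 2%N; n 3%N]`_i) b.
  by rewrite combE !big_ord_recr big_ord0 /=; ring.
move/nil_parity => /= [h0 h1 h4 h5 h23].
by do 5?[case=> [|]] => // _; rewrite ?addr0 in h23.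
Qed.

(** Residues 1 and 0 at the two primes over the root 0, 0 at the ramified prime, and w in F_4. Three
    primes share the two residues of F_2, so one coincidence is unavoidable. [X2] and [X3] are al^2
    and al^3 modulo 2. *)
Let al := ga + psi.
Let X2 := ga + psi + th + rho.
Let X3 := ga + th + ka.

Let al2 : ev (al ^+ 2 - X2).
Proof.
(* Coordinates of al^2 - X2 on [b]; they are even because [b1] and a0 + g b1 are odd. *)
apply: (@combine (fun i => [:: 2 * c3 - 16 * a0 * c3 - 2 * b1 * g - 8 * c3 * g - 24 * c3 * g ^+ 2;
  - a0 + 2 * c3 - b1 * g - 8 * c3 * g - 8 * c3 * g ^+ 2 - 1; 2 * c3 - 8 * c3 * g + 8 * c3 * g ^+ 2;
  a0 - 2 * c3 + b1 * g + 8 * c3 * g + 8 * c3 * g ^+ 2 - 1;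
  - 4 * a0 - 4 * c3 - 2 * b1 * g - 16 * c3 * g - 16 * c3 * g ^+ 2; b1 + 2 * g - 1]`_i)).
  by rewrite combE /= /al /X2 /ka /rho /psi; field: Rc R5 Rg; nz_tac.
by apply: lt6_ind => /=; lia.
Qed.

Let al3 : ev (al ^+ 3 - X3).
Proof.
have -> : al ^+ 3 - X3 = al * (al ^+ 2 - X2) + (al * X2 - X3) by ring.
apply: evD; first by apply: evMl => //; rewrite /al; int_tac.
apply: (@combine (fun i => [:: 2 * c3 - 16 * a0 * c3 - 4 * b1 * g - 24 * c3 * g - 24 * c3 * g ^+ 2;
  - 3 * a0 + 2 * c3 - b1 * g - 8 * c3 * g - 8 * c3 * g ^+ 2 - 1;
  - a0 + 2 * c3 - b1 * g - 24 * c3 * g + 24 * c3 * g ^+ 2 - 1;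
  - 2 * c3 + 2 * b1 * g + 8 * c3 * g + 24 * c3 * g ^+ 2;
  2 - 6 * a0 - 4 * c3 - 4 * b1 * g - 16 * c3 * g - 48 * c3 * g ^+ 2; b1 + 4 * g - 1]`_i)).
  by rewrite combE /= /al /X2 /X3 /ka /rho /psi; field: Rc R5 Rg; nz_tac.
by apply: lt6_ind => /=; lia.
Qed.

Let al4 : ev (al ^+ 4 - al - eta).
Proof.
have -> : al ^+ 4 - al - eta = al * (al ^+ 3 - X3) + (al * X3 - al - eta) by ring.
apply: evD; first by apply: evMl => //; rewrite /al; int_tac.
apply: (@combine (fun i => [:: 2 * c3 - 16 * a0 * c3 - 2 * b1 * g - 12 * c3 * g - 16 * c3 * g ^+ 2;
  - 2 * a0 + 2 * c3 + 4 * c3 * g - 16 * c3 * g ^+ 2; - a0 + 2 * c3 + b1 * g + 4 * c3 * g + 1;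
  a0 - 2 * c3 + b1 * g + 12 * c3 * g - 1; - 2 * a0 - 4 * c3 - 2 * b1 * g - 24 * c3 * g;
  b1 + 2 * g - 1]`_i)).
  by rewrite combE /= /al /X3 /eta /ka /rho /psi; field: Rc R5 Rg; nz_tac.
by apply: lt6_ind => /=; lia.
Qed.

Let u_ka : ev (u - ka).
Proof.
apply: (@combine (fun i => nu`_i - (i == 2%N)%:Z)); first by rewrite /u !combE /=; ring.
by apply: lt6_ind => /=; lia.
Qed.

Let ind_al : indep2 [:: 1; al; al ^+ 2; al ^+ 3; eta; u].
Proof.
apply: (indep2_change (M := [:: [:: 1]; [:: 0; 0; 0; 0; 1; 1]; [:: 0; 1; 0; 1; 1; 1];
  [:: 0; 1; 1; 0; 0; 1]; [:: 0; 0; - 1; 1]; [:: 0; 0; 1]]) ind_b); last by move=> n H; parity6 H.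
apply: lt6_ind; rewrite combE /=.
- by apply: (evE (OK0 K)); ring.
- by apply: (evE (OK0 K)); rewrite /al; ring.
- by congr ev: al2; rewrite /X2; ring.
- by congr ev: al3; rewrite /X3; ring.
- by apply: (evE (OK0 K)); rewrite /eta; ring.
- by congr ev: u_ka; ring.
Qed.

Lemma field_index2_odd : vp 2 (field_index K) = 1%N /\ ((0 < 1)%N -> ~ monogenic K).
Proof.
have dimK := dimK6 f_irr f_th K_th size_f.
apply: vp2_field_index => [be Obe|].
  have Ob5 i : OK b5`_i by do 5?[case: i => [|i] //]; rewrite /b5 /= ?nth_nil; int_tac.
  exact: (ind_lower_frob mon_f f_irr f_th K_th size_f (nil2_exp_sub Ob dimK ind_b frob4)
    isT Ob5 ind_b5 Obe).
have Oal : OK al by rewrite /al; int_tac.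
have Oeta : OK eta by rewrite /eta; int_tac.
exists al => //.
exact: (ind_upper1 mon_f f_irr f_th K_th size_f Oal Oeta Ou al4 eta2 ind_al).
Qed.

End OddCase.

(** * Case (i): five primes with residue field F_2 *)

Section EvenCase.

Hypothesis sigma_even : (2 %| a0 + g * b1)%Z.

Let dimK := dimK6 f_irr f_th K_th size_f.
(** Equal to (th^5 - th) / 8. *)
Let w1 : K := - a0%:~R * th - g%:~R * b1%:~R + g%:~R * ga.

(** All residue fields are F_2, so x^2 - x is nilpotent modulo 2; the nilpotent classes are those of
    0 and [eta]. *)
Let comb_sqr n : ev (comb n b ^+ 2 - comb n b) \/ ev (comb n b ^+ 2 - comb n b - eta).
Proof.
have [m def_m] := comb_frob b_sc erefl n 2; rewrite -def_m.
have H p pq p0 := @hom_frob2 _ _ _ free_b b_sc erefl p [::] pq p0 erefl n m erefl def_m.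
have := H _ (hom2_A a0 g c3 b1_odd) erefl.
have := H _ (hom2_A' a0 g b1 c3) erefl.
have := H _ (hom2_R a0 g b1 c3) erefl.
have := H _ (hom2_B c3 sigma_even) erefl.
have := H _ (hom2_C c3 sigma_even) erefl.
rewrite !dotpE /= => *; case: (@comb_eta m); try lia; first by case; left.
by right.
Qed.

Let sqr_eta x : OK x -> ev (x ^+ 2 - x) \/ ev (x ^+ 2 - x - eta).
Proof.
move=> Ox; have [n] := indep2_span dimK ind_b Ob Ox.
have On : OK (comb n b) by exact: OK_comb.
set y := comb n b in On *; set e := x - y => ev_e.
have def_x : x = y + e by rewrite /e; ring.
have ev_r : ev (2%:R * (y * e) + (e ^+ 2 - e)).
  apply: evD; first by apply/ev2/OKM => //; exact: ev_OK.
  by apply: evB => //; exact: evX.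
have def_y : x ^+ 2 - x = (y ^+ 2 - y) + (2%:R * (y * e) + (e ^+ 2 - e)) by rewrite def_x; ring.
case: (comb_sqr n) => ev_y; [left | right]; first by rewrite def_y; exact: evD.
by rewrite def_y addrAC; exact: evD.
Qed.

Let b4 := [:: 1; th; psi; ga].

(** Only the ramified prime has a nonzero residue of [ka]. The four other residue maps therefore
    descend to O_K / (2, ka), and they separate these four elements. *)
Let ind_b4 (n : nat -> int) : ideal2 ka (\sum_(i < 4) (n i)%:~R * b4`_i) ->
  forall i, (i < 4)%N -> (2 %| n i)%Z.
Proof.
have -> : \sum_(i < 4) (n i)%:~R * b4`_i =
    comb (fun i => [:: n 0%N; n 1%N; 0; 0; n 2%N; n 3%N]`_i) b.
  by rewrite combE !big_ord_recr big_ord0 /=; ring.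
set n' := (fun i => _); case=> x [v [Ox Ov def_n]].
have [m ev_m] := indep2_span dimK ind_b Ob Ov.
have nil_n : nil2 (comb n' b - b`_2 * comb m b).
  apply: ev_nil2; have -> : comb n' b - b`_2 * comb m b = 2%:R * x + ka * (v - comb m b).
    by rewrite def_n /=; ring.
  by apply: evD; [exact: ev2 | exact: evMl].
have H p pq p0 p2 :=
  @hom_nil2_ideal _ _ _ free_b b_sc erefl p [::] pq p0 erefl 2%N n' m isT p2 erefl nil_n.
have [+ _] := H _ (hom2_A a0 g c3 b1_odd) erefl erefl.
have [+ _] := H _ (hom2_A' a0 g b1 c3) erefl erefl.
have [+ _] := H _ (hom2_B c3 sigma_even) erefl erefl.
have [+ _] := H _ (hom2_C c3 sigma_even) erefl erefl.
rewrite !dotpE /n' /=; clear; move=> ? ? ? ?.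
by do 4?[case=> [|]] => // _; lia.
Qed.

(** With N = 2 O_K + ka O_K, the lower bound needs eta^2 = 2 u to lie in 2 N. As eta = ka (th - 1)
    and ka (th^2 + 1) = 4 w1, [u] is a multiple of [ka]. *)
Let u_ideal : u = ka * (2%:R * w1 - ka * th).
Proof.
apply: (mulfI (two_neq0 K)); rewrite -eta2 /eta /w1 /ka /rho.
by field: Rc R5 Rg; nz_tac.
Qed.

Let lower16 be : OK be -> (2 ^ 4 %| ind be)%N.
Proof.
move=> Obe; have Ow1 : OK w1 by rewrite /w1; int_tac.
have Ob4 i : OK b4`_i by do 4?[case: i => [|i] //]; rewrite /b4 /= ?nth_nil; int_tac.
have Oeta : OK eta by rewrite /eta; int_tac.
have def_eta : eta = ka * (th - 1) by rewrite /eta /ka /rho; ring.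
apply: (ind_lower_ideal2 mon_f f_irr f_th K_th size_f Obe Oka Ob Ob4 ind_b ind_b4).
  case: (sqr_eta Obe) => /evP[z Oz def_y].
    by exists z, 0; split; [| int_tac | rewrite def_y; ring].
  exists z, (th - 1); split; [by [] | by int_tac |].
  by rewrite -def_y -def_eta; ring.
case: (sqr_eta Obe) => /evP[z Oz def_y].
  exists (2%:R * z ^+ 2); last by rewrite def_y; ring.
  by exists (z ^+ 2), 0; split; [int_tac | int_tac | ring].
exists (2%:R * (eta * z + z ^+ 2) + u); last first.
  have -> : be ^+ 2 - be = eta + 2%:R * z by rewrite -def_y; ring.
  by rewrite mulrDr -eta2; ring.
by exists (eta * z + z ^+ 2), (2%:R * w1 - ka * th); split; [int_tac | int_tac | rewrite u_ideal].
Qed.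

(** Modulo 4, th is 0 at the two primes over the root 0, 1 at B and -1 at C; adding 2 ga moves the
    prime with ga = 1 to residue 2. Thus [al] takes each residue modulo 4 once on the four
    unramified primes. *)
Let al := th + 2%:R * ga.
Let be := (al ^+ 3 - al) / 2%:R.
(** The factors al - 2 and al + 1 vanish modulo 4 where al is 2 and -1. After the division by 2 only
    B keeps a nonzero residue, so that [de] is [psi] modulo 2. *)
Let de := (al - 2%:R) * (al + 1) * (be + al) / 2%:R.
Let w := - 12%:R * g%:~R * c3%:~R * th - 24%:R * g%:~R * c3%:~R * ga + ga ^+ 3.

Let Oal : OK al. Proof. by rewrite /al; int_tac. Qed.
Let Ow : OK w. Proof. by rewrite /w !mulNr; int_tac. Qed.

Let def_be : be = ka - ga + 2%:R * (2%:R * w).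
Proof. by rewrite /be /al /w /ka; field: Rc; nz_tac. Qed.

Let be_ev : ev (be - (ka + ga)).
Proof. by apply: (evE (y := 2%:R * w - ga)); [int_tac | rewrite def_be; ring]. Qed.

Let albe_ev : ev (al * be - rho).
Proof.
apply: (evE (y := al * (2%:R * w) + 8%:R * g%:~R * c3%:~R + ga * ka - ga ^+ 2)); first by int_tac.
by rewrite def_be /al /rho /ka /w; field: Rc; nz_tac.
Qed.

Let Obe : OK be. Proof. by rewrite def_be; int_tac. Qed.

Let de_ev : ev (de - psi).
Proof.
(* [v] is half of de - psi + (b1 + 1) ga, written with integral elements. *)
pose v := w1 - psi - 4%:R * g%:~R * c3%:~R * (th - 1) + c3%:~R * (th ^+ 4 + 8%:R * a0%:~R - 1)
  - 16%:R * g%:~R * c3%:~R * (ka + th + ga)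
  + (2%:R * ga - 1) * (- (4%:R * g%:~R * c3%:~R * (th ^+ 2 - 1)) - 8%:R * g%:~R * c3%:~R)
  + ga ^+ 3 + (al ^+ 2 - al - 2%:R) * w.
have Ov : OK v by rewrite /v /w1; int_tac.
have -> : de - psi = 2%:R * v - (b1 + 1)%:~R * ga.
  by rewrite rmorphD /= /de def_be /v /w1 /al /psi /ka /w; field: Rc R5 Rg; nz_tac.
apply: evB; first exact: ev2.
by apply: evMr => //; apply: ev_int; lia.
Qed.

Let Ode : OK de.
Proof. by rewrite -(subrK psi de); apply: OKD => //; apply: ev_OK. Qed.

Let ind_al : indep2 [:: 1; al; al ^+ 2; be; al * be; de].
Proof.
apply: (indep2_change (M := [:: [:: 1]; [:: 0; 1]; [:: 0; 1; 1; 1];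
  [:: 0; 0; 1; 0; 0; 1]; [:: 0; 0; 0; 1]; [:: 0; 0; 0; 0; 1]]) ind_b); last by move=> n H; parity6 H.
apply: lt6_ind; rewrite combE /=.
- by apply: (evE (OK0 K)); ring.
- by apply: (evE Oga); rewrite /al; ring.
- apply: (evE (y := psi - th - ka - rho + 2%:R * th * ga + 2%:R * ga ^+ 2)); first by int_tac.
  by rewrite /al /psi /ka /rho; field; nz_tac.
- by congr ev: be_ev; ring.
- by congr ev: albe_ev; ring.
- by congr ev: de_ev; ring.
Qed.

Lemma field_index2_even : vp 2 (field_index K) = 4%N /\ ((0 < 4)%N -> ~ monogenic K).
Proof.
apply: vp2_field_index => [x Ox|]; first exact: lower16.
exists al => //.
have two_be : 2%:R * be = al ^+ 3 - al by rewrite /be; field; nz_tac.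
have gA := Zadjoin_subgrp al; have gA1 := adjZ_subgrp be gA.
have gA2 := adjZ_subgrp (al * be) gA1; have gA3 := adjZ_subgrp (al ^+ 2 * be) gA2.
(* The powers al^3, al^4, al^5 are corrected and halved into be, al be, al^2 be; one further halving
   gives [de]. This makes four steps. *)
apply: (@ind_upper _ _ _ mon_f f_irr f_th K_th size_f al
  [:: be; al * be; al ^+ 2 * be; de] _ Oal _ _ ind_al).
- by move=> x; rewrite !inE => /or4P[] /eqP->; int_tac.
- split; first by rewrite two_be; zadj_tac.
  split; first by apply: sub_adjZ; rewrite mulrCA two_be; zadj_tac.
  split; first by do 2!apply: sub_adjZ; rewrite mulrCA two_be; zadj_tac.
  split=> //; have -> : 2%:R * de = (al ^+ 2 - al - 2%:R) * al - 2%:R * be - al * be + al ^+ 2 * be.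
    by rewrite /de; field; nz_tac.
  apply: subgrpD => //; last exact: mem_adjZ.
  apply: sub_adjZ; apply: (gA2.2); last exact: mem_adjZ.
  by do 2!apply: sub_adjZ; rewrite two_be; zadj_tac.
apply: lt6_ind.
- by do 4!apply: sub_adjZ; zadj_tac.
- by do 4!apply: sub_adjZ; zadj_tac.
- by do 4!apply: sub_adjZ; zadj_tac.
- by do 3!apply: sub_adjZ; apply: mem_adjZ.
- by do 2!apply: sub_adjZ; apply: mem_adjZ.
by apply: mem_adjZ.
Qed.

End EvenCase.

End Degree2.

(** * The case m = 3 *)

(** Structure constants on 1, th, th^2, th^3, et, ga, in the layout of [table2]. Here 2^v_2(b) = 2
    Q^2, which is where v_2(b) odd enters. *)
Definition table3 (a Q b1 c2 : int) : seq (seq (seq int)) :=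
[:: [:: [:: 1; 0; 0; 0; 0; 0];
  [:: 0; 1; 0; 0; 0; 0];
  [:: 0; 0; 1; 0; 0; 0];
  [:: 0; 0; 0; 1; 0; 0];
  [:: 0; 0; 0; 0; 1; 0];
  [:: 0; 0; 0; 0; 0; 1]];
 [:: [::];
  [:: 0; 0; 1; 0; 0; 0];
  [:: 0; 0; 0; 1; 0; 0];
  [:: 0; - a; 0; 0; Q; 0];
  [:: - 2 * Q * b1; 0; 0; 0; 0; 2 * Q];
  [:: - 2 * Q * c2; 0; 0; 0; 0; 0]];
 [:: [::];
  [::];
  [:: 0; - a; 0; 0; Q; 0];
  [:: - 2 * Q ^+ 2 * b1; 0; - a; 0; 0; 2 * Q ^+ 2];
  [:: - 4 * Q ^+ 2 * c2; - 2 * Q * b1; 0; 0; 0; 0];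
  [:: 0; - 2 * Q * c2; 0; 0; 0; 0]];
 [:: [::];
  [::];
  [::];
  [:: - 4 * Q ^+ 3 * c2; - 2 * Q ^+ 2 * b1; 0; - a; 0; 0];
  [:: 0; - 4 * Q ^+ 2 * c2; - 2 * Q * b1; 0; 0; 0];
  [:: 0; 0; - 2 * Q * c2; 0; 0; 0]];
 [:: [::];
  [::];
  [::];
  [::];
  [:: - 2 * a * b1; 0; - 4 * Q * c2; - 2 * b1; 0; 2 * a];
  [:: - 2 * a * c2; 0; 0; - 2 * c2; 0; 0]];
 [:: [::];
  [::];
  [::];
  [::];
  [::];
  [:: 0; 0; 0; 0; - c2; b1]]].

(** Modulo 2, f = X^3 (X + 1) (X^2 + X + 1). Over the root 0 lie this prime, with ga = 1, and one
    with e = 2 and ga = 0 ([hom3_R]); [hom3_D] and [hom3_F4] belong to the other two factors. *)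
Lemma hom3_A a Q b1 c2 : ~~ (2 %| a)%Z -> ~~ (2 %| b1)%Z ->
  hom4 (table3 a Q b1 c2) [:: 1; 0; 0; 0; 0; 1] [::].
Proof. by move=> ? ?; apply: le_lt6_ind; [apply: lt6_ind|..]; rewrite !dotpE /=; lia. Qed.

Lemma hom3_R a Q b1 c2 : hom4 (table3 a Q b1 c2) [:: 1; 0; 0; 0; 0; 0] [::].
Proof. by apply: le_lt6_ind; [apply: lt6_ind|..]; rewrite !dotpE /=; lia. Qed.

Lemma hom3_D a Q b1 c2 : ~~ (2 %| a)%Z ->
  hom4 (table3 a Q b1 c2) [:: 1; 1; 1; 1; 0; 0] [::].
Proof. by move=> ?; apply: le_lt6_ind; [apply: lt6_ind|..]; rewrite !dotpE /=; lia. Qed.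

Lemma hom3_F4 a Q b1 c2 : ~~ (2 %| a)%Z ->
  hom4 (table3 a Q b1 c2) [:: 1; 0; 1; 1; 0; 0] [:: 0; 1; 1; 0; 0; 0].
Proof. by move=> ?; apply: le_lt6_ind; [apply: lt6_ind|..]; rewrite !dotpE /=; lia. Qed.

Section Degree3.

Variables (K : fieldExtType rat) (th : K) (f : {poly int}).
Hypotheses (mon_f : f \is monic) (f_irr : irreducible_poly (map_poly intr f : {poly rat})).
Hypotheses (f_th : root (map_poly intr f) th) (K_th : primitive_elt th).
Hypothesis size_f : size f = 7%N.

Local Notation OK := (@ring_of_integers K).

(* Here f = X^6 + a X^3 + b X + c with b = 2 Q^2 b1 and c = 4 Q^3 c2, where Q
   is a power of 2. *)
Variables (a Q b1 c2 : int).
Hypotheses (Q_neq0 : Q != 0) (Q_even : (2 %| Q)%Z).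
Hypotheses (a_odd : ~~ (2 %| a)%Z) (b1_odd : ~~ (2 %| b1)%Z).
Hypothesis f_eq : th ^+ 6 = - (a%:~R * th ^+ 3 + 2%:R * Q%:~R ^+ 2 * b1%:~R * th
  + 4%:R * Q%:~R ^+ 3 * c2%:~R).

Let nzQ : Q%:~R != 0 :> K. Proof. by rewrite intr_K_eq0. Qed.

(** At the ramified prime theta has valuation v_2(b)/2, and Q = 2^((v_2(b) - 1)/2), so that [et] has
    valuation 1/2: it is a uniformizer. *)
Let et := (th ^+ 4 + a%:~R * th) / Q%:~R.
Let ga := (th ^+ 5 + a%:~R * th ^+ 2 + 2%:R * Q%:~R ^+ 2 * b1%:~R) / (2%:R * Q%:~R ^+ 2).
Let b := [:: 1; th; th ^+ 2; th ^+ 3; et; ga].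

Let R4 : th ^+ 4 = Q%:~R * et - a%:~R * th.
Proof. by rewrite /et; field; nz_tac. Qed.

Let Rte : th * et = 2%:R * Q%:~R * (ga - b1%:~R).
Proof. by rewrite /et /ga; field; nz_tac. Qed.

Let Rtg : th * ga = - (2%:R * Q%:~R * c2%:~R).
Proof. by rewrite /ga; field: f_eq; nz_tac. Qed.

Let Rt2e : th ^+ 2 * et = - (2%:R * Q%:~R * (2%:R * Q%:~R * c2%:~R + b1%:~R * th)).
Proof.
have -> : th ^+ 2 * et = th * (th * et) by ring.
by rewrite Rte; ring: Rtg.
Qed.

Let Ree : et ^+ 2 = 2%:R * (- (2%:R * Q%:~R * c2%:~R) * th ^+ 2 - b1%:~R * th ^+ 3
  + a%:~R * ga - a%:~R * b1%:~R).
Proof.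
have -> : et ^+ 2 = (th ^+ 3 + a%:~R) / Q%:~R * (th * et) by rewrite /et; field; nz_tac.
by rewrite Rte; field: Rtg; nz_tac.
Qed.

Let Reg : et * ga = - (2%:R * c2%:~R * (th ^+ 3 + a%:~R)).
Proof.
have -> : et * ga = (th ^+ 3 + a%:~R) / Q%:~R * (th * ga) by rewrite /et; field; nz_tac.
by rewrite Rtg; field; nz_tac.
Qed.

Let Rgg : ga ^+ 2 = b1%:~R * ga - c2%:~R * et.
Proof.
have -> : ga ^+ 2 = (th * (th ^+ 3 + a%:~R) / (2%:R * Q%:~R ^+ 2)) * (th * ga) + b1%:~R * ga.
  by rewrite /ga; field; nz_tac.
by rewrite Rtg /et; field; nz_tac.
Qed.

Let Oth : OK th. Proof. exact: OK_theta mon_f f_th. Qed.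

Let Oga : OK ga.
Proof.
apply: (@OK_trinomial _ 2 _ b1%:~R (2%:R * c2%:~R ^+ 2 * (th ^+ 3 + a%:~R))).
- by int_tac.
- by int_tac.
have -> : ga ^+ 3 = ga * ga ^+ 2 by ring.
by rewrite Rgg; ring: Reg Rgg.
Qed.

Let Oet : OK et.
Proof. by apply: (@OK_expI _ _ 2) => //; rewrite Ree mulNr; int_tac. Qed.

Let Ob i : OK b`_i.
Proof. by do 6?[case: i => [|i] //]; rewrite /b /= ?nth_nil; int_tac. Qed.

Let free_b : Zfree b.
Proof.
move=> n; rewrite combE /=.
set n0 := n 0%N; set n1 := n 1%N; set n2 := n 2%N; set n3 := n 3%N; set n4 := n 4%N; set n5 := n 5%N.
move=> comb0.
pose c := [:: 2 * Q ^+ 2 * n0 + 2 * Q ^+ 2 * b1 * n5; 2 * Q ^+ 2 * n1 + 2 * Q * a * n4;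
  2 * Q ^+ 2 * n2 + a * n5; 2 * Q ^+ 2 * n3; 2 * Q * n4; n5].
have /(theta_Zfree6 f_irr f_th size_f (c := c) erefl) : \sum_(i < 6) (c`_i)%:~R * th ^+ i = 0 :> K.
  transitivity (2%:R * Q%:~R ^+ 2 * (n0%:~R * 1 + n1%:~R * th + n2%:~R * th ^+ 2
    + n3%:~R * th ^+ 3 + n4%:~R * et + n5%:~R * ga)); last by rewrite comb0 mulr0.
  by rewrite !big_ord_recr big_ord0 /= /et /ga; field; nz_tac.
move=> [e0 e1 e2 e3 e4 e5].
have Q_reg x : Q * x = 0 -> x = 0 by move/eqP; rewrite mulf_eq0 (negPf Q_neq0) => /eqP.
have n4_0 : n4 = 0 by have := Q_reg (2 * n4); clear -e4; lia.
have n5_0 : n5 = 0 by [].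
rewrite n5_0 n4_0 ?mulr0 ?addr0 in e0 e1 e2.
have Q2_reg x : 2 * Q ^+ 2 * x = 0 -> x = 0.
  by move=> Q0; apply/Q_reg/Q_reg; move: Q0; clear; lia.
by apply: lt6_ind => //; apply: Q2_reg.
Qed.

Let b_sc : struct_const b (table3 a Q b1 c2).
Proof.
apply: le_lt6_ind; [apply: lt6_ind|..]; rewrite combE /=;
  first [ring: R4 Rte Ree Reg Rgg Rtg | ring: Rte Rtg | ring: Rtg | ring: Rt2e Rtg | ring: Reg].
Qed.

(** Coordinates on [b] of et^2 / 2; the value at the ramified prime is -a b1, which is odd. *)
Let nu : seq int := [:: - a * b1; 0; - 2 * Q * c2; - b1; 0; a].
Let u := comb (fun i => nu`_i) b.

Let et2 : et ^+ 2 = 2%:R * u.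
Proof. by rewrite /u combE /= Ree; ring. Qed.

Let Ou : OK u. Proof. exact: OK_comb. Qed.

Let et_nil : nil2 et.
Proof. by apply/nil2_sqr/ev_nil2; rewrite et2; exact: ev2. Qed.

Let et_odd : ~ ev et.
Proof.
case/evP=> x Ox def_et.
have def_u : u = 2%:R * x ^+ 2.
  by apply: (mulfI (two_neq0 K)); rewrite -et2 def_et; ring.
have nil_u : nil2 (comb (fun i => nu`_i) b) by apply/ev_nil2/(evE _ def_u)/OKX.
have [+ _] := hom_nil2 free_b b_sc erefl (@hom3_R _ _ _ _) erefl erefl nil_u.
rewrite dotpE /= !mulr0 !addr0 mulr1 mulNr dvdzE abszN abszM Euclid_dvdM // -!dvdzE.
by rewrite (negPf a_odd) (negPf b1_odd).
Qed.

Let nil_parity n : nil2 (comb n b) ->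
  [/\ (2 %| n 0%N)%Z, (2 %| n 1%N)%Z, (2 %| n 2%N)%Z, (2 %| n 3%N)%Z & (2 %| n 5%N)%Z].
Proof.
move=> nil_n; have H p q pq p0 q0 := @hom_nil2 _ _ _ free_b b_sc erefl p q pq p0 q0 n nil_n.
have [+ _] := H _ _ (hom3_A Q c2 a_odd b1_odd) erefl erefl.
have [+ _] := H _ _ (hom3_R a Q b1 c2) erefl erefl.
have [+ _] := H _ _ (hom3_D Q b1 c2 a_odd) erefl erefl.
have [] := H _ _ (hom3_F4 Q b1 c2 a_odd) erefl erefl; rewrite !dotpE /=; clear.
by move: (n 0%N) (n 1%N) (n 2%N) (n 3%N) (n 4%N) (n 5%N) => *; split; lia.
Qed.

Let comb_et n : (2 %| n 0%N)%Z -> (2 %| n 1%N)%Z -> (2 %| n 2%N)%Z -> (2 %| n 3%N)%Z ->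
  (2 %| n 5%N)%Z -> ev (comb n b) /\ (2 %| n 4%N)%Z \/ ev (comb n b - et).
Proof.
move=> n0 n1 n2 n3 n5; have [n4|n4] := boolP (2 %| n 4%N)%Z.
  by left; split=> //; apply: ev_comb => //; apply: lt6_ind.
right; have -> : comb n b - et = comb (fun i => n i + [:: 0; 0; 0; 0; 1]`_i) b - 2%:R * et.
  by rewrite !combE /= !rmorphD /=; ring.
apply: evB; last exact: ev2.
by apply: ev_comb => //; apply: lt6_ind => /=; rewrite ?addr0 //; lia.
Qed.

Let ind_b : indep2 b.
Proof.
move=> n ev_n; have [n0 n1 n2 n3 n5] := nil_parity (ev_nil2 ev_n).
have [[_ n4]|ev_n_et] := comb_et n0 n1 n2 n3 n5; first exact: lt6_ind.
by case: et_odd; rewrite -(subKr (comb n b) et); apply: evB.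
Qed.

Let nil_of_parity n : (2 %| n 0%N)%Z -> (2 %| n 1%N)%Z -> (2 %| n 2%N)%Z -> (2 %| n 3%N)%Z ->
  (2 %| n 5%N)%Z -> nil2 (comb n b).
Proof.
move=> n0 n1 n2 n3 /(comb_et n0 n1 n2 n3)[[/ev_nil2 //]|/ev_nil2 nil_n].
by rewrite -[comb n b](subrK et); apply: nil2D.
Qed.

Let frob4 n : nil2 (comb n b ^+ (2 ^ 2) - comb n b).
Proof.
have [m def_m] := comb_frob b_sc erefl n 4; rewrite -def_m.
have H p q pq p0 q0 := @hom_frob4 _ _ _ free_b b_sc erefl p q pq p0 q0 n m def_m.
have [+ _] := H _ _ (hom3_A Q c2 a_odd b1_odd) erefl erefl.
have [+ _] := H _ _ (hom3_R a Q b1 c2) erefl erefl.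
have [+ _] := H _ _ (hom3_D Q b1 c2 a_odd) erefl erefl.
have [] := H _ _ (hom3_F4 Q b1 c2 a_odd) erefl erefl.
rewrite !dotpE /= => *; apply: nil_of_parity; lia.
Qed.

Let b5 := [:: 1; th; th ^+ 2; th ^+ 3; ga].

Let ind_b5 (n : nat -> int) : nil2 (\sum_(i < 5) (n i)%:~R * b5`_i) ->
  forall i, (i < 5)%N -> (2 %| n i)%Z.
Proof.
have -> : \sum_(i < 5) (n i)%:~R * b5`_i =
    comb (fun i => [:: n 0%N; n 1%N; n 2%N; n 3%N; 0; n 4%N]`_i) b.
  by rewrite combE !big_ord_recr big_ord0 /=; ring.
by move/nil_parity => /= [h0 h1 h2 h3 h5]; do 5?[case=> [|]] => // _.
Qed.

(** theta has valuation at least 3/2 at the ramified prime. Adding [et] keeps all residues and makes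
    [al] a uniformizer there. *)
Let al := th + et.

Let al2 : ev (al ^+ 2 - th ^+ 2).
Proof.
apply: (evE (y := th * et + u)); first by int_tac.
by rewrite mulrDr -et2 /al; ring.
Qed.

Let al3 : ev (al ^+ 3 - th ^+ 3).
Proof.
have -> : al ^+ 3 - th ^+ 3 = al * (al ^+ 2 - th ^+ 2) + (th * et) * th by rewrite /al; ring.
apply: evD; first by apply: evMl => //; rewrite /al; int_tac.
by rewrite Rte -!mulrA; apply: ev2; int_tac.
Qed.

Let al4 : ev (al ^+ 4 - al - et).
Proof.
have -> : al ^+ 4 - al - et = al * (al ^+ 3 - th ^+ 3) + (th ^+ 4 - th + (th * et) * th ^+ 2 - 2%:R * et).
  by rewrite /al; ring.
apply: evD; first by apply: evMl => //; rewrite /al; int_tac.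
apply: evB; last exact: ev2.
apply: evD; last by rewrite Rte -!mulrA; apply: ev2; int_tac.
have -> : th ^+ 4 - th = Q%:~R * et - (a + 1)%:~R * th by rewrite R4 rmorphD /=; ring.
by apply: evB; apply: evMr => //; apply: ev_int => //; lia.
Qed.

Let ind_al : indep2 [:: 1; al; al ^+ 2; al ^+ 3; et; u].
Proof.
(* The last row says u = 1 + th^3 + ga modulo 2, as [a] and [b1] are odd. *)
apply: (indep2_change (M := [:: [:: 1]; [:: 0; 1; 0; 0; 1]; [:: 0; 0; 1]; [:: 0; 0; 0; 1];
  [:: 0; 0; 0; 0; 1]; [:: 1; 0; 0; 1; 0; 1]]) ind_b); last by move=> n H; parity6 H.
apply: lt6_ind; rewrite combE /=.
- by apply: (evE (OK0 K)); ring.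
- by apply: (evE (OK0 K)); rewrite /al; ring.
- by congr ev: al2; ring.
- by congr ev: al3; ring.
- by apply: (evE (OK0 K)); ring.
have -> : u - (1%:~R * 1 + 0%:~R * th + 0%:~R * th ^+ 2 + 1%:~R * th ^+ 3 + 0%:~R * et + 1%:~R * ga) =
  comb (fun i => nu`_i - [:: 1; 0; 0; 1; 0; 1]`_i) b by rewrite /u !combE /=; ring.
apply: ev_comb => //.
have ab_odd : ~~ (2 %| a * b1)%Z.
  by rewrite dvdzE abszM Euclid_dvdM // -!dvdzE (negPf a_odd).
by apply: lt6_ind => /=; lia.
Qed.

Lemma field_index3 : vp 2 (field_index K) = 1%N /\ ((0 < 1)%N -> ~ monogenic K).
Proof.
have dimK := dimK6 f_irr f_th K_th size_f.
apply: vp2_field_index => [be Obe|].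
  have Ob5 i : OK b5`_i by do 5?[case: i => [|i] //]; rewrite /b5 /= ?nth_nil; int_tac.
  exact: (ind_lower_frob mon_f f_irr f_th K_th size_f (nil2_exp_sub Ob dimK ind_b frob4)
    isT Ob5 ind_b5 Obe).
have Oal : OK al by rewrite /al; int_tac.
exists al => //.
exact: (ind_upper1 mon_f f_irr f_th K_th size_f Oal Oet Ou al4 et2 ind_al).
Qed.

End Degree3.

(** * The case m = 4 *)

(** Structure constants on 1, th, ze, et, e2, ga. The pair s, t with s t = 2 covers the two classes
    of v_2(b) modulo 3: s = 1 for class 1 and s = 2 for class 2. *)
Definition table4 (a0 R s t b1 c2 : int) : seq (seq (seq int)) :=
[:: [:: [:: 1; 0; 0; 0; 0; 0];
  [:: 0; 1; 0; 0; 0; 0];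
  [:: 0; 0; 1; 0; 0; 0];
  [:: 0; 0; 0; 1; 0; 0];
  [:: 0; 0; 0; 0; 1; 0];
  [:: 0; 0; 0; 0; 0; 1]];
 [:: [::];
  [:: 0; - 1; 2; 0; 0; 0];
  [:: 0; - 4 * a0; 1; R; 0; 0];
  [:: 0; 0; 0; 0; 2 * R * s; 0];
  [:: - 4 * R * b1; 0; 0; 0; 0; 4 * R];
  [:: - 4 * R * c2; 0; 0; 0; 0; 0]];
 [:: [::];
  [::];
  [:: 0; - 2 * a0; 1 - 4 * a0; R; R ^+ 2 * s; 0];
  [:: - 4 * R ^+ 2 * b1 * s; 0; 0; 0; R * s; 4 * R ^+ 2 * s];
  [:: - 2 * R * b1 - 8 * R ^+ 2 * c2; - 2 * R * b1; 0; 0; 0; 2 * R];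
  [:: - 2 * R * c2; - 2 * R * c2; 0; 0; 0; 0]];
 [:: [::];
  [::];
  [::];
  [:: - 16 * R ^+ 2 * c2 * s; - 4 * R * b1 * s; 0; 0; - s + 8 * a0 * s; 0];
  [:: 2 * b1 - 16 * a0 * b1; 2 * b1 - 8 * R * c2; - 4 * b1; 0; 0; - 2 + 16 * a0];
  [:: 2 * c2 - 16 * a0 * c2; 2 * c2; - 4 * c2; 0; 0; 0]];
 [:: [::];
  [::];
  [::];
  [::];
  [:: 2 * c2 * t - 16 * a0 * c2 * t; 2 * c2 * t; - 4 * c2 * t; - b1 * t; 0; 0];
  [:: 0; 0; 0; - c2 * t; 0; 0]];
 [:: [::];
  [::];
  [::];
  [::];
  [::];
  [:: 0; 0; 0; 0; - c2; b1]]].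

(** Modulo 2, f = X^4 (X + 1)^2. Over the root 0 lie this prime, with ga = 1, and one with e = 3
    ([hom4_R]). Over the root 1 the residue of [ze] is idempotent and separates [hom4_B] from
    [hom4_C]. *)
Lemma hom4_A a0 R s t b1 c2 : ~~ (2 %| b1)%Z ->
  hom4 (table4 a0 R s t b1 c2) [:: 1; 0; 0; 0; 0; 1] [::].
Proof. by move=> ?; apply: le_lt6_ind; [apply: lt6_ind|..]; rewrite !dotpE /=; lia. Qed.

Lemma hom4_B a0 R s t b1 c2 : hom4 (table4 a0 R s t b1 c2) [:: 1; 1; 1; 0; 0; 0] [::].
Proof. by apply: le_lt6_ind; [apply: lt6_ind|..]; rewrite !dotpE /=; lia. Qed.

Lemma hom4_C a0 R s t b1 c2 : hom4 (table4 a0 R s t b1 c2) [:: 1; 1; 0; 0; 0; 0] [::].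
Proof. by apply: le_lt6_ind; [apply: lt6_ind|..]; rewrite !dotpE /=; lia. Qed.

Lemma hom4_R a0 R s t b1 c2 : hom4 (table4 a0 R s t b1 c2) [:: 1; 0; 0; 0; 0; 0] [::].
Proof. by apply: le_lt6_ind; [apply: lt6_ind|..]; rewrite !dotpE /=; lia. Qed.

Section Degree4.

Variables (K : fieldExtType rat) (th : K) (f : {poly int}).
Hypotheses (mon_f : f \is monic) (f_irr : irreducible_poly (map_poly intr f : {poly rat})).
Hypotheses (f_th : root (map_poly intr f) th) (K_th : primitive_elt th).
Hypothesis size_f : size f = 7%N.

Local Notation OK := (@ring_of_integers K).

(* Here f = X^6 + a X^4 + b X + c with a = 8 a0 - 1, b = 2 s Q^3 b1 and
   c = 4 s Q^4 c2, where Q = 2 R is a power of 2. *)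
Variables (a0 R s t b1 c2 : int).
Hypotheses (R_neq0 : R != 0) (st : s = 1 /\ t = 2 \/ s = 2 /\ t = 1) (b1_odd : ~~ (2 %| b1)%Z).
Hypothesis f_eq : th ^+ 6 = - ((8%:R * a0%:~R - 1) * th ^+ 4
  + 16%:R * s%:~R * R%:~R ^+ 3 * b1%:~R * th + 64%:R * s%:~R * R%:~R ^+ 4 * c2%:~R).

Let nzR : R%:~R != 0 :> K. Proof. by rewrite intr_K_eq0. Qed.
Let s_neq0 : s != 0. Proof. by case: st => [[-> _]|[-> _]]. Qed.
Let nzs : s%:~R != 0 :> K. Proof. by rewrite intr_K_eq0. Qed.
Let def_t : t%:~R = 2%:R / s%:~R :> K.
Proof. by case: st => [[-> ->]|[-> ->]]; [rewrite divr1 | rewrite (divff (two_neq0 K))]. Qed.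

Let E := th ^+ 2 + 8%:R * a0%:~R - 1.
Let ze := (th ^+ 2 + th) / 2%:R.
(** At the prime with e = 3 theta has valuation v_2(b)/3, so [et] and [e2] have valuations 1/3 and
    2/3 if s = 1, and 2/3 and 1/3 if s = 2. *)
Let et := th * E / (2%:R * R%:~R).
Let e2 := th ^+ 2 * E / (4%:R * s%:~R * R%:~R ^+ 2).
Let ga := th ^+ 3 * E / (16%:R * s%:~R * R%:~R ^+ 3) + b1%:~R.
Let b := [:: 1; th; ze; et; e2; ga].

Let def_E : E = 2%:R * ze - th + 8%:R * a0%:~R - 1.
Proof. by rewrite /E /ze; field; nz_tac. Qed.

Let Rtt : th ^+ 2 = 2%:R * ze - th.
Proof. by rewrite /ze; field; nz_tac. Qed.

Let Rte : th * et = 2%:R * R%:~R * s%:~R * e2.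
Proof. by rewrite /et /e2; field; nz_tac. Qed.

Let Rte2 : th * e2 = 4%:R * R%:~R * (ga - b1%:~R).
Proof. by rewrite /ga /e2; field; nz_tac. Qed.

Let Rtg : th * ga = - (4%:R * R%:~R * c2%:~R).
Proof. by rewrite /ga /E; field: f_eq; nz_tac. Qed.

Let Rtz : th * ze = R%:~R * et + ze - 4%:R * a0%:~R * th.
Proof. by rewrite /ze /et /E; field; nz_tac. Qed.

Let Rzz : ze ^+ 2 = (1 - 4%:R * a0%:~R) * ze - 2%:R * a0%:~R * th
  + R%:~R * et + R%:~R ^+ 2 * s%:~R * e2.
Proof. by rewrite /ze /et /e2 /E; field; nz_tac. Qed.

Let Rze : ze * et = R%:~R * s%:~R * (e2 + 4%:R * R%:~R * (ga - b1%:~R)).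
Proof.
have -> : ze * et = (th + 1) / 2%:R * (th * et) by rewrite /ze; field; nz_tac.
by rewrite Rte -Rte2; field; nz_tac.
Qed.

Let Rze2 : ze * e2 = 2%:R * R%:~R * (ga - b1%:~R - 4%:R * R%:~R * c2%:~R - b1%:~R * th).
Proof.
have -> : ze * e2 = (th + 1) / 2%:R * (th * e2) by rewrite /ze; field; nz_tac.
by rewrite Rte2; field: Rtg; nz_tac.
Qed.

Let Rzg : ze * ga = - (2%:R * R%:~R * c2%:~R * (th + 1)).
Proof.
have -> : ze * ga = (th + 1) / 2%:R * (th * ga) by rewrite /ze; field; nz_tac.
by rewrite Rtg; field; nz_tac.
Qed.

Let Ree : et ^+ 2 = s%:~R * (e2 * E).
Proof. by rewrite /et /e2; field; nz_tac. Qed.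

Let Re2E : e2 * E = (8%:R * a0%:~R - 1) * e2
  - 4%:R * R%:~R * (4%:R * R%:~R * c2%:~R + b1%:~R * th).
Proof.
have -> : e2 * E = (8%:R * a0%:~R - 1) * e2 + th * (th * e2) by rewrite /E; ring.
by rewrite Rte2; ring: Rtg.
Qed.

Let Ree2 : et * e2 = 2%:R * ((ga - b1%:~R) * E).
Proof. by rewrite /et /e2 /ga; field; nz_tac. Qed.

Let Rge : ga * et = - (2%:R * c2%:~R * E).
Proof.
have -> : ga * et = th * ga * E / (2%:R * R%:~R) by rewrite /et; field; nz_tac.
by rewrite Rtg; field; nz_tac.
Qed.

Let RgE : (ga - b1%:~R) * E = (8%:R * a0%:~R - 1) * ga - 4%:R * R%:~R * c2%:~R * th - b1%:~R * E.
Proof.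
rewrite mulrBl def_E; have -> : ga * (2%:R * ze - th + 8%:R * a0%:~R - 1) =
  2%:R * (ze * ga) - th * ga + (8%:R * a0%:~R - 1) * ga by ring.
by rewrite Rzg Rtg; ring.
Qed.

Let Re2e2 : e2 ^+ 2 = t%:~R * ((ga - b1%:~R) * et).
Proof. by rewrite def_t /et /e2 /ga; field; nz_tac. Qed.

Let Rge2 : ga * e2 = - (t%:~R * c2%:~R * et).
Proof.
have -> : ga * e2 = th * ga * (th * E) / (4%:R * s%:~R * R%:~R ^+ 2) by rewrite /e2; field; nz_tac.
by rewrite Rtg def_t /et; field; nz_tac.
Qed.

Let Rgg : ga ^+ 2 = b1%:~R * ga - c2%:~R * e2.
Proof.
have -> : ga ^+ 2 = b1%:~R * ga + th * ga * (th ^+ 2 * E) / (16%:R * s%:~R * R%:~R ^+ 3).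
  by rewrite /ga; field; nz_tac.
by rewrite Rtg /e2; field; nz_tac.
Qed.

Let Oth : OK th. Proof. exact: OK_theta mon_f f_th. Qed.

Let OE : OK E. Proof. by rewrite /E; int_tac. Qed.

Let Oga : OK ga.
Proof.
apply: (@OK_trinomial _ 3 _ b1%:~R (- (2%:R * t%:~R * c2%:~R ^+ 3 * E))).
- by int_tac.
- by int_tac.
have -> : ga ^+ 4 = ga ^+ 2 * ga ^+ 2 by ring.
rewrite {1}Rgg.
have -> : (b1%:~R * ga - c2%:~R * e2) * ga ^+ 2 =
  b1%:~R * ga ^+ 3 - c2%:~R * (ga * (ga * e2)) by ring.
rewrite Rge2; have -> : ga * - (t%:~R * c2%:~R * et) = - (t%:~R * c2%:~R * (ga * et)) by ring.
by rewrite Rge; ring.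
Qed.

Let Ogb : OK (ga - b1%:~R). Proof. by int_tac. Qed.

Let et3 : et ^+ 3 = 2%:R * (s%:~R * ((ga - b1%:~R) * E ^+ 2)).
Proof.
have -> : et ^+ 3 = et * et ^+ 2 by ring.
by rewrite Ree mulrCA [et * _]mulrA Ree2; ring.
Qed.

Let e23 : e2 ^+ 3 = 2%:R * (t%:~R * ((ga - b1%:~R) ^+ 2 * E)).
Proof.
have -> : e2 ^+ 3 = e2 * e2 ^+ 2 by ring.
by rewrite Re2e2 mulrCA [e2 * _]mulrC -mulrA Ree2; ring.
Qed.

Let Oet : OK et.
Proof. by apply: (@OK_expI _ _ 3) => //; rewrite et3; int_tac. Qed.

Let Oe2 : OK e2.
Proof. by apply: (@OK_expI _ _ 3) => //; rewrite e23; int_tac. Qed.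

Let Oze : OK ze.
Proof.
apply: (@OK_trinomial _ 1 _ (1 - 4%:R * a0%:~R)
  (R%:~R ^+ 2 * s%:~R * e2 + R%:~R * et - 2%:R * a0%:~R * th)).
- by int_tac.
- by int_tac.
by rewrite Rzz; ring.
Qed.

Let Ob i : OK b`_i.
Proof. by do 6?[case: i => [|i] //]; rewrite /b /= ?nth_nil; int_tac. Qed.

Let free_b : Zfree b.
Proof.
move=> n; rewrite combE /=.
set n0 := n 0%N; set n1 := n 1%N; set n2 := n 2%N; set n3 := n 3%N; set n4 := n 4%N; set n5 := n 5%N.
move=> comb0; pose a := 8 * a0 - 1.
pose c := [:: 16 * s * R ^+ 3 * (n0 + b1 * n5);
  8 * s * R ^+ 3 * (2 * n1 + n2) + 8 * s * R ^+ 2 * a * n3;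
  8 * s * R ^+ 3 * n2 + 4 * R * a * n4; 8 * s * R ^+ 2 * n3 + a * n5; 4 * R * n4; n5].
have /(theta_Zfree6 f_irr f_th size_f (c := c) erefl) : \sum_(i < 6) (c`_i)%:~R * th ^+ i = 0 :> K.
  transitivity (16%:R * s%:~R * R%:~R ^+ 3 * (n0%:~R * 1 + n1%:~R * th + n2%:~R * ze
    + n3%:~R * et + n4%:~R * e2 + n5%:~R * ga)); last by rewrite comb0 mulr0.
  by rewrite !big_ord_recr big_ord0 /= /a /et /e2 /ze /ga /E; field; nz_tac.
move=> [c0 c1 c2' c3 c4 n5_0].
have regM (k x : int) : k * x = 0 -> k != 0 -> x = 0.
  by move=> /eqP; rewrite mulf_eq0 => /orP[/eqP->|/eqP //]; rewrite eqxx.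
have n4_0 : n4 = 0 by apply: (regM (4 * R)) => //; rewrite mulf_neq0.
rewrite n5_0 n4_0 ?mulr0 ?addr0 in c0 c2' c3.
have n0_0 : n0 = 0 by apply: (regM (16 * s * R ^+ 3)) => //; rewrite !mulf_neq0 ?expf_neq0.
have n2_0 : n2 = 0 by apply: (regM (8 * s * R ^+ 3)) => //; rewrite !mulf_neq0 ?expf_neq0.
have n3_0 : n3 = 0 by apply: (regM (8 * s * R ^+ 2)) => //; rewrite !mulf_neq0 ?expf_neq0.
rewrite n2_0 n3_0 ?mulr0 ?addr0 mulrA in c1.
have n1_0 : n1 = 0 by apply: (regM (8 * s * R ^+ 3 * 2)) => //; rewrite !mulf_neq0 ?expf_neq0.
exact: lt6_ind.
Qed.

Let b_sc : struct_const b (table4 a0 R s t b1 c2).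
Proof.
apply: le_lt6_ind; [apply: lt6_ind; rewrite combE /=; ring|..]; rewrite combE /=.
- by rewrite -expr2 Rtt; ring.
- by rewrite Rtz; ring.
- by rewrite Rte; ring.
- by rewrite Rte2; ring.
- by rewrite Rtg; ring.
- by rewrite -expr2 Rzz; ring.
- by rewrite Rze; ring.
- by rewrite Rze2; ring.
- by rewrite Rzg; ring.
- by rewrite -expr2 Ree Re2E; ring.
- by rewrite Ree2 RgE def_E; ring.
- by rewrite mulrC Rge def_E; ring.
- by rewrite -expr2 Re2e2 mulrBl Rge def_E; ring.
- by rewrite mulrC Rge2; ring.
by rewrite -expr2 Rgg; ring.
Qed.

(** Coordinates on [b] of et e2 / 2. *)
Let nu : seq int := [:: b1 - 8 * a0 * b1; b1 - 4 * R * c2; - 2 * b1; 0; 0; 8 * a0 - 1].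
Let u := comb (fun i => nu`_i) b.

Let def_u : u = (ga - b1%:~R) * E.
Proof. by rewrite /u combE /= RgE def_E; ring. Qed.

Let Ou : OK u. Proof. exact: OK_comb. Qed.

Let nil2_cube x : ev (x ^+ 3) -> OK x -> @nil2 K x.
Proof.
move=> ev_x Ox; do 2!apply: nil2_sqr; apply: ev_nil2.
have -> : x ^+ 2 ^+ 2 = x * x ^+ 3 by ring.
exact: evMl.
Qed.

Let et_nil : nil2 et.
Proof. by apply: nil2_cube => //; rewrite et3; apply: ev2; int_tac. Qed.

Let e2_nil : nil2 e2.
Proof. by apply: nil2_cube => //; rewrite e23; apply: ev2; int_tac. Qed.

Let nil_parity n : nil2 (comb n b) ->
  [/\ (2 %| n 0%N)%Z, (2 %| n 1%N)%Z, (2 %| n 2%N)%Z & (2 %| n 5%N)%Z].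
Proof.
move=> nil_n; have H p pq p0 := @hom_nil2 _ _ _ free_b b_sc erefl p [::] pq p0 erefl n nil_n.
have [+ _] := H _ (hom4_A a0 R s t c2 b1_odd) erefl.
have [+ _] := H _ (hom4_B a0 R s t b1 c2) erefl.
have [+ _] := H _ (hom4_C a0 R s t b1 c2) erefl.
have [+ _] := H _ (hom4_R a0 R s t b1 c2) erefl; rewrite !dotpE /=; clear.
by move: (n 0%N) (n 1%N) (n 2%N) (n 3%N) (n 4%N) (n 5%N) => *; split; lia.
Qed.

Let comb_nil n : (2 %| n 0%N)%Z -> (2 %| n 1%N)%Z -> (2 %| n 2%N)%Z -> (2 %| n 5%N)%Z ->
  ev (comb n b - ((n 3%N)%:~R * et + (n 4%N)%:~R * e2)).
Proof.
move=> n0 n1 n2 n5.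
have -> : comb n b - ((n 3%N)%:~R * et + (n 4%N)%:~R * e2) =
    comb (fun i => [:: n 0%N; n 1%N; n 2%N; 0; 0; n 5%N]`_i) b.
  by rewrite !combE /=; ring.
by apply: ev_comb => //; apply: lt6_ind.
Qed.

Let nil_of_parity n : (2 %| n 0%N)%Z -> (2 %| n 1%N)%Z -> (2 %| n 2%N)%Z ->
  (2 %| n 5%N)%Z -> nil2 (comb n b).
Proof.
move=> n0 n1 n2 n5; rewrite -[comb n b](subrK ((n 3%N)%:~R * et + (n 4%N)%:~R * e2)).
apply: nil2D; first exact/ev_nil2/comb_nil.
by apply: nil2D; apply: nil2Ml => //; exact: OK_int.
Qed.

(* The element u is a unit modulo the prime containing et and e2. *)
Let u_odd (k : int) : nil2 (k%:~R * u) -> (2 %| k)%Z.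
Proof.
rewrite -combZ => /(hom_nil2 free_b b_sc erefl (@hom4_R _ _ _ _ _ _) erefl erefl)[+ _].
rewrite dotpE /= !mulr0 !addr0 mulr1 => even_k.
have : (2 %| k * b1)%Z by move: even_k; clear; lia.
by rewrite !dvdzE abszM Euclid_dvdM // -!dvdzE (negPf b1_odd) orbF.
Qed.

(** Multiplication by [e2] turns [et] into 2 u; after cancelling 2, k u is nilpotent modulo 2 and
    [u_odd] applies. *)
Let mul_et_odd (k : int) y : ev (k%:~R * et + y) -> OK y ->
  (exists2 z, nil2 z & y * e2 = 2%:R * z) -> (2 %| k)%Z.
Proof.
move=> /evP[x Ox def_x] Oy [z nil_z def_z]; apply: u_odd.
have -> : k%:~R * u = x * e2 - z.
  apply: (mulfI (two_neq0 K)); transitivity (k%:~R * (et * e2)); first by rewrite Ree2 def_u; ring.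
  by transitivity ((k%:~R * et + y) * e2 - y * e2); [ring | rewrite def_x def_z; ring].
by apply: nil2B => //; apply: nil2Ml.
Qed.

Let mul_e2_odd (k : int) y : ev (k%:~R * e2 + y) -> OK y ->
  (exists2 z, nil2 z & y * et = 2%:R * z) -> (2 %| k)%Z.
Proof.
move=> /evP[x Ox def_x] Oy [z nil_z def_z]; apply: u_odd.
have -> : k%:~R * u = x * et - z.
  apply: (mulfI (two_neq0 K)); transitivity (k%:~R * (et * e2)); first by rewrite Ree2 def_u; ring.
  by transitivity ((k%:~R * e2 + y) * et - y * et); [ring | rewrite def_x def_z; ring].
by apply: nil2B => //; apply: nil2Ml.
Qed.

Let et_e2_odd (k l : int) : ev (k%:~R * et + l%:~R * e2) -> (2 %| k)%Z /\ (2 %| l)%Z.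
Proof.
move=> ev_kl; have OZ := @OK_int K.
have nil0 : nil2 (0 : K) by apply/ev_nil2/ev0.
have Oke : OK (k%:~R * et) by apply: OKM.
have Ole : OK (l%:~R * e2) by apply: OKM.
(* The coefficient of the element of valuation 1/3 comes first: multiplying by the element of
   valuation 2/3 turns the other term into twice a nilpotent. *)
case: st => [[s1 t2]|[s2 t1]].
  have even_k : (2 %| k)%Z.
    apply: mul_et_odd ev_kl Ole _; exists (l%:~R * ((ga - b1%:~R) * et)).
      by do 2!apply: nil2Ml => //.
    by rewrite -mulrA -expr2 Re2e2 t2; ring.
  split=> //; apply: (@mul_e2_odd _ 0); [|exact: OK0|by exists 0; rewrite ?mul0r ?mulr0].
  rewrite addr0 -[X in ev X](addKr (k%:~R * et)) addrC; apply: evB => //.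
  by apply: evMr => //; apply: ev_int.
have even_l : (2 %| l)%Z.
  rewrite addrC in ev_kl; apply: mul_e2_odd ev_kl Oke _; exists (k%:~R * (E * e2)).
    by do 2!apply: nil2Ml => //.
  by rewrite -mulrA -expr2 Ree s2; ring.
split=> //; apply: (@mul_et_odd _ 0); [|exact: OK0|by exists 0; rewrite ?mul0r ?mulr0].
rewrite addr0 -[X in ev X](addrK (l%:~R * e2)); apply: evB => //.
by apply: evMr => //; apply: ev_int.
Qed.

Let ind_b : indep2 b.
Proof.
move=> n ev_n; have [n0 n1 n2 n5] := nil_parity (ev_nil2 ev_n).
have [] := @et_e2_odd (n 3%N) (n 4%N); last by move=> n3 n4; exact: lt6_ind.
by rewrite -[X in ev X](subKr (comb n b)); apply: evB => //; apply: comb_nil.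
Qed.

Let frob2 n : nil2 (comb n b ^+ (2 ^ 1) - comb n b).
Proof.
have [m def_m] := comb_frob b_sc erefl n 2; rewrite expn1 -def_m.
have H p pq p0 := @hom_frob2 _ _ _ free_b b_sc erefl p [::] pq p0 erefl n m erefl def_m.
have := H _ (hom4_A a0 R s t c2 b1_odd) erefl.
have := H _ (hom4_B a0 R s t b1 c2) erefl.
have := H _ (hom4_C a0 R s t b1 c2) erefl.
have := H _ (hom4_R a0 R s t b1 c2) erefl; rewrite !dotpE /= => *.
by apply: nil_of_parity; lia.
Qed.

Let b4 := [:: 1; th; ze; ga].

Let ind_b4 (n : nat -> int) : nil2 (\sum_(i < 4) (n i)%:~R * b4`_i) ->
  forall i, (i < 4)%N -> (2 %| n i)%Z.
Proof.
have -> : \sum_(i < 4) (n i)%:~R * b4`_i =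
    comb (fun i => [:: n 0%N; n 1%N; n 2%N; 0; 0; n 3%N]`_i) b.
  by rewrite combE !big_ord_recr big_ord0 /=; ring.
by move/nil_parity => /= [h0 h1 h2 h5]; do 4?[case=> [|]] => // _.
Qed.

Section Upper.

Variables (pi pi2 y v : K) (k : int) (M1 M2 : seq int).
Hypotheses (Opi : OK pi) (Oy : OK y) (Ov : OK v).
Hypotheses (th_pi : th * pi = 2%:R * y) (pi3 : pi ^+ 3 = 2%:R * v).
Hypotheses (ev_yth : ev (y * th)) (ev_ypi : ev (y * pi)) (pi_sqr : ev (pi ^+ 2 - pi2)).
Hypotheses (ev_v : ev (v - (1 + th + ga + k%:~R * e2))) (ev_vpi : ev (v * pi - pi)).

(** [pi] is whichever of [et], [e2] has valuation 1/3 at the prime with e = 3, [pi2] is its square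
    modulo 2 and v = pi^3 / 2, so both values of [s] are treated at once. theta has larger valuation
    there, so [al] is a uniformizer. *)
Let al := th + pi.
(** The expansion of al^3 (al + 1) / 2. This is integral: al^3 is even at the primes where al has
    residue 0, and al + 1 is even where it has residue 1. *)
Let be := th ^+ 2 * ze + y * th * (4%:R * th + 3%:R) + y * pi * (6%:R * th + 3%:R)
  + v * (4%:R * th + 1) + v * pi.

Let Oal : OK al. Proof. by rewrite /al; int_tac. Qed.
Let Obe : OK be. Proof. by rewrite /be; int_tac. Qed.

Let two_be : 2%:R * be = al ^+ 4 + al ^+ 3.
Proof.
have -> : 2%:R * be = th ^+ 3 * (th + 1) + 2%:R * y * th * (4%:R * th + 3%:R)
    + 2%:R * y * pi * (6%:R * th + 3%:R) + 2%:R * v * (4%:R * th + 1 + pi).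
  by rewrite /be /ze; field; nz_tac.
by rewrite -th_pi -pi3 /al; ring.
Qed.

Let ev_thpi : ev (th * pi). Proof. by rewrite th_pi; apply: ev2. Qed.

Let al2 : ev (al ^+ 2 - (th + pi2)).
Proof.
have -> : al ^+ 2 - (th + pi2) = 2%:R * (ze - th + th * pi) + (pi ^+ 2 - pi2).
  by rewrite /al /ze; field; nz_tac.
by apply: evD => //; apply: ev2; int_tac.
Qed.

Let al3 : ev (al ^+ 3 - th).
Proof.
have -> : al ^+ 3 - th = 2%:R * (R%:~R * et - 4%:R * a0%:~R * th) + th * pi * (3%:R * al) + pi ^+ 3.
  by rewrite /al /et /E; field; nz_tac.
apply: evD; last by rewrite pi3; apply: ev2.
by apply: evD; [apply: ev2|apply: evMr => //]; int_tac.
Qed.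

Let ev_tz : ev (th * ze - (ze + R%:~R * et)).
Proof. by rewrite Rtz; apply: (evE (y := - (2%:R * a0%:~R * th))); [int_tac | ring]. Qed.

Let ev_tet : ev (th * et).
Proof. by rewrite Rte -!mulrA; apply: ev2; int_tac. Qed.

Let ev_ttz : ev (th ^+ 2 * ze - (ze + R%:~R * et)).
Proof.
have -> : th ^+ 2 * ze - (ze + R%:~R * et) = th * (th * ze - (ze + R%:~R * et))
    + (R%:~R * (th * et) + (th * ze - (ze + R%:~R * et))) by ring.
by apply: evD; [apply: evMl | apply: evD => //; apply: evMl => //; apply: OK_int].
Qed.

Let be_W : ev (be - th ^+ 2 * ze - v - pi).
Proof.
have -> : be - th ^+ 2 * ze - v - pi = y * th * (4%:R * th + 3%:R)
  + y * pi * (6%:R * th + 3%:R) + 2%:R * (2%:R * v * th) + (v * pi - pi) by rewrite /be; ring.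
apply: evD => //; apply: evD; last by apply: ev2; int_tac.
by apply: evD; apply: evMr => //; int_tac.
Qed.

Let be_ev : ev (be - (1 + th + ze + R%:~R * et + k%:~R * e2 + pi + ga)).
Proof.
have -> : be - (1 + th + ze + R%:~R * et + k%:~R * e2 + pi + ga) =
  (be - th ^+ 2 * ze - v - pi) + (th ^+ 2 * ze - (ze + R%:~R * et))
  + (v - (1 + th + ga + k%:~R * e2)) by ring.
by apply: evD => //; apply: evD.
Qed.

Let ev_thv : ev (th * v).
Proof.
have -> : th * v = th * (v - (1 + th + ga + k%:~R * e2))
    + (th + th ^+ 2 + th * ga + k%:~R * (th * e2)) by ring.
apply: evD; first exact: evMl.
apply: (evE (y := ze - 2%:R * R%:~R * c2%:~R + 2%:R * R%:~R * k%:~R * (ga - b1%:~R))).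
  by int_tac.
by rewrite Rtg Rte2 Rtt; ring.
Qed.

Let albe_ev : ev (al * be - (ze + R%:~R * et + pi + pi2)).
Proof.
have -> : al * be - (ze + R%:~R * et + pi + pi2) =
    al * (be - th ^+ 2 * ze - v - pi) + th * (th ^+ 2 * ze - (ze + R%:~R * et))
    + R%:~R * (th * et) + (th * ze - (ze + R%:~R * et)) + th * v + th * pi * (1 + th * ze)
    + (v * pi - pi) + (pi ^+ 2 - pi2) by rewrite /al; ring.
repeat apply: evD => //; try by apply: evMl => //; int_tac.
by apply: evMr => //; int_tac.
Qed.

Lemma ind_upper4 : (M1, M2) = ([:: 0; 0; 0; 1], [:: 0; 0; 0; 0; 1]) \/
    (M1, M2) = ([:: 0; 0; 0; 0; 1], [:: 0; 0; 0; 1]) ->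
  pi = comb (fun i => M1`_i) b -> pi2 = comb (fun i => M2`_i) b ->
  exists2 al : K, OK al & [/\ primitive_elt al, ind al != 0%N & (logn 2 (ind al) <= 2)%N].
Proof.
move=> M12 def_pi def_pi2; exists al => //.
have gA := Zadjoin_subgrp al; have gA1 := adjZ_subgrp be gA.
have OZ := @OK_int K; have OkE : OK (k%:~R * e2 + R%:~R * et) by int_tac.
apply: (@ind_upper _ _ _ mon_f f_irr f_th K_th size_f al [:: be; al * be]
  [:: 1; al; al ^+ 2; al ^+ 3; be; al * be] Oal).
- by move=> x; rewrite !inE => /orP[] /eqP->; int_tac.
- split; first by rewrite two_be; zadj_tac.
  by split=> //; apply: sub_adjZ; rewrite mulrCA two_be; zadj_tac.
- pose M := [:: [:: 1]; [:: 0; 1; 0; M1`_3; M1`_4]; [:: 0; 1; 0; M2`_3; M2`_4]; [:: 0; 1];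
    [:: 1; 1; 1; M1`_3 + R; M1`_4 + k; 1]; [:: 0; 0; 1; M1`_3 + M2`_3 + R; M1`_4 + M2`_4]].
  apply: (indep2_change (M := M) ind_b).
    have {}def_pi : pi = (M1`_3)%:~R * et + (M1`_4)%:~R * e2.
      by rewrite def_pi combE; case: M12 => [[-> _]|[-> _]] /=; ring.
    have {}def_pi2 : pi2 = (M2`_3)%:~R * et + (M2`_4)%:~R * e2.
      by rewrite def_pi2 combE; case: M12 => [[_ ->]|[_ ->]] /=; ring.
    apply: lt6_ind; rewrite combE /=.
    + by apply: (evE (OK0 K)); ring.
    + by apply: (evE (OK0 K)); rewrite /al def_pi; ring.
    + by congr ev: al2; rewrite def_pi2; ring.
    + by congr ev: al3; ring.
    + by congr ev: be_ev; rewrite def_pi; ring.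
    + by congr ev: albe_ev; rewrite def_pi def_pi2; ring.
  move=> n H.
  have := H 0%N isT; have := H 1%N isT; have := H 2%N isT; have := H 3%N isT;
  have := H 4%N isT; have := H 5%N isT; rewrite !big_ord_recr !big_ord0 /=; clear -M12.
  (* [R] and [k] are unknown entries of [M]: n 4 and n 5 are first written as explicit multiples of
     2, so that their products with [R] and [k] are visibly even. *)
  rewrite ?(mulr0, mulr1, addr0, add0r) => /dvdzP[m4 def4]; rewrite def4.
  by case: M12 => -[-> ->] /= H4 H3 H2 H1 H0;
    have /dvdzP[m5 def5] : (2 %| n 5%N)%Z by [lia];
    apply: lt6_ind; rewrite ?def4 ?def5 in H4 H3 H2 H1 H0 *; lia.
apply: lt6_ind.
- by do 2!apply: sub_adjZ; zadj_tac.
- by do 2!apply: sub_adjZ; zadj_tac.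
- by do 2!apply: sub_adjZ; zadj_tac.
- by do 2!apply: sub_adjZ; zadj_tac.
- by apply: sub_adjZ; apply: mem_adjZ.
by apply: mem_adjZ.
Qed.

End Upper.

Let ev_gbE : ev ((ga - b1%:~R) * E - (1 + th + ga)).
Proof.
have -> : (ga - b1%:~R) * E - (1 + th + ga) = 2%:R * ((4%:R * a0%:~R - 1) * ga
    - 2%:R * R%:~R * c2%:~R * th - b1%:~R * (ze + 4%:R * a0%:~R)) + (b1 - 1)%:~R * (th + 1).
  by rewrite RgE def_E rmorphB /=; ring.
apply: evD; first by apply: ev2; int_tac.
by apply: evMr; [apply: ev_int; lia | int_tac].
Qed.

Let ev_ga_et : ev (ga * et).
Proof. by apply: (evE (y := - (c2%:~R * E))); [int_tac | rewrite Rge; ring]. Qed.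

Let upper : exists2 al : K, OK al &
  [/\ primitive_elt al, ind al != 0%N & (logn 2 (ind al) <= 2)%N].
Proof.
case: st => [[s1 t2]|[s2 t1]].
  have ev_v : ev (s%:~R * ((ga - b1%:~R) * E ^+ 2) - (1 + th + ga + 0%:~R * e2)).
    have -> : s%:~R * ((ga - b1%:~R) * E ^+ 2) - (1 + th + ga + 0%:~R * e2) =
        E * ((ga - b1%:~R) * E - (1 + th + ga)) + ((E + th - 1) * (1 + th + ga) - (th + th ^+ 2 + th * ga)).
      by rewrite s1; ring.
    apply: evD; first exact: evMl.
    apply: (evE (y := (ze + 4%:R * a0%:~R - 1) * (1 + th + ga) - ze + 2%:R * R%:~R * c2%:~R)).
      by int_tac.
    by rewrite def_E Rtt Rtg; ring.
  apply: (@ind_upper4 et e2 (R%:~R * s%:~R * e2) (s%:~R * ((ga - b1%:~R) * E ^+ 2)) 0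
    [:: 0; 0; 0; 1] [:: 0; 0; 0; 0; 1]) => //; try by int_tac.
  - by rewrite Rte; ring.
  - apply: (evE (y := 2%:R * R%:~R * s%:~R * (R%:~R * (ga - b1%:~R)))); first by int_tac.
    transitivity (R%:~R * s%:~R * (th * e2)); [ring | rewrite Rte2; ring].
  - apply: (evE (y := R%:~R * s%:~R * ((ga - b1%:~R) * E))); first by int_tac.
    transitivity (R%:~R * s%:~R * (et * e2)); [ring | rewrite Ree2; ring].
  - apply: (evE (y := (4%:R * a0%:~R - 1) * e2
      - 2%:R * R%:~R * (4%:R * R%:~R * c2%:~R + b1%:~R * th))); first by int_tac.
    by rewrite Ree Re2E s1; ring.
  - set v := _ * _ in ev_v *; have Ov : OK v by rewrite /v; int_tac.
    have -> : v * et - et = (v - (1 + th + ga + 0%:~R * e2)) * et + th * et + ga * et by ring.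
    apply: evD => //; apply: evD; first exact: evMr.
    by rewrite Rte -!mulrA; apply: ev2; int_tac.
  - by left.
  - by rewrite combE /=; ring.
  by rewrite combE /=; ring.
have ev_b1 x : OK x -> ev ((b1 + 1)%:~R * x).
  by move=> Ox; apply: evMr => //; apply: ev_int; lia.
have ev_v : ev (t%:~R * ((ga - b1%:~R) ^+ 2 * E) - (1 + th + ga + c2%:~R * e2)).
  have -> : t%:~R * ((ga - b1%:~R) ^+ 2 * E) - (1 + th + ga + c2%:~R * e2) =
      (ga - b1%:~R) * ((ga - b1%:~R) * E - (1 + th + ga)) + (th * ga + ga ^+ 2 - b1%:~R * ga
      - c2%:~R * e2 - (b1 + 1)%:~R * (1 + th)) by rewrite t1 rmorphD /=; ring.
  apply: evD; first exact: evMl.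
  apply: evB; last by apply: ev_b1; int_tac.
  apply: (evE (y := - (2%:R * R%:~R * c2%:~R) - c2%:~R * e2)); first by int_tac.
  by rewrite Rtg Rgg; ring.
apply: (@ind_upper4 e2 et (2%:R * R%:~R * (ga - b1%:~R)) (t%:~R * ((ga - b1%:~R) ^+ 2 * E)) c2
  [:: 0; 0; 0; 0; 1] [:: 0; 0; 0; 1]) => //; try by int_tac.
- by rewrite Rte2; ring.
- by rewrite -!mulrA; apply: ev2; int_tac.
- by rewrite -!mulrA; apply: ev2; int_tac.
- have -> : e2 ^+ 2 - et = ga * et - (b1 + 1)%:~R * et by rewrite Re2e2 t1 rmorphD /=; ring.
  by apply: evB => //; apply: ev_b1.
- set v := _ * _ in ev_v *; have Ov : OK v by rewrite /v; int_tac.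
  have -> : v * e2 - e2 = (v - (1 + th + ga + c2%:~R * e2)) * e2 + th * e2
    + (ga * e2 + c2%:~R * e2 ^+ 2) by ring.
  apply: evD; last first.
    have -> : ga * e2 + c2%:~R * e2 ^+ 2 = c2%:~R * (ga * et - (b1 + 1)%:~R * et).
      by rewrite Rge2 Re2e2 t1 rmorphD /=; ring.
    by apply: evMl; [exact: OK_int | apply: evB => //; apply: ev_b1].
  apply: evD; first exact: evMr.
  by rewrite Rte2; apply: (evE (y := 2%:R * (R%:~R * (ga - b1%:~R)))); [int_tac | ring].
- by right.
- by rewrite combE /=; ring.
by rewrite combE /=; ring.
Qed.

Lemma field_index4 : vp 2 (field_index K) = 2%N /\ ((0 < 2)%N -> ~ monogenic K).
Proof.
have dimK := dimK6 f_irr f_th K_th size_f.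
apply: vp2_field_index => [be Obe|]; last exact: upper.
have Ob4 i : OK b4`_i by do 4?[case: i => [|i] //]; rewrite /b4 /= ?nth_nil; int_tac.
exact: (ind_lower_frob mon_f f_irr f_th K_th size_f (nil2_exp_sub Ob dimK ind_b frob2)
  isT Ob4 ind_b4 Obe).
Qed.

End Degree4.

(** * The theorem *)

Lemma dvdz_vp2 k (c : int) : (k <= vp 2 c)%N -> (2 ^+ k %| c)%Z.
Proof.
have [->|c_neq0] := eqVneq c 0; first by rewrite dvdz0.
by rewrite dvdzE abszX -pfactor_dvdn ?absz_gt0.
Qed.

Lemma vp2_ge k (c : int) : c != 0 -> (2 ^+ k %| c)%Z -> (k <= vp 2 c)%N.
Proof. by move=> c_neq0; rewrite dvdzE abszX -pfactor_dvdn ?absz_gt0. Qed.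

Lemma vp2_split (b : int) : b != 0 -> exists2 b1, ~~ (2 %| b1)%Z & b = 2 ^+ vp 2 b * b1.
Proof.
move=> b_neq0; have /dvdzP[b1 def_b] := dvdz_vp2 (leqnn (vp 2 b)).
exists b1; last by rewrite mulrC.
apply/negP => even_b1; have : ((vp 2 b).+1 <= vp 2 b)%N.
  by apply: vp2_ge => //; rewrite exprS [X in (_ %| X)%Z]def_b dvdz_mul.
by rewrite ltnn.
Qed.

Lemma sextic_monic (m : nat) (a b c : int) : (m < 6)%N ->
  let f := 'X^6 + a *: 'X^m + b *: 'X + c%:P : {poly int} in f \is monic /\ size f = 7%N.
Proof.
move=> ltm f.
have size_g : (size (a *: 'X^m + b *: 'X + c%:P : {poly int})%R <= 6)%N.
  apply: leq_trans (size_polyD _ _) _; rewrite geq_max; apply/andP; split; last first.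
    by apply: leq_trans (size_polyC_leq1 c) _.
  apply: leq_trans (size_polyD _ _) _; rewrite geq_max; apply/andP; split.
    by apply: leq_trans (size_scale_leq _ _) _; rewrite size_polyXn.
  by apply: leq_trans (size_scale_leq _ _) _; rewrite size_polyX.
by rewrite /f -2!addrA [_ *: 'X^m + _]addrA; exact: monic_XnD size_g.
Qed.

Lemma sextic_eq (K : fieldExtType rat) (th : K) (m : nat) (a b c : int) :
  root (map_poly intr ('X^6 + a *: 'X^m + b *: 'X + c%:P : {poly int})) th ->
  th ^+ 6 = - (a%:~R * th ^+ m + b%:~R * th + c%:~R).
Proof.
rewrite /root !rmorphD /= !map_polyZ /= !map_polyXn map_polyX map_polyC /=.
by rewrite !hornerE => /eqP h; apply/eqP; rewrite -subr_eq0 opprK !addrA h.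
Qed.

(** The number is f(-1). It must be known to be nonzero because [vp 2 0] is 0: a divisibility bounds
    the valuation from below only for nonzero numbers. *)
Lemma sextic_neq0_m1 (a b c : int) :
  irreducible_poly (map_poly intr ('X^6 + a *: 'X^2 + b *: 'X + c%:P : {poly int}) : {poly rat}) ->
  a + 1 - b + c != 0.
Proof.
set p := map_poly _ _ => irr_p; apply/eqP => eq0.
have [_ size_f] := @sextic_monic 2 a b c isT.
have size_p : size p = 7%N by rewrite size_map_poly_id0 ?size_f // intr_eq0 lead_coef_eq0 -size_poly_eq0 size_f.
have root_p : ('X - (-1)%:P) %| p.
  rewrite dvdp_XsubCl /root /p !rmorphD /= !map_polyZ /= !map_polyXn map_polyX map_polyC /=.
  by rewrite !hornerE /= -[X in _ == X]/(0%:~R) -eq0 !rmorphD rmorphN /=; apply/eqP; ring.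
have := irr_p.2 ('X - (-1)%:P); rewrite size_XsubC => /(_ isT root_p)/eqp_size.
by rewrite size_XsubC size_p.
Qed.

Section Assembly.

Variables (K : fieldExtType rat) (th : K) (a b c : int).
Hypotheses (K_th : primitive_elt th) (hb : (8 %| b)%Z) (b_neq0 : b != 0).

Local Notation sextic m := ('X^6 + a *: 'X^m + b *: 'X + c%:P : {poly int}).

Let vb3 : (3 <= vp 2 b)%N. Proof. by apply: vp2_ge. Qed.

Lemma degree2_index :
    irreducible_poly (map_poly intr (sextic 2) : {poly rat}) ->
    root (map_poly intr (sextic 2)) th -> (8 %| a + 1)%Z -> (2 * vp 2 b < vp 2 c)%N ->
  ((3 < vp 2 (a + 1 - b + c)%R)%N -> vp 2 (field_index K) = 4%N /\ ~ monogenic K) /\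
  (vp 2 (a + 1 - b + c) = 3%N -> vp 2 (field_index K) = 1%N /\ ~ monogenic K).
Proof.
move=> f_irr f_th /dvdzP[a0 def_a1] hbc.
have def_a : a = 8 * a0 - 1 by rewrite mulrC -def_a1 addrK.
have [mon_f size_f] := @sextic_monic 2 a b c isT.
have [b1 b1_odd def_b] := vp2_split b_neq0.
pose g : int := 2 ^+ (vp 2 b - 3).
have g_neq0 : g != 0 by rewrite expf_neq0.
have {}def_b : b = 8 * g * b1 by rewrite {1}def_b -{1}(subnKC vb3) exprD.
(* 128 g^2 = 2^(2 v_2(b) + 1), exactly what the strict inequality grants. *)
have /dvdzP[c3 def_c] : (128 * g ^+ 2 %| c)%Z.
  have -> : 128 * g ^+ 2 = 2 ^+ (7 + (vp 2 b - 3) * 2) by rewrite exprD exprM.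
  by apply: dvdz_vp2; lia.
have f_eq : th ^+ 6 = - ((8%:R * a0%:~R - 1) * th ^+ 2 + 8%:R * g%:~R * b1%:~R * th
    + 128%:R * g%:~R ^+ 2 * c3%:~R).
  by rewrite (sextic_eq f_th) def_a def_b def_c !(rmorphB, rmorphM, rmorphXn) /=; ring.
have neq0 := sextic_neq0_m1 f_irr.
(* Hence the valuation exceeds 3 exactly when a0 + g b1 is even. *)
have def_n : a + 1 - b + c = 8 * (a0 - g * b1 + 16 * g ^+ 2 * c3).
  by rewrite def_a def_b def_c; ring.
split=> hn.
  have := dvdz_vp2 hn; rewrite def_n (_ : 2 ^+ 4 = 8 * 2) // dvdz_mul2l // => even_n.
  have sig : (2 %| a0 + g * b1)%Z by move: even_n; clear; lia.
  have [-> nm] := field_index2_even mon_f f_irr f_th K_th size_f g_neq0 b1_odd f_eq sig.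
  by split=> //; exact: nm.
have sig : ~~ (2 %| a0 + g * b1)%Z.
  apply/negP => even_n; suff: (4 <= vp 2 (a + 1 - b + c)%R)%N by rewrite hn.
  apply: vp2_ge => //; rewrite def_n (_ : 2 ^+ 4 = 8 * 2) // dvdz_mul2l //.
  by move: even_n; clear; lia.
have [-> nm] := field_index2_odd mon_f f_irr f_th K_th size_f g_neq0 b1_odd f_eq sig.
by split=> //; exact: nm.
Qed.

Lemma degree3_index :
    irreducible_poly (map_poly intr (sextic 3) : {poly rat}) ->
    root (map_poly intr (sextic 3)) th -> (8 %| a - 1)%Z -> (3 * vp 2 b < 2 * vp 2 c)%N ->
    gcdn (vp 2 b) 2 = 1%N ->
  vp 2 (field_index K) = 1%N /\ ~ monogenic K.
Proof.
move=> f_irr f_th ha hbc co_vb.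
have [mon_f size_f] := @sextic_monic 3 a b c isT.
have [b1 b1_odd def_b] := vp2_split b_neq0.
have odd_vb : odd (vp 2 b) by rewrite -coprimen2 /coprime co_vb.
have def_vb : vp 2 b = ((vp 2 b)./2 * 2 + 1)%N by rewrite muln2 addn1 -{1}(odd_double_half (vp 2 b)) odd_vb.
set q := (vp 2 b)./2 in def_vb; pose Q : int := 2 ^+ q.
have Q_neq0 : Q != 0 by rewrite expf_neq0.
have Q_even : (2 %| Q)%Z by rewrite -[X in (X %| _)%Z]expr1 dvdz_exp2l; lia.
have a_odd : ~~ (2 %| a)%Z by move: ha; clear; lia.
have {}def_b : b = 2 * Q ^+ 2 * b1 by rewrite {1}def_b def_vb exprD exprM /Q; ring.
(* With v_2(b) = 2 q + 1 the inequality reads v_2(c) >= 3 q + 2. *)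
have /dvdzP[c2 def_c] : (4 * Q ^+ 3 %| c)%Z.
  have -> : 4 * Q ^+ 3 = 2 ^+ (2 + q * 3) by rewrite exprD exprM.
  by apply: dvdz_vp2; lia.
have f_eq : th ^+ 6 = - (a%:~R * th ^+ 3 + 2%:R * Q%:~R ^+ 2 * b1%:~R * th
    + 4%:R * Q%:~R ^+ 3 * c2%:~R).
  by rewrite (sextic_eq f_th) def_b def_c !(rmorphM, rmorphXn) /=; ring.
have [-> nm] := field_index3 mon_f f_irr f_th K_th size_f Q_neq0 Q_even a_odd b1_odd f_eq.
by split=> //; exact: nm.
Qed.

Lemma degree4_index :
    irreducible_poly (map_poly intr (sextic 4) : {poly rat}) ->
    root (map_poly intr (sextic 4)) th -> (8 %| a + 1)%Z -> (4 * vp 2 b < 3 * vp 2 c)%N ->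
    gcdn (vp 2 b) 3 = 1%N ->
  vp 2 (field_index K) = 2%N /\ ~ monogenic K.
Proof.
move=> f_irr f_th /dvdzP[a0 def_a1] hbc co_vb.
have def_a : a = 8 * a0 - 1 by rewrite mulrC -def_a1 addrK.
have [mon_f size_f] := @sextic_monic 4 a b c isT.
have [b1 b1_odd def_b] := vp2_split b_neq0.
have vb3' : ~~ (3 %| vp 2 b)%N by rewrite -prime_coprime // coprime_sym /coprime co_vb.
(* 2^v_2(b) = 2 s Q^3 with Q = 2 R, hence the predecessor; the quotient is positive since v_2(b) >=
   3. *)
pose r : nat := ((vp 2 b) %/ 3).-1.
have [e [def_vb e12]] : exists e : nat, vp 2 b = (e + 3 + r * 3)%N /\ (e = 1%N \/ e = 2%N).
  by exists (vp 2 b %% 3)%N; rewrite /r; lia.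
pose R : int := 2 ^+ r; pose s : int := 2 ^+ (e - 1); pose t : int := 2 ^+ (2 - e).
have R_neq0 : R != 0 by rewrite expf_neq0.
have st : s = 1 /\ t = 2 \/ s = 2 /\ t = 1.
  by rewrite /s /t; case: e12 => ->; [left | right].
have def_2s : 2 ^+ e = 2 * s by rewrite /s; case: e12 => ->.
have {}def_b : b = 16 * s * R ^+ 3 * b1.
  by rewrite {1}def_b def_vb !exprD exprM def_2s /R; ring.
have /dvdzP[c2 def_c] : (64 * s * R ^+ 4 %| c)%Z.
  have -> : 64 * s * R ^+ 4 = 2 ^+ (e + 5 + r * 4) by rewrite !exprD exprM def_2s /R; ring.
  by apply: dvdz_vp2; lia.
have f_eq : th ^+ 6 = - ((8%:R * a0%:~R - 1) * th ^+ 4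
    + 16%:R * s%:~R * R%:~R ^+ 3 * b1%:~R * th + 64%:R * s%:~R * R%:~R ^+ 4 * c2%:~R).
  by rewrite (sextic_eq f_th) def_a def_b def_c !(rmorphB, rmorphM, rmorphXn) /=; ring.
have [-> nm] := field_index4 mon_f f_irr f_th K_th size_f R_neq0 st b1_odd f_eq.
by split=> //; exact: nm.
Qed.

End Assembly.

Theorem theorem1p3 (m : nat) (a b c : int) (K : fieldExtType rat) (theta : K)
    (f := 'X^6 + a *: 'X^m + b *: 'X + c%:P : {poly int})
    (hm : m \in [:: 2; 3; 4]%N)
    (f_irr : irreducible_poly (map_poly intr f : {poly rat}))
    (f_theta : root (map_poly intr f) theta)
    (K_theta : primitive_elt theta)
    (ha : (8 %| a + (-1) ^+ m)%Z)
    (hb : (8 %| b)%Z)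
    (hc : (8 %| c)%Z)
    (b_neq0 : b != 0)
    (hbc : (m * vp 2 b < (m - 1) * vp 2 c)%N) :
  [/\ m = 2%N -> (vp 2 (a + 1 - b + c)%R > 3)%N ->
        vp 2 (field_index K) = 4%N,
      m = 2%N -> vp 2 (a + 1 - b + c) = 3%N ->
        vp 2 (field_index K) = 1%N,
      m = 3%N -> gcdn (vp 2 b) 2 = 1%N ->
        vp 2 (field_index K) = 1%N,
      m = 4%N -> gcdn (vp 2 b) 3 = 1%N ->
        vp 2 (field_index K) = 2%N &
      [\/ m = 2%N /\ (vp 2 (a + 1 - b + c)%R > 3)%N,
          m = 2%N /\ vp 2 (a + 1 - b + c) = 3%N,
          m = 3%N /\ gcdn (vp 2 b) 2 = 1%N |
          m = 4%N /\ gcdn (vp 2 b) 3 = 1%N] -> ~ monogenic K].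
Proof.
have H2 : m = 2%N ->
    ((3 < vp 2 (a + 1 - b + c)%R)%N -> vp 2 (field_index K) = 4%N /\ ~ monogenic K) /\
    (vp 2 (a + 1 - b + c) = 3%N -> vp 2 (field_index K) = 1%N /\ ~ monogenic K).
  move=> m2; rewrite /f m2 in f_irr f_theta ha hbc.
  by apply: degree2_index f_irr f_theta _ _ => //; rewrite mul1n in hbc.
have H3 : m = 3%N -> gcdn (vp 2 b) 2 = 1%N -> vp 2 (field_index K) = 1%N /\ ~ monogenic K.
  by move=> m3; rewrite /f m3 in f_irr f_theta ha hbc; apply: degree3_index f_irr f_theta _ _.
have H4 : m = 4%N -> gcdn (vp 2 b) 3 = 1%N -> vp 2 (field_index K) = 2%N /\ ~ monogenic K.
  by move=> m4; rewrite /f m4 in f_irr f_theta ha hbc; apply: degree4_index f_irr f_theta _ _.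
split.
- by move=> /H2[+ _] => H /H[].
- by move=> /H2[_ +] => H /H[].
- by move=> /H3 H /H[].
- by move=> /H4 H /H[].
by case=> -[]; [move=> /H2[+ _] | move=> /H2[_ +] | move=> /H3 | move=> /H4] => H /H[].
Qed.
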